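(* Let $Z=(Z_n)_{n\ge 0}$ be a subcritical Bienaymé--Galton--Watson process whose offspring distribution has mean $m\in(0,1)$, let $\nu_{\min}$ be its Yaglom limit and let $H(z)=\sum_{n\ge1}\nu_{\min}(n)z^n$. Then: 1. There exist no non-trivial (i.e. $\not\equiv 0$) $\lambda$-invariant measures for $Z$ with $\lambda<m$. 2. The only $m$-invariant measures of $Z$ are multiples of the Yaglom limit $\nu_{\min}$. 3. Let $\alpha\in(-\infty,1)$. A measure $\nu$ on $\mathbb{N}^*$ is an $m^\alpha$-invariant measure for $Z$ if and only if its generating function $G(z)=\sum_{n\ge 1}\nu(n)z^n$ satisfies $$G(z)=\int_0^\infty\left(e^{(H(z)-1)x}-e^{-x}\right)\frac{1}{x^\alpha}\,\Lambda(dx),\qquad |z|<1, \qquad ( * )$$ where $\Lambda$ is a locally finite measure on $(0,\infty)$ satisfying $\Lambda(A)=\Lambda(mA)$ for every Borel set $A\subset(0,\infty)$. The measure $\Lambda$ is uniquely determined from $\nu$. Moreover, for every such measure $\Lambda$, $( * )$ defines the generating function of an $m^\alpha$-invariant measure for $Z$ with radius of convergence at least $1$.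
   Context: $\mathbb{N}^*=\{1,2,\ldots\}$. All measures are non-negative and locally finite; on $\mathbb{N}^*$ this means $\nu(n)<\infty$ for every $n$. $P$ denotes the restriction to $\mathbb{N}^*$ of the transition matrix of $Z$ (i.e. the sub-stochastic transition matrix of $Z$ killed upon hitting $0$). A measure $\nu$ on $\mathbb{N}^*$, viewed as a row vector, is a $\lambda$-invariant measure for $Z$ if $\nu P=\lambda\nu$. $\mathbf{P}_1$ is the law of $Z$ started from $Z_0=1$. The Yaglom limit is the probability measure on $\mathbb{N}^*$ given by $\nu_{\min}=\lim_{n\to\infty}\mathbf{P}_1(Z_n\in\cdot\mid Z_n>0)$ (weak limit), which is known to exist. For $A\subset(0,\infty)$, $mA=\{ma:a\in A\}$. *)

(* Defs.v *)
From HB Require Import structures.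
From mathcomp Require Import all_boot all_order all_algebra.
From mathcomp Require Import complex.
From mathcomp Require Import all_classical all_reals all_analysis.

Set Implicit Arguments.
Unset Strict Implicit.
Unset Printing Implicit Defensive.

Import Order.TTheory GRing.Theory Num.Theory.
Import numFieldNormedType.Exports.

Local Open Scope classical_set_scope.
Local Open Scope ring_scope.
Local Open Scope complex_scope.

(* A measure on N^* is a measure on nat that does not charge 0; real-valued
   weights on singletons are exactly local finiteness for the discrete
   topology. *)
Definition Nstar_measure (R : realType) (nu : {measure set nat -> \bar R}) :
    Prop :=
  nu [set 0%N] = 0%E /\ forall n : nat, (nu [set n] < +oo)%E.

Definition weight (R : realType) (nu : {measure set nat -> \bar R}) (n : nat) :
    R := fine (nu [set n]).

(* bgw_trans p i j is the mass at j of the i-fold convolution of p, i.e. the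
   probability that i independent individuals with offspring law p have j
   children in total. *)
Fixpoint bgw_trans (R : realType) (p : probability nat R) (i j : nat) : R :=
  if i is i'.+1 then
    \sum_(k < j.+1) weight p k * bgw_trans p i' (j - k)%N
  else (j == 0%N)%:R.

(* Markov chain with transition matrix bgw_trans p started from z0, written
   through its finite-dimensional distributions. *)
Definition bgw_process (d : measure_display) (Omega : measurableType d)
    (R : realType) (p : probability nat R) (z0 : nat)
    (P : probability Omega R) (Z : nat -> {RV P >-> nat}) : Prop :=
  P [set w | Z 0%N w = z0] = 1%E /\
  forall (x : nat -> nat) (n : nat),
    P [set w | forall k, (k <= n.+1)%N -> Z k w = x k] =
    (P [set w | forall k, (k <= n)%N -> Z k w = x k]
      * (bgw_trans p (x n) (x n.+1))%:E)%E.

Lemma measurable_pos : measurable [set k : nat | (0 < k)%N].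
Proof. by []. Qed.

(* P(X \in . | X > 0). The second argument of mnormalize is only used when
   P(X > 0) = 0. *)
Definition cond_pos_law (d : measure_display) (Omega : measurableType d)
    (R : realType) (P : probability Omega R) (X : {RV P >-> nat}) :
    probability nat R :=
  mnormalize (mrestr (distribution P X) measurable_pos) (distribution P X).

(* Every function on nat is continuous, so the test functions are all the
   bounded ones. *)
Definition weak_cvg (R : realType) (mu : nat -> probability nat R)
    (mu_lim : probability nat R) : Prop :=
  forall f : nat -> R, bounded_fun f ->
    (fun n => \int[mu n]_k f k) @ \oo --> \int[mu_lim]_k f k.

Definition yaglom_limit (d : measure_display) (Omega : measurableType d)
    (R : realType) (P : probability Omega R) (Z : nat -> {RV P >-> nat})
    (nu_min : probability nat R) : Prop :=
  Nstar_measure nu_min /\ weak_cvg (fun n => cond_pos_law (Z n)) nu_min.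

Definition invariant_measure (R : realType) (p : probability nat R)
    (lambda : R) (nu : {measure set nat -> \bar R}) : Prop :=
  forall j : nat, (0 < j)%N ->
    (\sum_(1 <= i <oo) nu [set i] * (bgw_trans p i j)%:E
     = lambda%:E * nu [set j])%E.

Definition gf_partial (R : realType) (nu : {measure set nat -> \bar R})
    (z : R[i]) (n : nat) : R[i]^o :=
  \sum_(1 <= k < n) (weight nu k)%:C * z ^+ k.

(* The limit is meaningful where the series converges. *)
Definition gf (R : realType) (nu : {measure set nat -> \bar R}) (z : R[i]) :
    R[i] := limn (gf_partial nu z).

Definition conv_radius (R : realType) (a : nat -> R) : \bar R :=
  ereal_sup [set r%:E | r in
    [set r : R | 0 <= r /\ cvgn (series (fun n => `|a n| * r ^+ n))]].

Definition cexp (R : realType) (z : R[i]) : R[i] :=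
  (expR (complex.Re z))%:C * (cos (complex.Im z) +i* sin (complex.Im z)).

Definition cintegrable (d : measure_display) (T : measurableType d)
    (R : realType) (mu : {measure set T -> \bar R}) (D : set T)
    (f : T -> R[i]) : Prop :=
  mu.-integrable D (fun x => (complex.Re (f x))%:E) /\
  mu.-integrable D (fun x => (complex.Im (f x))%:E).

Definition cintegral (d : measure_display) (T : measurableType d)
    (R : realType) (mu : {measure set T -> \bar R}) (D : set T)
    (f : T -> R[i]) : R[i] :=
  (\int[mu]_(x in D) complex.Re (f x)) +i* (\int[mu]_(x in D) complex.Im (f x)).

Definition posreals (R : realType) : set (measurableTypeR R) :=
  [set x : R | 0 < x].
Arguments posreals R : clear implicits.

(* A measure on ]0, +oo[ is a Borel measure on R that does not charge the
   complement of ]0, +oo[. *)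
Definition posreals_measure (R : realType)
    (Lambda : {measure set (measurableTypeR R) -> \bar R}) : Prop :=
  Lambda (~` posreals R) = 0%E /\
  forall x : R, 0 < x ->
    exists U : set R, [/\ open U, U x & (Lambda U < +oo)%E].

Definition scale_invariant (R : realType) (m : R)
    (Lambda : {measure set (measurableTypeR R) -> \bar R}) : Prop :=
  forall A : set (measurableTypeR R), measurable A -> A `<=` posreals R ->
    Lambda A = Lambda [set m * a | a in A].

Definition gf_integrand (R : realType) (nu_min : probability nat R)
    (alpha : R) (z : R[i]) (x : R) : R[i] :=
  (cexp ((gf nu_min z - 1) * x%:C) - (expR (- x))%:C) * (x `^ alpha)^-1%:C.

(* The power series converges on the open unit disc, with the stated sum. *)
Definition gf_representation (R : realType) (nu_min : probability nat R)
    (alpha : R) (Lambda : {measure set (measurableTypeR R) -> \bar R})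
    (nu : {measure set nat -> \bar R}) : Prop :=
  forall z : R[i], `|z| < 1 ->
    cintegrable Lambda (posreals R) (gf_integrand nu_min alpha z) /\
    gf_partial nu z @ \oo -->
      (cintegral Lambda (posreals R) (gf_integrand nu_min alpha z) : R[i]^o).

(* Main.v *)
Require Import Defs.

(* Let F be the offspring generating function, F_n its iterates, H and G the
   generating functions of nu_min and nu. The Yaglom limit gives
   1 - H(F(r)) = m (1 - H(r)), and nu is lambda-invariant iff G is finite on
   [0, 1) with G(F(r)) = G(F(0)) + lambda G(r). Comparing slopes of the
   convex function G between iterates of F yields, in the limit,
   m^j G(s) H(r) <= lambda^j G(r) H(s) as soon as s <= F_j(r); hence G = 0 if
   lambda < m, and G is a multiple of H if lambda = m.

   For lambda = m^alpha, e^((H - 1) x) - e^(-x) is the generating function of a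
   compound Poisson law without its atom at 0. Its coefficients are nonnegative,
   so the integral representation only has to be known at real z, where it reads
   G(r) = I(1 - H(r)) with
   I(s) = int (e^(-s x) - e^(-x)) x^(-alpha) Lambda(dx). Scale invariance of
   Lambda gives I(m s) = I(m) + m^alpha I(s), that is, invariance of nu.
   Conversely, given an invariant nu, put the mass lambda^(-n-1) nu(k) at
   - k ln F_(n+1)(0). The differences of the Laplace transforms of these measures
   converge as n grows, to those of a function g with g(1 - H(r)) = G(r) and
   g(s) - g(t) = m^alpha (g(s/m) - g(t/m)); the continuity theorem for Laplace
   transforms, applied after weighting by 1 - e^(-x), then produces
   x^(-alpha) Lambda. Scale invariance and uniqueness of Lambda come from the
   injectivity of the Laplace transform. *)
From HB Require Import structures.
From mathcomp Require Import all_boot all_order all_algebra.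
From mathcomp Require Import finmap complex.
From mathcomp Require Import all_classical all_reals all_analysis.
From mathcomp Require Import measurable_realfun.
From mathcomp Require Import ring lra.

Set Implicit Arguments.
Unset Strict Implicit.
Unset Printing Implicit Defensive.

Import Order.TTheory GRing.Theory Num.Theory.
Import numFieldNormedType.Exports.

Local Open Scope classical_set_scope.
Local Open Scope ring_scope.


(** * Power series with nonnegative coefficients *)

(** Two obstacles shape the converse in the case lambda = m^alpha. First, x^(-alpha) Lambda may have
    infinite mass near 0 and then has no Laplace transform. Only differences such as I(s) - I(s + 1)
    are finite, and e^(-s x) - e^(-(s + 1) x) = e^(-s x) (1 - e^(-x)) makes them the transform of
    the weighted measure. These differences determine g only up to a function of period 1;
    monotonicity of g, together with unit differences that become small far out, removes the
    ambiguity. Second, a limit of measures on ]0, +oo[ may have an atom at 0; it is excluded by the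
    scaling of g, because alpha < 1. The points - k ln F_(n+1)(0) make the transform at s equal to G
    at F_(n+1)(0)^s, up to the factor lambda^(-n-1). On this scale F_(n+1)(r) sits at ln F_(n+1)(r)
    / ln F_(n+1)(0), which tends to 1 - H(r): the ratio of logarithms behaves like the ratio of
    survival probabilities in the Yaglom limit. *)

Lemma exists_expr_lt {R : realType} (m e : R) : 0 < m -> m < 1 -> 0 < e ->
  exists n, m ^+ n < e.
Proof.
move=> m0 m1 e0.
have /cvgrPdist_lt /(_ _ e0) [n _ /(_ n (leqnn n))] : m ^+ k @[k --> \oo] --> 0.
  by apply: cvg_expr; rewrite ger0_norm ?ltW.
by rewrite /= sub0r normrN ger0_norm ?exprn_ge0 ?(ltW m0)// => h; exists n.
Qed.

Section egf.
Context {R : realType}.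
Implicit Types (a b : nat -> \bar R) (r s : R).
Local Open Scope ereal_scope.

(** With extended values, series can be rearranged before they are known to converge. For invariant
    measures, finiteness on [0, 1) is itself a conclusion, [invariant_gf_finite]. *)
Definition egf a r : \bar R := \sum_(k <oo) a k * (r ^+ k)%:E.

Lemma egf_term_ge0 a r k : (forall k, 0 <= a k) -> (0 <= r)%R ->
  0 <= a k * (r ^+ k)%:E.
Proof. by move=> a0 r0; rewrite mule_ge0// lee_fin exprn_ge0. Qed.
Hint Resolve egf_term_ge0 : core.

Lemma egf_ge0 a r : (forall k, 0 <= a k) -> (0 <= r)%R -> 0 <= egf a r.
Proof. by move=> a0 r0; apply: nneseries_ge0 => k _ _; exact: egf_term_ge0. Qed.

Lemma egf_recl a r : (forall k, 0 <= a k) -> (0 <= r)%R ->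
  egf a r = a 0%N + r%:E * egf (fun k => a k.+1) r.
Proof.
move=> a0 r0; rewrite /egf nneseries_recl//; last by move=> k _; exact: egf_term_ge0.
rewrite expr0 mule1 -nneseriesZl; last first.
  by move=> k _; apply: (@egf_term_ge0 (fun k => a k.+1)).
congr (_ + _); rewrite -nneseries_addn; last by move=> k; exact: egf_term_ge0.
by apply: eq_eseriesr => k _; rewrite addn1 exprS EFinM muleCA.
Qed.

Lemma egf0 a : (forall k, 0 <= a k) -> egf a 0 = a 0%N.
Proof. by move=> a0; rewrite egf_recl// mul0e adde0. Qed.

Lemma le_egf a r s : (forall k, 0 <= a k) -> (0 <= r)%R -> (r <= s)%R ->
  egf a r <= egf a s.
Proof.
move=> a0 r0 rs; apply: lee_nneseries => k _; first by move=> _; apply: egf_term_ge0.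
by rewrite lee_wpmul2l// lee_fin lerXn2r// nnegrE (le_trans r0).
Qed.

Lemma egfZ a r c : (forall k, 0 <= a k) -> (0 <= r)%R ->
  egf (fun k => c%:E * a k) r = c%:E * egf a r.
Proof.
move=> a0 r0; rewrite /egf -nneseriesZl; last by move=> k _; exact: egf_term_ge0.
by apply: eq_eseriesr => k _; rewrite muleA.
Qed.

Lemma egf_coef_lty a r k : (forall k, 0 <= a k) -> (0 < r)%R ->
  egf a r < +oo -> a k < +oo.
Proof.
move=> a0 r0; rewrite !ltey; apply: contra_neq => akoo.
apply: (@nneseries_pinfty _ _ _ k) => //.
  by move=> n _; apply: egf_term_ge0 => //; exact: ltW.
by rewrite akoo gt0_mulye// lte_fin exprn_gt0.
Qed.

(** Let r tend to 0: beyond its constant term [egf b r] is at most r B, where B is the shifted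
    series at the fixed point s = rho / 2. *)
Let egf_coef0_le a b (rho : R) : (0 < rho)%R ->
  (forall k, 0 <= a k) -> (forall k, 0 <= b k) ->
  (forall r, (0 < r < rho)%R -> egf b r < +oo) ->
  (forall r, (0 < r < rho)%R -> egf a r = egf b r) -> a 0%N <= b 0%N.
Proof.
move=> rho0 a0 b0 boo ab.
pose s := (rho / 2)%R; have s0 : (0 < s)%R by rewrite divr_gt0.
have srho : (s < rho)%R by rewrite /s ltr_pdivrMr// ltr_pMr// ltr1n.
pose B := egf (fun k => b k.+1) s.
have Boo : B < +oo.
  have := boo s; rewrite s0 srho => /(_ isT); rewrite egf_recl//; last exact: ltW.
  rewrite !ltey; apply: contra_neq; rewrite -/B => ->.
  by rewrite gt0_muley ?lte_fin// addey// -ltNye (lt_le_trans _ (b0 0%N)).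
have B0 : 0 <= B by apply: egf_ge0 => //; exact: ltW.
have BE : B = (fine B)%:E by rewrite fineK// ge0_fin_numE.
have b0oo : b 0%N < +oo by apply: (@egf_coef_lty _ s) => //; apply: boo; rewrite s0.
apply/lee_addgt0Pr => e e0.
pose r := Num.min s (e / (fine B + 1))%R.
have fB1 : (0 < fine B + 1)%R by rewrite ltr_wpDl// fine_ge0.
have r0 : (0 < r)%R by rewrite lt_min s0 divr_gt0.
have r0' := ltW r0.
have rs : (r <= s)%R by rewrite ge_min lexx.
have := ab r; rewrite r0 (le_lt_trans rs srho) => /(_ isT) abr.
apply: (@le_trans _ _ (egf a r)).
  by rewrite egf_recl// leeDl// mule_ge0// egf_ge0.
rewrite abr egf_recl// leeD2l//.
apply: (@le_trans _ _ (r%:E * B)).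
  by rewrite lee_wpmul2l//; apply: le_egf => //; exact: ltW.
rewrite BE -EFinM lee_fin (@le_trans _ _ (r * (fine B + 1))%R)//.
  by rewrite ler_wpM2l// lerDl.
by rewrite -ler_pdivlMr// /r ge_min lexx orbT.
Qed.

(** Identity theorem by peeling: equal constant terms are subtracted, the equation is divided by r,
    and the argument is repeated for the shifted sequences. Finiteness passes from b to a through
    the equality. *)
Lemma egf_inj a b (rho : R) : (0 < rho)%R ->
  (forall k, 0 <= a k) -> (forall k, 0 <= b k) ->
  (forall r, (0 < r < rho)%R -> egf b r < +oo) ->
  (forall r, (0 < r < rho)%R -> egf a r = egf b r) -> a = b.
Proof.
move=> rho0 a0 b0 boo ab; apply/funext => n.
elim: n a b a0 b0 boo ab => [|n IH] a b a0 b0 boo ab.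
  apply/eqP; rewrite eq_le (@egf_coef0_le a b rho)// (@egf_coef0_le b a rho)//.
    by move=> r rr; rewrite ab// boo.
  by move=> r rr; rewrite ab.
have ab0 : a 0%N = b 0%N.
  apply/eqP; rewrite eq_le (@egf_coef0_le a b rho)// (@egf_coef0_le b a rho)//.
    by move=> r rr; rewrite ab// boo.
  by move=> r rr; rewrite ab.
apply: (IH (fun k => a k.+1) (fun k => b k.+1)) => // r /andP[r0 rr]; have r0' := ltW r0.
  have := boo r; rewrite r0 rr => /(_ isT); rewrite egf_recl//.
  rewrite !ltey; apply: contra_neq => ->.
  by rewrite gt0_muley ?lte_fin// addey// -ltNye (lt_le_trans _ (b0 0%N)).
have := ab r; rewrite r0 rr => /(_ isT); rewrite (@egf_recl a)// (@egf_recl b)// ab0.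
have b0oo : b 0%N \is a fin_num.
  by rewrite ge0_fin_numE// (@egf_coef_lty _ r)// boo// r0.
move=> /(congr1 (fun x => x - b 0%N)); rewrite addeAC subee// add0e addeAC subee// add0e.
move=> /(congr1 (fun x => (r^-1)%:E * x)).
by rewrite !muleA -EFinM mulVf ?gt_eqF// !mul1e.
Qed.

(** Tonelli for the double series over k <= j. Finiteness of the second factor lets it leave the
    outer sum as a real number. *)
Lemma egf_conv (a b : nat -> R) r :
  (forall k, 0 <= a k)%R -> (forall k, 0 <= b k)%R -> (0 <= r)%R ->
  egf (EFin \o b) r \is a fin_num ->
  egf (fun j => (\sum_(k < j.+1) a k * b (j - k)%N)%:E) r =
  egf (EFin \o a) r * egf (EFin \o b) r.
Proof.
move=> a0 b0 r0 boo; pose A k := (a k * r ^+ k)%R; pose B k := (b k * r ^+ k)%R.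
have A0 k : (0 <= A k)%R by rewrite mulr_ge0 ?exprn_ge0.
have B0 k : (0 <= B k)%R by rewrite mulr_ge0 ?exprn_ge0.
have AB0 k j : 0 <= (A k * B j)%:E by rewrite lee_fin mulr_ge0.
transitivity (\sum_(j <oo) \sum_(k <oo) if (k <= j)%N then (A k * B (j - k)%N)%:E else 0).
  apply: eq_eseriesr => j _.
  rewrite (nneseries_split 0 j.+1); last first.
    by move=> k _; case: ifP.
  rewrite add0n [X in _ + X]eseries0 ?adde0; last first.
    by move=> k jk _; rewrite leqNgt jk.
  rewrite big_mkord -EFinM mulr_suml -sumEFin; apply: eq_bigr => k _.
  have kj : (k <= j)%N by rewrite -ltnS.
  by rewrite kj /A /B mulrACA -exprD subnKC.
rewrite nneseries_interchange; last by move=> i j; case: ifP.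
transitivity (\sum_(k <oo) (A k)%:E * egf (EFin \o b) r).
  apply: eq_eseriesr => k _.
  rewrite -[LHS]eseries_mkcond.
  rewrite (_ : \sum_(i <oo | (k <= i)%N) _ = \sum_(k <= i <oo) (A k * B (i - k)%N)%:E); last first.
    by rewrite [RHS]eseries_cond.
  rewrite -(@nneseries_addn _ (fun i => (A k * B (i - k)%N)%:E)); last by move=> i.
  rewrite -nneseriesZl//; last by move=> i _; exact: egf_term_ge0.
  by apply: eq_eseriesr => i _; rewrite addnK -EFinM.
rewrite -(fineK boo) muleC -nneseriesZl; last by move=> k _; exact: egf_term_ge0.
by apply: eq_eseriesr => k _; rewrite muleC.
Qed.

End egf.

Section measure_nat.
Context {R : realType}.
Implicit Types mu : {measure set nat -> \bar R}.
Local Open Scope ereal_scope.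

Lemma ge0_integral_nat mu (f : nat -> \bar R) : (forall k, 0 <= f k) ->
  \int[mu]_k f k = \sum_(k <oo) f k * mu [set k].
Proof.
move=> f0.
have -> : [set: nat] = \bigcup_k [set k].
  by rewrite bigcup_imset1 image_id.
rewrite ge0_integral_bigcup//; last first.
  by move=> i j _ _ [x [/= -> ->]].
apply: eq_eseriesr => k _.
rewrite -integral_cst//; apply: eq_integral => x; rewrite inE => -> //.
Qed.

Lemma measure_nat mu (A : set nat) : mu A = \sum_(k <oo) (\1_A k)%:E * mu [set k].
Proof. by rewrite -ge0_integral_nat// integral_indic// setIT. Qed.

End measure_nat.

Section gfr.
Context {R : realType}.
Implicit Types (a : nat -> R) (r s : R).

(** Where the series diverges this is 0, the value of [fine] at infinity; hence the finiteness
    hypotheses in the lemmas that compare values. *)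
Definition gfr a r : R := fine (egf (EFin \o a) r).

Lemma gfr_ge0 a r : (forall k, 0 <= a k) -> 0 <= r -> 0 <= gfr a r.
Proof. by move=> a0 r0; rewrite fine_ge0// egf_ge0. Qed.

Lemma egf_gfr a r : (forall k, 0 <= a k) -> 0 <= r ->
  (egf (EFin \o a) r < +oo)%E -> egf (EFin \o a) r = (gfr a r)%:E.
Proof. by move=> a0 r0 aoo; rewrite fineK// ge0_fin_numE// egf_ge0. Qed.

Lemma le_gfr a r s : (forall k, 0 <= a k) -> 0 <= r -> r <= s ->
  (egf (EFin \o a) s < +oo)%E -> gfr a r <= gfr a s.
Proof.
move=> a0 r0 rs soo; have s0 := le_trans r0 rs.
rewrite -lee_fin -!egf_gfr//; first exact: le_egf.
by apply: le_lt_trans soo; exact: le_egf.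
Qed.

Lemma gfr0 a : (forall k, 0 <= a k) -> gfr a 0 = a 0%N.
Proof. by move=> a0; rewrite /gfr egf0. Qed.

(** Convexity of t^k as monotonicity of chord slopes, cross-multiplied so that intervals may
    degenerate. Both sides share the factor (y - x) (v - u), and the cofactors are sums of monomials
    compared termwise. *)
Lemma expr_slope (x y u v : R) k : 0 <= x -> x <= y -> 0 <= u -> u <= v ->
  x <= u -> y <= v -> (y ^+ k - x ^+ k) * (v - u) <= (v ^+ k - u ^+ k) * (y - x).
Proof.
move=> x0 xy u0 uv xu yv; rewrite !subrXX mulrAC [leRHS]mulrAC (mulrC (v - u)).
rewrite ler_wpM2l ?mulr_ge0 ?subr_ge0//.
have y0 := le_trans x0 xy; have v0 := le_trans u0 uv.
by apply: ler_sum => i _; rewrite ler_pM ?exprn_ge0 ?lerXn2r ?nnegrE.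
Qed.

Lemma gfr_slope a (x y u v : R) : (forall k, 0 <= a k) ->
  0 <= x -> x <= y -> 0 <= u -> u <= v -> x <= u -> y <= v ->
  (egf (EFin \o a) v < +oo)%E ->
  (gfr a y - gfr a x) * (v - u) <= (gfr a v - gfr a u) * (y - x).
Proof.
move=> a0 x0 xy u0 uv xu yv voo.
have y0 := le_trans x0 xy; have v0 := le_trans u0 uv.
have fin r : 0 <= r -> r <= v -> egf (EFin \o a) r = (gfr a r)%:E.
  by move=> r0 rv; apply: egf_gfr => //; apply: le_lt_trans voo; exact: le_egf.
have vu0 : 0 <= v - u by rewrite subr_ge0.
have yx0 : 0 <= y - x by rewrite subr_ge0.
(* Negative terms change sides, so that both sides become series of nonnegative terms and
   [expr_slope] applies termwise. *)
rewrite !mulrBl lerBlDr addrAC lerBrDr -lee_fin !EFinD !EFinM.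
have comb c d r t : 0 <= c -> 0 <= d -> 0 <= r -> 0 <= t ->
    (c%:E * egf (EFin \o a) r + d%:E * egf (EFin \o a) t =
     \sum_(k <oo) (a k * (c * r ^+ k + d * t ^+ k))%:E)%E.
  move=> c0 d0 r0 t0; rewrite -!nneseriesZl; last 2 first.
    1,2: by move=> k _; apply: egf_term_ge0.
  rewrite -nneseriesD; last 2 first.
    1,2: by move=> k _ _; rewrite mule_ge0// egf_term_ge0.
  apply: eq_eseriesr => k _.
  by rewrite -!EFinM -EFinD; congr EFin; ring.
have yv' : egf (EFin \o a) y = (gfr a y)%:E by exact: fin.
have uv' : egf (EFin \o a) u = (gfr a u)%:E by exact: fin.
have xv' : egf (EFin \o a) x = (gfr a x)%:E by apply: fin => //; exact: le_trans xu uv.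
have vv' : egf (EFin \o a) v = (gfr a v)%:E by exact: fin.
rewrite -yv' -uv' -xv' -vv' ![(egf _ _ * _)%E]muleC !comb//.
apply: lee_nneseries => k.
  by move=> _; rewrite lee_fin mulr_ge0// addr_ge0// mulr_ge0// exprn_ge0.
move=> _; rewrite lee_fin ler_wpM2l//.
have := expr_slope k x0 xy u0 uv xu yv; lra.
Qed.

(** By convexity no chord inside [0, c] is steeper than the chord from c to d, the midpoint of c and
    1. *)
Lemma gfr_lip a (c : R) : (forall k, 0 <= a k) -> 0 <= c < 1 ->
  (forall r, 0 <= r < 1 -> (egf (EFin \o a) r < +oo)%E) ->
  exists2 K, 0 <= K & forall x y, 0 <= x -> x <= y -> y <= c ->
    gfr a y - gfr a x <= K * (y - x).
Proof.
move=> a0 /andP[c0 c1] aoo; pose d := (1 + c) / 2.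
have cd : c < d by rewrite /d; lra.
have d1 : d < 1 by rewrite /d; lra.
have doo : (egf (EFin \o a) d < +oo)%E by apply: aoo; rewrite d1 andbT; lra.
exists ((gfr a d - gfr a c) / (d - c)).
  by rewrite divr_ge0 ?subr_ge0 ?(ltW cd)//; apply: le_gfr => //; exact: ltW.
move=> x y x0 xy yc; rewrite mulrAC ler_pdivlMr ?subr_gt0//.
by apply: gfr_slope => //; lra.
Qed.

Lemma gfr_inj a b (rho : R) : 0 < rho ->
  (forall k, 0 <= a k) -> (forall k, 0 <= b k) ->
  (forall r, 0 < r < rho -> (egf (EFin \o a) r < +oo)%E) ->
  (forall r, 0 < r < rho -> (egf (EFin \o b) r < +oo)%E) ->
  (forall r, 0 < r < rho -> gfr a r = gfr b r) -> a = b.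
Proof.
move=> rho0 a0 b0 aoo boo ab.
suff : EFin \o a = EFin \o b.
  by move=> H; apply/funext => k; apply: EFin_inj; exact: (congr1 (fun f => f k) H).
apply: (@egf_inj _ _ _ rho) => //.
move=> r rr.
have r0 : 0 <= r by case/andP: rr => /ltW.
by rewrite (egf_gfr a0 r0 (aoo _ rr)) (egf_gfr b0 r0 (boo _ rr)) ab.
Qed.

End gfr.

(** * The offspring generating function and its slope at 1 *)

Section offspring.
Context {R : realType} (p : probability nat R) (m : R).
Hypothesis m0 : 0 < m.
Hypothesis m1 : m < 1.
Hypothesis mean : (\int[p]_k (k%:R : R)%:E)%E = m%:E.

Implicit Types (r s : R) (q : probability nat R).

Definition pgf q r : R := gfr (weight q) r.

Lemma weight_ge0 (mu : {measure set nat -> \bar R}) k : 0 <= weight mu k.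
Proof. by rewrite fine_ge0. Qed.

Lemma prob_weight q k : (weight q k)%:E = q [set k].
Proof. by rewrite fineK// fin_num_measure. Qed.

Lemma prob_egf1 q : egf (EFin \o weight q) 1 = 1%E.
Proof.
rewrite -(@probability_setT _ _ _ q) measure_nat; apply: eq_eseriesr => k _.
by rewrite expr1n mule1 /= prob_weight indicT mul1e.
Qed.

Lemma prob_egf_lty q r : 0 <= r <= 1 ->
  (egf (EFin \o weight q) r < +oo)%E.
Proof.
move=> /andP[r0 r1]; apply: le_lt_trans (ltry 1).
by rewrite -(prob_egf1 q) le_egf// => k; rewrite lee_fin weight_ge0.
Qed.

Lemma pgf_egf q r : 0 <= r <= 1 ->
  egf (EFin \o weight q) r = (pgf q r)%:E.
Proof.
by move=> r01; rewrite egf_gfr ?prob_egf_lty//; [exact: weight_ge0|case/andP: r01].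
Qed.

Lemma pgf1 q : pgf q 1 = 1.
Proof. by rewrite /pgf /gfr prob_egf1. Qed.

Lemma pgf_ge0 q r : 0 <= r -> 0 <= pgf q r.
Proof. by move=> r0; apply: gfr_ge0 => // k; exact: weight_ge0. Qed.

Lemma le_pgf q r s : 0 <= r -> r <= s -> s <= 1 ->
  pgf q r <= pgf q s.
Proof.
move=> r0 rs s1; apply: le_gfr => //; first by move=> k; exact: weight_ge0.
by rewrite prob_egf_lty// s1 (le_trans r0).
Qed.

Lemma pgf_le1 q r : 0 <= r <= 1 -> pgf q r <= 1.
Proof. by move=> /andP[r0 r1]; rewrite -(pgf1 q) le_pgf. Qed.

Lemma pgf_gt0 q r : 0 < r < 1 -> 0 < pgf q r.
Proof.
move=> /andP[r0 r1]; rewrite lt_neqAle pgf_ge0 ?ltW// andbT eq_sym.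
apply/eqP => H0.
have w0 k : weight q k = 0.
  apply/eqP; rewrite eq_le weight_ge0 andbT.
  have : ((weight q k * r ^+ k)%:E <= 0)%E.
    rewrite -[leRHS]/(0%R%:E) -H0 -pgf_egf ?(ltW r0) ?(ltW r1)//.
    apply: le_trans (nneseries_lim_ge k.+1 _); last first.
      move=> j _ _; apply: egf_term_ge0 => [i|]; rewrite ?lee_fin ?weight_ge0//.
      exact: ltW.
    rewrite big_nat_recr//= leeDr// sume_ge0// => i _.
    by rewrite lee_fin mulr_ge0 ?weight_ge0// exprn_ge0// ltW.
  by rewrite lee_fin pmulr_lle0 ?exprn_gt0.
have := prob_egf1 q; rewrite /egf eseries0; last by move=> k _ _; rewrite /= w0 mul0e.
by move=> /eqP; rewrite eqe eq_sym oner_eq0.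
Qed.

Lemma mean_series : (\sum_(k <oo) (k%:R * weight p k)%:E = m%:E)%E.
Proof.
rewrite -mean ge0_integral_nat//; apply: eq_eseriesr => k _.
by rewrite EFinM prob_weight.
Qed.

Lemma pgf_compl r : 0 <= r <= 1 ->
  ((1 - pgf p r)%:E = \sum_(k <oo) (weight p k * (1 - r ^+ k))%:E)%E.
Proof.
move=> /andP[r0 r1].
have S : (\sum_(k <oo) (weight p k * (1 - r ^+ k))%:E + (pgf p r)%:E = 1)%E.
  rewrite -pgf_egf ?r0// -nneseriesD; last 2 first.
  - by move=> k _ _; rewrite lee_fin mulr_ge0 ?weight_ge0// subr_ge0 exprn_ile1.
  - by move=> k _ _; apply: egf_term_ge0 => // j; rewrite lee_fin weight_ge0.
  rewrite -(prob_egf1 p); apply: eq_eseriesr => k _.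
  by rewrite -!EFinM -EFinD expr1n; congr EFin; ring.
by rewrite EFinB -[in LHS]S addeK.
Qed.

(** Bernoulli's inequality 1 - r^k <= k (1 - r), averaged over the offspring law. *)
Lemma pgf_compl_le r : 0 <= r <= 1 -> 1 - pgf p r <= m * (1 - r).
Proof.
move=> r01; have /andP[r0 r1] := r01.
rewrite -lee_fin pgf_compl// EFinM -mean_series muleC -nneseriesZl; last first.
  by move=> k _; rewrite lee_fin mulr_ge0 ?weight_ge0.
apply: lee_nneseries => k.
  by move=> _; rewrite lee_fin mulr_ge0 ?weight_ge0// subr_ge0 exprn_ile1.
move=> _; rewrite -EFinM lee_fin.
have H : 1 - r ^+ k <= k%:R * (1 - r).
  elim: k => [|k IH]; first by rewrite expr0 mul0r subrr.
  rewrite exprS -(natr1 k).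
  have : r * (1 - r ^+ k) <= 1 - r ^+ k.
    by rewrite ler_piMl// subr_ge0 exprn_ile1.
  lra.
have := weight_ge0 p k; have := ler_wpM2l (weight_ge0 p k) H; lra.
Qed.

(** Only the mean of the offspring law is controlled, so the slope at 1 is bounded below through a
    truncated mean: k r^K (1 - r) <= 1 - r^k for k < K. *)
Lemma pgf_compl_ge r K : 0 <= r <= 1 ->
  (\sum_(k < K) k%:R * weight p k) * r ^+ K * (1 - r) <= 1 - pgf p r.
Proof.
move=> r01; have /andP[r0 r1] := r01.
rewrite -lee_fin pgf_compl//.
apply: le_trans (nneseries_lim_ge K _); last first.
  by move=> k _ _; rewrite lee_fin mulr_ge0 ?weight_ge0// subr_ge0 exprn_ile1.
rewrite big_mkord sumEFin lee_fin !mulr_suml; apply: ler_sum => k _.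
have H n : n%:R * r ^+ n * (1 - r) <= 1 - r ^+ n.
  elim: n => [|n IH]; first by rewrite expr0 !mul0r subrr.
  rewrite exprS -(natr1 n).
  have : r * (n%:R * r ^+ n * (1 - r)) <= r * (1 - r ^+ n) by rewrite ler_wpM2l.
  have : 0 <= (1 - r) * (1 - r * r ^+ n).
    by rewrite mulr_ge0 ?subr_ge0// -exprS exprn_ile1.
  lra.
have rk : r ^+ K <= r ^+ k by rewrite ler_wiXn2l// ltnW.
have H2 : k%:R * r ^+ K * (1 - r) <= 1 - r ^+ k.
  apply: le_trans (H k); rewrite ler_wpM2r ?subr_ge0// ler_wpM2l//.
have := ler_wpM2l (weight_ge0 p k) H2; lra.
Qed.

Lemma mean_partial e : 0 < e -> exists K, m - e < \sum_(k < K) k%:R * weight p k.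
Proof.
move=> e0; apply: contrapT => /forallNP h.
suff : (m%:E <= (m - e)%:E)%E by rewrite lee_fin; lra.
rewrite -mean_series; apply: lime_le.
  by apply: is_cvg_nneseries => k _ _; rewrite lee_fin mulr_ge0 ?weight_ge0.
apply: nearW => K; rewrite big_mkord sumEFin lee_fin.
by have /negP := h K; rewrite -leNgt.
Qed.

Lemma pgf_lt1 r : 0 <= r < 1 -> pgf p r < 1.
Proof.
move=> /andP[r0 r1]; have [K mK] := mean_partial m0.
have {}mK : 0 < \sum_(k < K) k%:R * weight p k by lra.
have h s : 0 < s < 1 -> pgf p s < 1.
  move=> /andP[s0 s1]; rewrite -subr_gt0; apply: lt_le_trans (@pgf_compl_ge _ K _).
    by rewrite !mulr_gt0 ?exprn_gt0// subr_gt0.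
  by rewrite !ltW.
(* At r = 0 the lower bound may degenerate because of the factor r^K, so monotonicity is used to
   compare with 1/2. *)
have [r00|r00] := ltP 0 r; first by apply: h; rewrite r00.
apply: le_lt_trans (@h (1/2) _); last lra.
by apply: le_pgf => //; lra.
Qed.

Lemma pgf0_gt0 : 0 < pgf p 0.
Proof.
have : 1 - pgf p 0 <= m * (1 - 0) by apply: pgf_compl_le; rewrite lexx ler01.
rewrite subr0 mulr1; move: m1; lra.
Qed.

(** The left derivative at 1 is the mean. It is stated along sequences because it is applied to
    iterates; the quotient is squeezed between M (r n)^K and m, with M a partial mean above m -
    e/2. *)
Lemma pgf_slope_cvg (r : nat -> R) : (forall n, 0 <= r n < 1) ->
  r @ \oo --> (1 : R) -> (1 - pgf p (r n)) / (1 - r n) @[n --> \oo] --> m.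
Proof.
move=> r01 r1; apply/cvgrPdist_lt => e e0.
have e20 : 0 < e / 2 by lra.
have [K mK] := mean_partial e20; set M := \sum_(k < K) _ in mK.
have rK : M * r n ^+ K @[n --> \oo] --> M * 1 ^+ K.
  apply: cvgM; first exact: cvg_cst.
  exact: (cvg_comp _ _ r1 (@exprn_continuous R K 1)).
rewrite expr1n mulr1 in rK.
have /cvgrPdist_lt /(_ _ e20) := rK.
apply: filterS => n; rewrite ltr_norml => /andP[h1 h2].
have /andP[r0 r1n] := r01 n.
have rn1 : 0 < 1 - r n by lra.
have up : (1 - pgf p (r n)) / (1 - r n) <= m.
  by rewrite ler_pdivrMr// pgf_compl_le// r0 ltW.
have lo : M * r n ^+ K <= (1 - pgf p (r n)) / (1 - r n).
  by rewrite ler_pdivlMr// pgf_compl_ge// r0 ltW.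
rewrite ltr_norml; apply/andP; split; lra.
Qed.

End offspring.

(** * Iterated generating functions and the Yaglom limit *)

Lemma mnormalizeE d (T : measurableType d) (R : realType)
    (mu : {measure set T -> \bar R}) (P : probability T R) A (c : R) :
  0 < c -> mu setT = c%:E -> mnormalize mu P A = (mu A * (c^-1)%:E)%E.
Proof. by move=> c0 muT; rewrite /mnormalize muT eqe gt_eqF. Qed.

Section iterates.
Context {R : realType} (p : probability nat R) (m : R).
Hypothesis m0 : 0 < m.
Hypothesis m1 : m < 1.
Hypothesis mean : (\int[p]_k (k%:R : R)%:E)%E = m%:E.

Implicit Types r s : R.

Definition pgfn n r : R := iter n (pgf p) r.

Lemma pgfnS n r : pgfn n.+1 r = pgf p (pgfn n r). Proof. by []. Qed.

Lemma pgfnSr n r : pgfn n.+1 r = pgfn n (pgf p r).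
Proof. by rewrite /pgfn iterSr. Qed.

Lemma pgfnD n k r : pgfn (n + k) r = pgfn n (pgfn k r).
Proof. by rewrite /pgfn iterD. Qed.

Lemma pgfn_ge0 n r : 0 <= r -> 0 <= pgfn n r.
Proof. by move=> r0; elim: n => [//|n IH]; rewrite pgfnS pgf_ge0. Qed.

Lemma pgfn_01 n r : 0 <= r < 1 -> 0 <= pgfn n r < 1.
Proof.
move=> r01; elim: n => [//|n IH]; rewrite pgfnS (pgf_lt1 m0 mean IH) andbT.
by apply: pgf_ge0; case/andP: IH.
Qed.

Lemma pgfn_compl_gt0 n r : 0 <= r < 1 -> 0 < 1 - pgfn n r.
Proof. by move=> /(pgfn_01 n) /andP[_]; rewrite subr_gt0. Qed.

Lemma pgfn_le1 n r : 0 <= r <= 1 -> 0 <= pgfn n r <= 1.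
Proof.
move=> r01; elim: n => [//|n IH]; rewrite pgfnS (pgf_le1 _ IH) andbT.
by apply: pgf_ge0; case/andP: IH.
Qed.

Lemma le_pgfn n r s : 0 <= r -> r <= s -> s <= 1 -> pgfn n r <= pgfn n s.
Proof.
move=> r0 rs s1; elim: n => [//|n IH]; rewrite !pgfnS le_pgf ?pgfn_ge0//.
by have /andP[] : 0 <= pgfn n s <= 1 by rewrite pgfn_le1// s1 (le_trans r0).
Qed.

Lemma pgfn_compl_le n r : 0 <= r <= 1 -> 1 - pgfn n r <= m ^+ n * (1 - r).
Proof.
move=> r01; elim: n => [|n IH]; first by rewrite expr0 mul1r.
rewrite pgfnS exprS -mulrA; apply: le_trans (ler_wpM2l (ltW m0) IH).
by apply: pgf_compl_le => //; exact: pgfn_le1.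
Qed.

Lemma pgfn_gt0 n r : 0 <= r <= 1 -> 0 < pgfn n.+1 r.
Proof.
move=> r01; rewrite pgfnS; apply: lt_le_trans (pgf0_gt0 m1 mean) _.
by have /andP[a b] := pgfn_le1 n r01; exact: le_pgf.
Qed.

Lemma pgfn_cvg r : 0 <= r <= 1 -> pgfn n r @[n --> \oo] --> (1 : R).
Proof.
move=> r01; apply: (@squeeze_cvgr _ _ _ _ (fun n => 1 - m ^+ n * (1 - r)) (cst 1)).
- apply: nearW => n; have := pgfn_compl_le n r01; have /andP[_] := pgfn_le1 n r01.
  by rewrite /cst /=; lra.
- rewrite -[X in _ --> X]subr0 -[X in _ --> _ - X](mul0r (1 - r)).
  apply: cvgB; first exact: cvg_cst.
  apply: cvgM; last exact: cvg_cst.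
  by apply: cvg_expr; rewrite ger0_norm// ltW.
- exact: cvg_cst.
Qed.

(** The ratio telescopes into j one-step slopes at points that tend to 1, and each of them tends to
    m. *)
Lemma pgfn_ratio_cvg r j : 0 <= r < 1 ->
  (1 - pgfn (j + n) r) / (1 - pgfn n r) @[n --> \oo] --> m ^+ j.
Proof.
move=> r01.
have pos n : 0 < 1 - pgfn n r by exact: pgfn_compl_gt0.
have cv1 : pgfn n r @[n --> \oo] --> (1 : R).
  by apply: pgfn_cvg; case/andP: r01 => -> /ltW ->.
elim: j => [|j IH].
  rewrite expr0; apply: cvg_near_cst; apply: nearW => n.
  by rewrite add0n divff// gt_eqF.
rewrite exprS.
have -> : (fun n => (1 - pgfn (j.+1 + n) r) / (1 - pgfn n r)) =
   (fun n => (1 - pgf p (pgfn (j + n) r)) / (1 - pgfn (j + n) r) *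
             ((1 - pgfn (j + n) r) / (1 - pgfn n r))).
  apply/funext => n; rewrite addSn pgfnS mulrA divfK//.
  by rewrite gt_eqF.
apply: cvgM => //.
apply: (pgf_slope_cvg mean); first by move=> n; exact: pgfn_01.
rewrite (_ : (fun n => _) = (fun n => pgfn (n + j) r)); last first.
  by apply/funext => n; rewrite addnC.
by rewrite (cvg_shiftn j (fun n => pgfn n r)).
Qed.

Lemma bgw_trans_ge0 i j : 0 <= bgw_trans p i j.
Proof.
elim: i j => [|i IH] j /=; first by rewrite ler0n.
by apply: sumr_ge0 => k _; rewrite mulr_ge0// weight_ge0.
Qed.

Lemma bgw_trans_egf i r : 0 <= r <= 1 ->
  egf (EFin \o bgw_trans p i) r = (pgf p r ^+ i)%:E.
Proof.
move=> r01; have /andP[r0 r1] := r01.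
elim: i => [|i IH].
  rewrite expr0 egf_recl//; last by move=> k; rewrite lee_fin ler0n.
  rewrite /egf eseries0 ?mule0 ?adde0// => k _ _.
  by rewrite /= mul0e.
rewrite exprS EFinM -IH -(pgf_egf _ r01) -egf_conv//.
- by move=> k; exact: weight_ge0.
- by move=> k; exact: bgw_trans_ge0.
- by rewrite IH.
Qed.

Lemma bgw_trans_00 i : bgw_trans p i 0 = weight p 0 ^+ i.
Proof.
elim: i => [|i IH]; first by rewrite expr0.
by rewrite /= big_ord1 subn0 IH exprS.
Qed.

End iterates.

(** * From the branching process to the Yaglom functional equation *)

Section process.
Context {R : realType} (p : probability nat R) (m : R).
Hypothesis m0 : 0 < m.
Hypothesis m1 : m < 1.
Hypothesis mean : (\int[p]_k (k%:R : R)%:E)%E = m%:E.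
Context (d : measure_display) (Omega : measurableType d)
    (P1 : probability Omega R) (Z : nat -> {RV P1 >-> nat}).
Hypothesis hZ : bgw_process p 1 Z.

Implicit Types r s : R.

Let path_event a n (x : nat -> nat) :=
  [set w | forall k, (a <= k <= n)%N -> Z k w = x k].

Let measurable_path_event a n x : measurable (path_event a n x).
Proof.
rewrite (_ : path_event a n x =
  \bigcap_(k in [set k | (a <= k <= n)%N]) (Z k @^-1` [set x k])).
  apply: fin_bigcap_measurable => [|k _].
    by apply: (@sub_finite_set _ _ `I_n.+1) (finite_II _) => k /= /andP[].
  exact: measurable_funPTI.
by apply/seteqP; split.
Qed.

Let upd (x : nat -> nat) a y k := if k == a then y else x k.

Let path_event_bigcup a n x : (a <= n)%N ->
  (P1 (path_event a.+1 n x) = \sum_(y <oo) P1 (path_event a n (upd x a y)))%E.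
Proof.
move=> an; rewrite -measure_semi_bigcup//.
- congr (P1 _); apply/seteqP; split => [w h|w [y _ h] k /andP[ak kn]].
    exists (Z a w) => // k /andP[ak kn]; rewrite /upd; case: eqP => [->//|/eqP ka].
    by apply: h; rewrite kn andbT ltn_neqAle eq_sym ka.
  have := h k; rewrite kn (ltnW ak) => /(_ isT); rewrite /upd.
  by rewrite gtn_eqF.
- move=> i j _ _ [w [hi hj]].
  have := hi a; have := hj a; rewrite leqnn an /upd eqxx.
  by move=> /(_ isT) -> /(_ isT).
- by apply: bigcup_measurable => k _; exact: measurable_path_event.
Qed.

(** The process is given through probabilities of paths observed from time 0. Summing out the
    earliest coordinate, one at a time, moves the start of the observation up to time a. *)
Let path_prob a n x : (a <= n)%N ->
  (P1 (path_event a n.+1 x) = P1 (path_event a n x) * (bgw_trans p (x n) (x n.+1))%:E)%E.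
Proof.
elim: a x => [|a IH] x an.
  exact: (hZ.2 x n).
rewrite path_event_bigcup; last by rewrite ltnW// ltnW.
rewrite path_event_bigcup; last exact: ltnW.
rewrite muleC -nneseriesZl//.
apply: eq_eseriesr => y _; rewrite IH; last exact: ltnW.
by rewrite muleC /upd gtn_eqF// gtn_eqF// ltnW.
Qed.

Definition law n : probability nat R := distribution P1 (Z n).

Lemma lawS n j : (law n.+1 [set j] =
  \sum_(i <oo) law n [set i] * (bgw_trans p i j)%:E)%E.
Proof.
(* Only the times n and n + 1 are observed, so the value j at all other times is a filler. *)
pose x i k := if k == n then i else j.
transitivity (\sum_(i <oo) P1 (path_event n n.+1 (x i)))%E.
  rewrite /law /= /pushforward -measure_semi_bigcup//.
  - congr (P1 _); apply/seteqP; split => [w /= h|w [i _ /= h]].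
      exists (Z n w) => // k /andP[nk kn]; rewrite /x; case: eqP => [->//|/eqP ka].
      have -> // : k = n.+1.
      by apply/eqP; rewrite eqn_leq kn ltn_neqAle eq_sym ka.
    have := h n.+1; rewrite leqnn leqnSn => /(_ isT) ->.
    by rewrite /x gtn_eqF.
  - move=> i i' _ _ [w [hi hj]].
    have := hi n; have := hj n; rewrite leqnn leqnSn /x eqxx.
    by move=> /(_ isT) -> /(_ isT).
  - by apply: bigcup_measurable => k _; exact: measurable_path_event.
apply: eq_eseriesr => i _; rewrite path_prob// /x eqxx gtn_eqF//; congr (_ * _)%E.
congr (P1 _); apply/seteqP; split => [w /(_ n)|w /= h k].
  by rewrite leqnn eqxx => /(_ isT).
by rewrite -eqn_leq => /eqP <-; rewrite eqxx.
Qed.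

Lemma law0 j : law 0 [set j] = (j == 1%N)%:R%:E.
Proof.
have [->|j1] := eqVneq j 1%N; first exact: hZ.1.
have h : (law 0 [set j] + law 0 [set 1%N] <= 1)%E.
  rewrite -measureU//.
    exact: probability_le1.
  by apply/seteqP; split => // k [/= -> /eqP]; rewrite (negPf j1).
have l1 : law 0 [set 1%N] = 1%E by exact: hZ.1.
move: h; rewrite l1 -[leRHS]add0e leeD2rE// => h.
by apply/eqP; rewrite eq_le h measure_ge0.
Qed.

Lemma law_pgf n r : 0 <= r <= 1 -> pgf (law n) r = pgfn p n r.
Proof.
move=> r01; have /andP[r0 r1] := r01.
apply: EFin_inj; rewrite -pgf_egf//.
elim: n r r01 {r0 r1} => [|n IH] r r01; have /andP[r0 r1] := r01.
  rewrite egf_recl//; last by move=> k; rewrite lee_fin weight_ge0.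
  rewrite egf_recl//; last by move=> k; rewrite lee_fin weight_ge0.
  rewrite /= !prob_weight !law0/= add0e /egf eseries0 ?mule0 ?adde0 ?mule1//.
  by move=> k _ _; rewrite /= prob_weight law0 mul0e.
(* Conditioning on generation n puts the new F innermost, hence [pgfnSr] and an induction hypothesis
   for every r. *)
rewrite pgfnSr -IH; last by rewrite pgf_ge0// pgf_le1.
transitivity (\sum_(j <oo) \sum_(i <oo) law n [set i] * ((bgw_trans p i j)%:E * (r ^+ j)%:E))%E.
  apply: eq_eseriesr => j _; rewrite /= prob_weight lawS muleC -nneseriesZl; last first.
    by move=> i _; rewrite mule_ge0// lee_fin bgw_trans_ge0.
  by apply: eq_eseriesr => i _; rewrite muleC -muleA.
rewrite nneseries_interchange; last first.
  by move=> i j; rewrite mule_ge0// mule_ge0// lee_fin ?bgw_trans_ge0// exprn_ge0.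
apply: eq_eseriesr => i _ /=; rewrite -prob_weight.
rewrite nneseriesZl; last first.
  by move=> j _; rewrite mule_ge0// lee_fin ?bgw_trans_ge0// exprn_ge0.
by rewrite -(bgw_trans_egf p i r01).
Qed.

Lemma cond_pos_law_pgf n r : 0 <= r <= 1 ->
  pgf (cond_pos_law (Z n)) r = (pgfn p n r - pgfn p n 0) / (1 - pgfn p n 0).
Proof.
move=> r01; have /andP[r0 r1] := r01.
have q0 : 0 < 1 - pgfn p n 0.
  by apply: (pgfn_compl_gt0 m0 mean); rewrite lexx ltr01.
have l0 : law n [set 0%N] = (pgfn p n 0)%:E.
  rewrite -law_pgf ?lexx ?ler01// -pgf_egf ?lexx ?ler01// egf0.
    by rewrite /= prob_weight.
  by move=> k; rewrite lee_fin weight_ge0.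
(* The mass of survival is nonzero, so [mnormalize] really divides by it and does not fall back on
   its default law. *)
have T : mrestr (distribution P1 (Z n)) measurable_pos setT = (1 - pgfn p n 0)%:E.
  rewrite /mrestr setTI EFinB -l0 -(@probability_setT _ _ _ (law n)).
  rewrite -(@setUv _ [set 0%N]) measureU//; last by rewrite setICr.
  rewrite addeAC subee ?add0e ?fin_num_measure//.
  congr (law n _); apply/seteqP; split => k /=; first by case: k.
  by case: k => // /(_ erefl).
have W k : weight (cond_pos_law (Z n)) k =
    (if k == 0%N then 0 else weight (law n) k / (1 - pgfn p n 0)).
  apply: EFin_inj; rewrite prob_weight.
  transitivity (mrestr (distribution P1 (Z n)) measurable_pos [set k] *
      ((1 - pgfn p n 0)^-1)%:E)%E.
    exact: (mnormalizeE _ _ q0 T).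
  rewrite /mrestr.
  case: eqP => [->|/eqP k0].
    by rewrite (_ : _ `&` _ = set0) ?measure0 ?mul0e//; apply/seteqP; split => // x [/= ->].
  rewrite EFinM prob_weight; congr (_ * _)%E; congr (law n _).
  by apply/seteqP; split => [x []//|x /= ->]; split => //=; rewrite lt0n.
have cw0 k : (0 <= (weight (cond_pos_law (Z n)) k)%:E)%E by rewrite lee_fin weight_ge0.
have lw0 k : (0 <= (weight (law n) k)%:E)%E by rewrite lee_fin weight_ge0.
apply: EFin_inj; rewrite -pgf_egf// egf_recl//= W/= add0e.
rewrite [X in egf X _](_ : _ =
    (fun k => ((1 - pgfn p n 0)^-1)%:E * (weight (law n) k.+1)%:E)%E); last first.
  by apply/funext => k /=; rewrite W/= EFinM muleC.
rewrite egfZ//.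
rewrite muleCA mulrC EFinM; congr (_ * _)%E.
have : egf (EFin \o weight (law n)) r = (pgfn p n r)%:E.
  by rewrite pgf_egf// law_pgf.
rewrite egf_recl//= prob_weight l0 EFinB => <-.
by rewrite addeAC subee// add0e.
Qed.

Context (nu_min : probability nat R).
Hypothesis hY : yaglom_limit Z nu_min.

(** Weak convergence is tested on the function r^k, which is bounded for 0 <= r <= 1. *)
Lemma yaglom_pgf_cvg r : 0 <= r <= 1 ->
  (pgfn p n r - pgfn p n 0) / (1 - pgfn p n 0) @[n --> \oo] --> pgf nu_min r.
Proof.
move=> r01; have /andP[r0 r1] := r01.
have Rint (q : probability nat R) : (\int[q]_k (r ^+ k))%R = pgf q r.
  rewrite /Rintegral ge0_integral_nat; last by move=> k; rewrite lee_fin exprn_ge0.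
  by congr fine; apply: eq_eseriesr => k _; rewrite muleC /= prob_weight.
have bnd : bounded_fun (fun k => r ^+ k : R).
  exists 1; split => // M M1 k _ /=.
  by rewrite ger0_norm ?exprn_ge0// (le_trans _ (ltW M1))// exprn_ile1.
have := hY.2 _ bnd; rewrite Rint; apply: cvg_trans; apply: near_eq_cvg.
by apply: nearW => n /=; rewrite Rint cond_pos_law_pgf.
Qed.

Lemma yaglom_pgf0 : pgf nu_min 0 = 0.
Proof.
rewrite /pgf gfr0; last by move=> k; exact: weight_ge0.
by rewrite /weight hY.1.1.
Qed.

Lemma yaglom_survival_cvg r : 0 <= r <= 1 ->
  (1 - pgfn p n r) / (1 - pgfn p n 0) @[n --> \oo] --> 1 - pgf nu_min r.
Proof.
move=> r01; have H := cvgB (@cvg_cst _ (1 : R) nat \oo _) (yaglom_pgf_cvg r01).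
have -> : (fun n => (1 - pgfn p n r) / (1 - pgfn p n 0)) =
  cst 1 - (fun n => (pgfn p n r - pgfn p n 0) / (1 - pgfn p n 0)); last exact: H.
apply/funext => n; rewrite !fctE.
have q0 : 0 < 1 - pgfn p n 0.
  by apply: (pgfn_compl_gt0 m0 mean); rewrite lexx ltr01.
have q0' : 1 - pgfn p n 0 != 0 by rewrite gt_eqF.
by rewrite /cst /=; field.
Qed.

(** Both sides are the limit of (1 - F_(n+1)(r)) / (1 - F_n(0)): F_(n+1)(r) is F_n evaluated at
    F(r), and it is also one step beyond F_n(r), which costs a factor m. *)
Lemma yaglom_pgfE r : 0 <= r < 1 ->
  1 - pgf nu_min (pgf p r) = m * (1 - pgf nu_min r).
Proof.
move=> r01; have /andP[r0 r1] := r01.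
have F01 : 0 <= pgf p r <= 1 by rewrite pgf_ge0// pgf_le1// r0 ltW.
have A := yaglom_survival_cvg F01.
have r01' : 0 <= r <= 1 by rewrite r0 ltW.
have B : (1 - pgfn p (1 + n) r) / (1 - pgfn p n r) *
    ((1 - pgfn p n r) / (1 - pgfn p n 0)) @[n --> \oo] --> m * (1 - pgf nu_min r).
  rewrite -[X in X * _]expr1; apply: cvgM; last exact: yaglom_survival_cvg.
  exact: (@pgfn_ratio_cvg _ p m m0 m1 mean r 1 r01).
have E : (fun n => (1 - pgfn p n (pgf p r)) / (1 - pgfn p n 0)) =
    (fun n => (1 - pgfn p (1 + n) r) / (1 - pgfn p n r) *
    ((1 - pgfn p n r) / (1 - pgfn p n 0))).
  apply/funext => n.
  have q0 : 0 < 1 - pgfn p n r by exact: (pgfn_compl_gt0 m0 mean).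
  by rewrite add1n mulrA divfK ?gt_eqF// -pgfnSr.
by rewrite E in A; apply: (cvg_unique _ A B).
Qed.

End process.

(** * Generating functions of invariant measures *)

Section invariant.
Context {R : realType} (p : probability nat R) (m : R).
Hypothesis m0 : 0 < m.
Hypothesis m1 : m < 1.
Hypothesis mean : (\int[p]_k (k%:R : R)%:E)%E = m%:E.
Implicit Types (nu : {measure set nat -> \bar R}) (r s lambda : R).

Definition gf_finite nu := forall r, 0 <= r < 1 ->
  (egf (EFin \o weight nu) r < +oo)%E.

Definition ngf nu r := gfr (weight nu) r.

Lemma Nstar_weight nu k : Nstar_measure nu -> (weight nu k)%:E = nu [set k].
Proof. by move=> [_ nuoo]; rewrite fineK// ge0_fin_numE. Qed.

Lemma Nstar_weight0 nu : Nstar_measure nu -> weight nu 0 = 0.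
Proof. by move=> [nu0 _]; rewrite /weight nu0. Qed.

Lemma ngf_egf nu r : gf_finite nu -> 0 <= r < 1 ->
  egf (EFin \o weight nu) r = (ngf nu r)%:E.
Proof.
move=> nuoo r01; rewrite egf_gfr//; last exact: nuoo.
- by move=> k; exact: weight_ge0.
- by case/andP: r01.
Qed.

Lemma ngf0 nu : Nstar_measure nu -> ngf nu 0 = 0.
Proof.
by move=> hnu; rewrite /ngf gfr0 ?Nstar_weight0// => k; exact: weight_ge0.
Qed.

Lemma ngf_ge0 nu r : 0 <= r -> 0 <= ngf nu r.
Proof. by move=> r0; apply: gfr_ge0 => // k; exact: weight_ge0. Qed.

Lemma le_ngf nu r s : gf_finite nu -> 0 <= r -> r <= s -> s < 1 ->
  ngf nu r <= ngf nu s.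
Proof.
move=> nuoo r0 rs s1; apply: le_gfr => //; first by move=> k; exact: weight_ge0.
by apply: nuoo; rewrite s1 (le_trans r0).
Qed.

(** The row vector nu P with the column of the absorbing state 0 kept. Because no mass is lost, its
    generating function is exactly G(F(r)). *)
Let image_mass nu j : \bar R := (\sum_(i <oo) nu [set i] * (bgw_trans p i j)%:E)%E.

Let image_mass_ge0 nu j : (0 <= image_mass nu j)%E.
Proof. by apply: nneseries_ge0 => i _ _; rewrite mule_ge0// lee_fin bgw_trans_ge0. Qed.

Let egf_comp nu r : Nstar_measure nu -> 0 <= r <= 1 ->
  egf (EFin \o weight nu) (pgf p r) = egf (image_mass nu) r.
Proof.
move=> hnu r01; have /andP[r0 r1] := r01; symmetry.
transitivity (\sum_(j <oo) \sum_(i <oo) nu [set i] * ((bgw_trans p i j)%:E * (r ^+ j)%:E))%E.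
  apply: eq_eseriesr => j _; rewrite muleC -nneseriesZl; last first.
    by move=> i _; rewrite mule_ge0// lee_fin bgw_trans_ge0.
  by apply: eq_eseriesr => i _; rewrite muleC -muleA.
rewrite nneseries_interchange; last first.
  by move=> i j; rewrite mule_ge0// mule_ge0// lee_fin ?bgw_trans_ge0// exprn_ge0.
apply: eq_eseriesr => i _ /=; rewrite -Nstar_weight//.
rewrite nneseriesZl; last first.
  by move=> j _; rewrite mule_ge0// lee_fin ?bgw_trans_ge0// exprn_ge0.
by rewrite -(bgw_trans_egf p i r01).
Qed.

Let invariantE nu lambda : Nstar_measure nu -> invariant_measure p lambda nu <->
  forall j, (0 < j)%N -> image_mass nu j = (lambda%:E * nu [set j])%E.
Proof.
move=> hnu; have E j : image_mass nu j =
    (\sum_(1 <= i <oo) nu [set i] * (bgw_trans p i j)%:E)%E.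
  rewrite /image_mass nneseries_recl//; last first.
    by move=> i _; rewrite mule_ge0// lee_fin bgw_trans_ge0.
  by rewrite hnu.1 mul0e add0e.
by split=> h j j0; have := h j j0; rewrite E.
Qed.

Let pgfE0 : pgf p 0 = weight p 0.
Proof. by rewrite /pgf gfr0// => k; exact: weight_ge0. Qed.

Let image_mass0 nu : Nstar_measure nu ->
  image_mass nu 0 = egf (EFin \o weight nu) (pgf p 0).
Proof.
move=> hnu; apply: eq_eseriesr => i _.
by rewrite bgw_trans_00 /= Nstar_weight// pgfE0.
Qed.

(** G(F(0)) is the mass absorbed at 0 in one step. The identity holds in the extended reals, so it
    can be used to propagate finiteness. *)
Let egf_functional nu lambda r : Nstar_measure nu -> 0 <= lambda ->
  invariant_measure p lambda nu -> 0 <= r <= 1 ->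
  egf (EFin \o weight nu) (pgf p r) =
  (egf (EFin \o weight nu) (pgf p 0) + lambda%:E * egf (EFin \o weight nu) r)%E.
Proof.
move=> hnu l0 /(invariantE _ hnu) inv r01; have /andP[r0 r1] := r01.
rewrite egf_comp// egf_recl// image_mass0//; congr (_ + _)%E.
rewrite [X in egf X _](_ : _ = (fun k => lambda%:E * (weight nu k.+1)%:E)%E); last first.
  by apply/funext => k; rewrite inv// Nstar_weight.
rewrite egfZ//; last by move=> k; rewrite lee_fin weight_ge0.
rewrite (@egf_recl _ (EFin \o weight nu))//; last by move=> k; rewrite lee_fin weight_ge0.
by rewrite /= Nstar_weight0// add0e muleCA.
Qed.

Lemma exists_offspring : exists2 k, (0 < k)%N & 0 < weight p k.
Proof.
have [K] := mean_partial mean m0; rewrite subrr => Kpos.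
have : exists k : 'I_K, 0 < (k%:R : R) * weight p k.
  apply: contrapT => /forallNP h; move: Kpos; rewrite ltNge => /negP; apply.
  by apply: sumr_le0 => k _; rewrite leNgt; exact/negP/h.
move=> [k kp]; exists k; move: kp.
  by case: (nat_of_ord k) => //; rewrite mul0r ltxx.
by apply: contraTT; rewrite -!leNgt => h; rewrite mulr_ge0_le0.
Qed.

(** One individual has k children and the i others have none. *)
Lemma bgw_trans_ge i k : weight p k * weight p 0 ^+ i <= bgw_trans p i.+1 k.
Proof.
rewrite /= big_ord_recr/= subnn bgw_trans_00 lerDr; apply: sumr_ge0 => j _.
by rewrite mulr_ge0 ?weight_ge0 ?bgw_trans_ge0.
Qed.

(** Finiteness of nu at one state k > 0 with p(k) > 0 bounds G(F(0)), through [bgw_trans_ge]. The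
    functional equation carries finiteness on to every iterate F_n(0), and these tend to 1. *)
Lemma invariant_gf_finite nu lambda : Nstar_measure nu -> 0 <= lambda ->
  invariant_measure p lambda nu -> gf_finite nu.
Proof.
move=> hnu l0 inv; have w0 k : (0 <= (EFin \o weight nu) k)%E.
  by rewrite lee_fin weight_ge0.
have F01 : 0 <= pgf p 0 <= 1.
  by rewrite pgf_ge0// pgf_le1// lexx ler01.
have base : (egf (EFin \o weight nu) (pgf p 0) < +oo)%E.
  have [k k0 pk] := exists_offspring.
  suff : ((weight p k)%:E * egf (EFin \o weight nu) (pgf p 0) <=
          lambda%:E * nu [set k])%E.
    rewrite -Nstar_weight//; apply: contraTT; rewrite -leNgt leye_eq => /eqP ->.
    by rewrite gt0_muley ?lte_fin// leNgt negbK -EFinM ltry.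
  rewrite -((invariantE _ hnu).1 inv)//; rewrite -nneseriesZl; last first.
    by move=> i _; apply: egf_term_ge0 => //; case/andP: F01.
  have H i : ((weight p k)%:E * ((EFin \o weight nu) i * (pgf p 0 ^+ i)%:E) <=
      nu [set i] * (bgw_trans p i k)%:E)%E.
    rewrite muleCA /= Nstar_weight//; case: i => [|i].
      by rewrite hnu.1 !mul0e.
    rewrite lee_wpmul2l// -EFinM lee_fin (le_trans _ (bgw_trans_ge i k))// pgfE0.
    rewrite ler_wpM2l ?weight_ge0// exprS ler_piMl ?exprn_ge0 ?weight_ge0//.
    by rewrite -pgfE0; case/andP: F01.
  apply: lee_nneseries => i; last by move=> _; exact: H.
  move=> _ _; apply: mule_ge0; first by rewrite lee_fin weight_ge0.
  by apply: egf_term_ge0 => //; case/andP: F01.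
have fin n : (egf (EFin \o weight nu) (pgfn p n 0) < +oo)%E.
  elim: n => [|n IH]; first by rewrite egf0//= ltry.
  rewrite pgfnS (egf_functional hnu l0 inv); last by rewrite pgfn_le1 ?lexx ?ler01.
  by rewrite lte_add_pinfty// lte_mul_pinfty.
move=> r /andP[r0 r1].
have := @pgfn_cvg _ p m m0 m1 mean 0; rewrite lexx ler01 => /(_ isT).
move=> /cvgrPdist_lt /(_ (1 - r)); rewrite subr_gt0 => /(_ r1) [N _ /(_ N (leqnn _))] /=.
rewrite ger0_norm; last first.
  by rewrite subr_ge0; have /andP[] : 0 <= pgfn p N 0 <= 1 by rewrite pgfn_le1// lexx ler01.
by move=> h; apply: le_lt_trans (fin N); apply: le_egf => //; lra.
Qed.

Lemma invariantP nu lambda : Nstar_measure nu -> 0 <= lambda ->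
  invariant_measure p lambda nu <->
  gf_finite nu /\
  forall r, 0 <= r < 1 -> ngf nu (pgf p r) = ngf nu (pgf p 0) + lambda * ngf nu r.
Proof.
move=> hnu l0.
have w0 k : (0 <= (EFin \o weight nu) k)%E by rewrite lee_fin weight_ge0.
have F01 r : 0 <= r < 1 -> 0 <= pgf p r < 1.
  by move=> r01; rewrite (pgf_lt1 m0 mean)// andbT pgf_ge0//; case/andP: r01.
have z01 : 0 <= (0 : R) < 1 by rewrite lexx ltr01.
split=> [inv|[nuoo eqn]].
  have nuoo := invariant_gf_finite hnu l0 inv; split => // r r01.
  apply: EFin_inj; rewrite EFinD EFinM -!ngf_egf ?F01//.
  by apply: egf_functional => //; case/andP: r01 => -> /ltW.
apply/(invariantE _ hnu).
(* [D] is the coefficient sequence that the functional equation prescribes for G(F(r)); its entry at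
   0 is the absorbed mass. *)
pose D j : \bar R := if j == 0%N then (ngf nu (pgf p 0))%:E
  else (lambda%:E * nu [set j])%E.
have D0 j : (0 <= D j)%E.
  rewrite /D; case: eqP => _; last by rewrite mule_ge0// lee_fin.
  by rewrite lee_fin ngf_ge0//; case/andP: (F01 _ z01).
have DE r : 0 < r < 1 -> egf D r = (ngf nu (pgf p r))%:E.
  move=> /andP[r0 r1]; have r01 : 0 <= r < 1 by rewrite (ltW r0).
  rewrite eqn// EFinD EFinM -(ngf_egf _ r01)// egf_recl ?(ltW r0)//.
  rewrite {1}/D /=; congr (_ + _)%E.
  rewrite [X in egf X _](_ : _ = (fun k => lambda%:E * (weight nu k.+1)%:E)%E); last first.
    by apply/funext => k; rewrite /D/= Nstar_weight.
  rewrite egfZ ?(ltW r0)//; last by move=> k; exact: w0.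
  rewrite (@egf_recl _ (EFin \o weight nu)) ?(ltW r0)//.
  by rewrite /= Nstar_weight0// add0e muleCA.
suff -> : image_mass nu = D by move=> j; rewrite /D; case: j.
apply: (@egf_inj _ _ _ 1) => // r r01; first by rewrite DE// ltry.
have /andP[r0 r1] := r01.
rewrite DE// -egf_comp ?(ltW r0) ?(ltW r1)// ngf_egf//.
by apply: F01; rewrite r1 (ltW r0).
Qed.

Lemma ngf_iter nu lambda n r : gf_finite nu ->
  (forall r, 0 <= r < 1 -> ngf nu (pgf p r) = ngf nu (pgf p 0) + lambda * ngf nu r) ->
  0 <= r < 1 -> Nstar_measure nu ->
  ngf nu (pgfn p n r) = ngf nu (pgfn p n 0) + lambda ^+ n * ngf nu r.
Proof.
move=> nuoo eqn r01 hnu; have z01 : 0 <= (0 : R) < 1 by rewrite lexx ltr01.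
elim: n => [|n IH]; first by rewrite /= expr0 mul1r ngf0// add0r.
rewrite !pgfnS eqn ?(pgfn_01 m0 mean)// IH.
rewrite [in RHS]eqn ?(pgfn_01 m0 mean)// exprS; ring.
Qed.

Context (d : measure_display) (Omega : measurableType d)
    (P1 : probability Omega R) (Z : nat -> {RV P1 >-> nat}).
Hypothesis hZ : bgw_process p 1 Z.
Context (nu_min : probability nat R).
Hypothesis hY : yaglom_limit Z nu_min.

Lemma ngf_compare nu lambda j r s : Nstar_measure nu -> 0 < lambda ->
  invariant_measure p lambda nu -> 0 < r < 1 -> 0 < s < 1 -> s <= pgfn p j r ->
  ngf nu s * (m ^+ j * pgf nu_min r) <= lambda ^+ j * ngf nu r * pgf nu_min s.
Proof.
move=> hnu l0 inv /andP[r0 r1] /andP[s0 s1] sr.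
have [nuoo eqn] := (invariantP hnu (ltW l0)).1 inv.
have r01 : 0 <= r < 1 by rewrite r1 ltW.
have s01 : 0 <= s < 1 by rewrite s1 ltW.
have r01' : 0 <= r <= 1 by rewrite !ltW.
have s01' : 0 <= s <= 1 by rewrite !ltW.
have z01 : 0 <= (0 : R) < 1 by rewrite lexx ltr01.
pose u t n := (pgfn p n t - pgfn p n 0) / (1 - pgfn p n 0).
have q0 n : 0 < 1 - pgfn p n 0 by exact: (pgfn_compl_gt0 m0 mean).
have step n : ngf nu s * ((1 - pgfn p (j + n) 0) / (1 - pgfn p n 0) * u r (n + j)%N) <=
    lambda ^+ j * ngf nu r * u s n.
  (* The increment of G over [F_n(0), F_n(s)] is lambda^n G(s), and over [F_(n+j)(0), F_(n+j)(r)] it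
     is lambda^(n+j) G(r). The second interval lies further right, as s <= F_j(r), so its slope is
     the larger one. After division by 1 - F_n(0) the lengths of the intervals tend to H(s) and m^j
     H(r). *)
  have S : (ngf nu (pgfn p n s) - ngf nu (pgfn p n 0)) *
     (pgfn p (n + j) r - pgfn p (n + j) 0) <=
     (ngf nu (pgfn p (n + j) r) - ngf nu (pgfn p (n + j) 0)) *
     (pgfn p n s - pgfn p n 0).
    have pj := pgfn_01 m0 mean j.
    apply: gfr_slope; rewrite ?pgfn_ge0 ?(ltW r0) ?(ltW s0) ?le_pgfn ?(ltW r1) ?(ltW s1) ?(ltW r0) ?(ltW s0)//.
    - by move=> k; exact: weight_ge0.
    - by rewrite pgfnD le_pgfn//; have /andP[? /ltW] := pj 0 z01.
    - by rewrite pgfnD le_pgfn ?(ltW s0)//; have /andP[? /ltW] := pj r r01.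
    - by apply: nuoo; exact: (pgfn_01 m0 mean).
  move: S; rewrite (ngf_iter n nuoo eqn s01 hnu) (ngf_iter (n + j) nuoo eqn r01 hnu).
  rewrite ![_ + _ * _ - _]addrAC !subrr !add0r exprD => S.
  have ln : 0 < lambda ^+ n by rewrite exprn_gt0.
  have {S} : ngf nu s * (pgfn p (n + j) r - pgfn p (n + j) 0) <=
      lambda ^+ j * ngf nu r * (pgfn p n s - pgfn p n 0).
    by rewrite -(ler_pM2l ln) !mulrA.
  rewrite -(ler_pM2r (x := (1 - pgfn p n 0)^-1)) ?invr_gt0// => S.
  rewrite /u (addnC j n) [leRHS]mulrA (le_trans _ S)// le_eqVlt; apply/orP; left.
  have qn := lt0r_neq0 (q0 n); have qnj := lt0r_neq0 (q0 (n + j)%N).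
  by apply/eqP; field; rewrite qn qnj.
have ucvg t : 0 <= t <= 1 -> u t n @[n --> \oo] --> pgf nu_min t.
  exact: (yaglom_pgf_cvg m0 mean hZ hY).
have L : ngf nu s * ((1 - pgfn p (j + n) 0) / (1 - pgfn p n 0) * u r (n + j)%N)
    @[n --> \oo] --> ngf nu s * (m ^+ j * pgf nu_min r).
  apply: cvgM; first exact: cvg_cst.
  apply: cvgM; first exact: (pgfn_ratio_cvg m0 m1 mean).
  by rewrite (cvg_shiftn j (u r)); exact: ucvg.
have M : lambda ^+ j * ngf nu r * u s n
    @[n --> \oo] --> lambda ^+ j * ngf nu r * pgf nu_min s.
  by apply: cvgM; [exact: cvg_cst|exact: ucvg].
by apply: (ler_cvg_to L M); exact: nearW.
Qed.

Lemma ngf_eq0 nu : Nstar_measure nu -> gf_finite nu ->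
  (forall r, 0 < r < 1 -> ngf nu r = 0) -> nu [set: nat] = 0%E.
Proof.
move=> hnu nuoo h.
have w : weight nu = fun=> 0.
  apply: (@gfr_inj _ _ _ 1) => // [k|r r01|r r01|r r01].
  - exact: weight_ge0.
  - by apply: nuoo; case/andP: r01 => /ltW -> ->.
  - by rewrite /egf eseries0// => k _ _; rewrite /= mul0e.
  - by rewrite -/(ngf nu r) h// /gfr /egf eseries0// => k _ _; rewrite /= mul0e.
rewrite measure_nat eseries0// => k _ _.
by rewrite -Nstar_weight// w mule0.
Qed.

Lemma pgfn_ge_eventually r s : 0 <= r < 1 -> s < 1 ->
  exists N, forall j, (N <= j)%N -> s <= pgfn p j r.
Proof.
move=> r01 s1; have r01' : 0 <= r <= 1 by case/andP: r01 => -> /ltW.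
have /cvgrPdist_lt /(_ (1 - s)) := pgfn_cvg m0 m1 mean r01'.
rewrite subr_gt0 => /(_ s1) [N _ h]; exists N => j /h /=.
rewrite ger0_norm; first lra.
by rewrite subr_ge0; have /andP[] := pgfn_le1 p j r01'.
Qed.

(** If lambda > 0, [ngf_compare] with r = 1/2 bounds G(s) by a constant times (lambda / m)^j for all
    large j. If lambda <= 0, positivity decides. *)
Lemma no_invariant_lt nu lambda : lambda < m -> Nstar_measure nu ->
  invariant_measure p lambda nu -> nu [set: nat] = 0%E.
Proof.
move=> lm hnu inv; have h12 : 0 < (1 / 2 : R) < 1 by apply/andP; split; lra.
have [l0|l0] := ltP 0 lambda.
  have [nuoo eqn] := (invariantP hnu (ltW l0)).1 inv.
  apply: ngf_eq0 => // s s01; have /andP[s0 s1] := s01.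
  apply/eqP; rewrite eq_le ngf_ge0 ?(ltW s0)// andbT.
  have Hr : 0 < pgf nu_min (1/2) by exact: pgf_gt0.
  have h12' : 0 <= (1 / 2 : R) < 1 by apply/andP; split; lra.
  have [N hN] := pgfn_ge_eventually h12' s1.
  have S : \forall n \near \oo, ngf nu s * pgf nu_min (1/2) <=
     (lambda / m) ^+ n * (ngf nu (1/2) * pgf nu_min s).
    exists N => // j Nj; have := ngf_compare hnu l0 inv h12 s01 (hN j Nj).
    rewrite mulrCA -ler_pdivlMl ?exprn_gt0// => /le_trans; apply.
    rewrite expr_div_n le_eqVlt; apply/orP; left; apply/eqP.
    by rewrite -!mulrA mulrCA.
  have C : (lambda / m) ^+ n * (ngf nu (1/2) * pgf nu_min s) @[n --> \oo] -->
      0 * (ngf nu (1/2) * pgf nu_min s).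
    apply: cvgM; last exact: cvg_cst.
    apply: cvg_expr; rewrite ger0_norm ?divr_ge0 ?ltW// ltr_pdivrMr// mul1r//.
  have : ngf nu s * pgf nu_min (1/2) <= 0 * (ngf nu (1/2) * pgf nu_min s).
    by apply: (ler_cvg_to _ C S); exact: cvg_cst.
  by rewrite mul0r pmulr_lle0.
(* For lambda <= 0, nu P is nonnegative and lambda nu nonpositive, so both vanish. If lambda < 0
   this kills nu directly; if lambda = 0, then nu P = 0, and some j > 0 is reached with positive
   probability from every state k + 1. *)
have nu_j0 j : (0 < j)%N -> (lambda%:E * nu [set j] = 0)%E.
  move=> j0; apply/eqP; rewrite eq_le mule_le0_ge0 ?lee_fin//=.
  rewrite -(inv j j0); apply: nneseries_ge0 => i _ _.
  by rewrite mule_ge0// lee_fin bgw_trans_ge0.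
rewrite measure_nat eseries0// => k _ _.
case: k => [|k]; first by rewrite hnu.1 mule0.
have [l00|ln0] := eqVneq lambda 0; last first.
  by have /eqP := nu_j0 k.+1 isT; rewrite mule_eq0 eqe (negPf ln0) => /eqP ->; rewrite mule0.
have [j j0 pj] := exists_offspring.
have := (invariantE _ hnu).1 inv j j0; rewrite l00 mul0e => inv0.
have : (nu [set k.+1] * (bgw_trans p k.+1 j)%:E <= 0)%E.
  rewrite -[leRHS]inv0; apply: le_trans (nneseries_lim_ge k.+2 _); last first.
    by move=> i _ _; rewrite mule_ge0// lee_fin bgw_trans_ge0.
  rewrite big_nat_recr//= leeDr// sume_ge0// => i _.
  by rewrite mule_ge0// lee_fin bgw_trans_ge0.
have P0 : 0 < bgw_trans p k.+1 j.
  apply: lt_le_trans (bgw_trans_ge k j); rewrite mulr_gt0// exprn_gt0//.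
  by rewrite -pgfE0 (pgf0_gt0 m1 mean).
rewrite pmule_lle0 ?lte_fin// => h.
by have -> : nu [set k.+1] = 0%E by [apply/eqP; rewrite eq_le h measure_ge0]; rewrite mule0.
Qed.

Lemma invariant_mE nu : Nstar_measure nu -> invariant_measure p m nu <->
  exists c : R, 0 <= c /\ forall A : set nat, nu A = (c%:E * nu_min A)%E.
Proof.
move=> hnu; have h12 : 0 < (1 / 2 : R) < 1 by apply/andP; split; lra.
have hmin := hY.1; split=> [inv|[c [c0 cE]]].
  have [nuoo eqn] := (invariantP hnu (ltW m0)).1 inv.
  have Hr : 0 < pgf nu_min (1/2) by exact: pgf_gt0.
  (* For lambda = m the powers cancel and j disappears. Exchanging r and s then gives equality, so
     that G / H is constant; c is its value at 1/2. *)
  have cmp r s : 0 < r < 1 -> 0 < s < 1 -> ngf nu s * pgf nu_min r <= ngf nu r * pgf nu_min s.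
    move=> r01 s01; have /andP[s0 s1] := s01.
    have r01' : 0 <= r < 1 by case/andP: r01 => /ltW -> ->.
    have [N /(_ N (leqnn N)) hN] := pgfn_ge_eventually r01' s1.
    have := ngf_compare hnu m0 inv r01 s01 hN.
    by rewrite mulrCA -!mulrA ler_pM2l// exprn_gt0.
  pose c := ngf nu (1/2) / pgf nu_min (1/2).
  have c0 : 0 <= c by rewrite divr_ge0 ?ngf_ge0 ?ltW//; lra.
  exists c; split => //.
  have W : weight nu = fun k => c * weight nu_min k.
    have E r : 0 <= r <= 1 -> egf (EFin \o (fun k => c * weight nu_min k)) r =
        (c * pgf nu_min r)%:E.
      move=> r01; rewrite EFinM -pgf_egf// -egfZ//.
        by move=> k; rewrite lee_fin weight_ge0.
      by case/andP: r01.
    apply: (@gfr_inj _ _ _ 1) => // [k|k|r r01|r r01|r r01].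
    - exact: weight_ge0.
    - by rewrite mulr_ge0 ?weight_ge0.
    - by apply: nuoo; case/andP: r01 => /ltW -> ->.
    - by rewrite E ?ltry//; case/andP: r01 => /ltW -> /ltW ->.
    - rewrite [in RHS]/gfr E/=; last by case/andP: r01 => /ltW -> /ltW ->.
      rewrite /c mulrAC; apply/eqP; rewrite eq_sym -subr_eq0 -/(ngf nu r).
      rewrite subr_eq0 eq_sym eq_le ler_pdivlMr// ler_pdivrMr//.
      by rewrite !cmp.
  move=> A; rewrite (measure_nat nu_min) -nneseriesZl; last first.
    by move=> k _; rewrite mule_ge0// lee_fin.
  rewrite measure_nat; apply: eq_eseriesr => k _.
  have nm := prob_weight nu_min k.
  by rewrite muleCA -(Nstar_weight _ hnu) W EFinM nm.
have W k : weight nu k = c * weight nu_min k.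
  by apply: EFin_inj; rewrite Nstar_weight// EFinM prob_weight.
have E r : 0 <= r <= 1 -> egf (EFin \o weight nu) r = (c * pgf nu_min r)%:E.
  move=> r01; rewrite EFinM -pgf_egf// -egfZ//.
  - by apply: eq_eseriesr => k _; rewrite /= W EFinM.
  - by move=> k; rewrite lee_fin weight_ge0.
  - by case/andP: r01.
have E' r : 0 <= r <= 1 -> ngf nu r = c * pgf nu_min r.
  by move=> r01; rewrite /ngf /gfr E.
apply/(invariantP hnu (ltW m0)); split=> [r|r] r01.
  by rewrite E ?ltry//; case/andP: r01 => -> /ltW ->.
have z01 : 0 <= (0 : R) < 1 by rewrite lexx ltr01.
have F01 t : 0 <= t < 1 -> 0 <= pgf p t <= 1.
  by move=> /andP[t0 t1]; rewrite pgf_ge0// pgf_le1// t0 ltW.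
rewrite !E' ?F01//; last by case/andP: r01 => -> /ltW ->.
have e1 := yaglom_pgfE m0 m1 mean hZ hY r01.
have e2 := yaglom_pgfE m0 m1 mean hZ hY z01.
rewrite (yaglom_pgf0 hY) in e2.
have -> : pgf nu_min (pgf p r) = 1 - m * (1 - pgf nu_min r) by rewrite -e1; ring.
have -> : pgf nu_min (pgf p 0) = 1 - m * (1 - 0) by rewrite -e2; ring.
ring.
Qed.

End invariant.

(** * Measures given by a density *)

Section density.
Local Open Scope ereal_scope.
Context d (T : measurableType d) (R : realType) (mu : {measure set T -> \bar R}).
Variables (f : T -> R) (mf : measurable_fun [set: T] f) (f0 : forall x, (0 <= f x)%R).

(** The two proofs are arguments, so that the measure structure can be attached to the term
    [mdensity mu mf f0]. *)
Definition mdensity of measurable_fun [set: T] f & (forall x, 0 <= f x)%R :=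
  fun A : set T => \int[mu]_(x in A) (f x)%:E.

Local Notation mdf := (mdensity mf f0).

Let mdensity0 : mdf set0 = 0.
Proof. exact: integral_set0. Qed.

Let mdensity_ge0 A : 0 <= mdf A.
Proof. by apply: integral_ge0 => x _; rewrite lee_fin. Qed.

Let mdensity_sigma_additive : semi_sigma_additive mdf.
Proof.
move=> F mF tF mUF; apply: cvg_toP.
  by apply: is_cvg_ereal_nneg_natsum => n _; exact: mdensity_ge0.
rewrite /mdensity ge0_integral_bigcup//.
- by apply/measurable_EFinP; exact: measurable_funTS.
- by move=> x _; rewrite lee_fin.
Qed.

HB.instance Definition _ := isMeasure.Build _ _ _ mdf
  mdensity0 mdensity_ge0 mdensity_sigma_additive.

Import HBNNSimple.

Let integral_mdensity_indic E : measurable E ->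
  \int[mdf]_x (\1_E x)%:E = \int[mu]_x ((\1_E x)%:E * (f x)%:E).
Proof.
move=> mE; rewrite integral_indic// setIT /= /mdensity integral_mkcond.
apply: eq_integral => x _; rewrite patchE indicE.
by case: ifPn => _; rewrite ?mul1e ?mul0e.
Qed.

Let integral_mdensity_nnsfun (h : {nnsfun T >-> R}) :
  \int[mdf]_x (h x)%:E = \int[mu]_x ((h x)%:E * (f x)%:E).
Proof.
under [LHS]eq_integral do rewrite fimfunE -fsumEFin//.
rewrite [LHS]ge0_integral_fsum//; last 2 first.
  - by move=> r; exact/measurable_EFinP/measurableT_comp.
  - by move=> n x _; rewrite EFinM nnfun_muleindic_ge0.
under [RHS]eq_integral.
  move=> x xD; rewrite fimfunE -fsumEFin// muleC ge0_mule_fsumr; last first.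
    by move=> r; rewrite EFinM nnfun_muleindic_ge0.
  over.
rewrite [RHS]ge0_integral_fsum//; last 2 first.
  - move=> r; apply: emeasurable_funM; first exact/measurable_EFinP.
    by apply/measurable_EFinP; exact: measurableT_comp.
  - move=> n x _; rewrite EFinM; apply: mule_ge0; first by rewrite lee_fin.
    exact: nnfun_muleindic_ge0.
apply: eq_fsbigr => r _.
under [RHS]eq_integral do rewrite EFinM muleCA (muleC (f _)%:E).
rewrite integralZl_indic_nnsfun//= integral_mdensity_indic//.
have [r0|r0] := leP 0%R r; first rewrite ge0_integralZl//.
- apply: emeasurable_funM; last exact/measurable_EFinP.
  exact/measurable_EFinP.
- by move=> x _; rewrite mule_ge0 ?lee_fin.
- rewrite [in LHS]preimage_nnfun0//= [X in _ * X]integral0_eq ?mule0; last first.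
    by move=> x _; rewrite indic0 mul0e.
  by rewrite [RHS]integral0_eq// => x _; rewrite preimage_nnfun0// indic0 mul0e mule0.
Qed.

Lemma ge0_integral_mdensity (g : T -> \bar R) : measurable_fun setT g ->
  (forall x, 0 <= g x) -> \int[mdf]_x g x = \int[mu]_x (g x * (f x)%:E).
Proof.
move=> mg g0; pose g_ := nnsfun_approx measurableT mg.
transitivity (limn (fun n => \int[mdf]_x (g_ n x)%:E)).
  rewrite -monotone_convergence//=.
  - apply: eq_integral => x _; apply/esym/cvg_lim => //=.
    exact: cvg_nnsfun_approx.
  - by move=> n; apply/measurable_EFinP.
  - by move=> n x _; rewrite lee_fin.
  - by move=> x _ a b ab; rewrite lee_fin//; exact/lefP/nd_nnsfun_approx.
rewrite (_ : \int[mu]_x _ =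
    limn (fun n => \int[mu]_x ((g_ n x)%:E * (f x)%:E))).
  by congr (limn _); apply/funext => n; exact: integral_mdensity_nnsfun.
rewrite -monotone_convergence//=.
- apply: eq_integral => x _; apply/esym/cvg_lim => //.
  by apply: cvgeZr => //; exact: cvg_nnsfun_approx.
- by move=> n; apply: emeasurable_funM; exact/measurable_EFinP.
- by move=> n x _; rewrite mule_ge0 ?lee_fin.
- move=> x _ a b ab; rewrite lee_wpmul2r ?lee_fin//.
  exact/lefP/nd_nnsfun_approx.
Qed.

End density.

(** * Injectivity and continuity of the Laplace transform *)

Section laplace_unique.
Context {R : realType}.
Local Notation TR := (measurableTypeR R).
Implicit Types (tau : {measure set TR -> \bar R}).

Lemma measurable_posreals : measurable (posreals R).
Proof.
rewrite /posreals (_ : [set _ | _] = `]0, +oo[%classic); first exact: measurable_itv.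
by apply/seteqP; split => x /=; rewrite in_itv/= andbT.
Qed.
Hint Resolve measurable_posreals : core.

Lemma measurable_expRN (c : R) (D : set TR) :
  measurable_fun D (fun x : TR => expR (- (c * x))).
Proof.
apply: measurable_funTS; apply: measurableT_comp => //.
by apply: measurableT_comp => //; exact: measurable_funM.
Qed.

(** With w = sqrt z, n w^n is at most the geometric sum of the first n powers of w, hence at most 1
    / (1 - w); the other factor w^n tends to 0. *)
Lemma muln_expr_cvg0 (z : R) : 0 <= z < 1 -> n%:R * z ^+ n @[n --> \oo] --> 0.
Proof.
move=> /andP[z0 z1]; pose w := Num.sqrt z.
have w0 : 0 <= w by exact: sqrtr_ge0.
have w1 : w < 1 by rewrite -sqrtr1 ltr_sqrt.
have zw : z = w * w by rewrite -expr2 sqr_sqrtr.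
have nw n : n%:R * w ^+ n <= (1 - w)^-1.
  have : (\sum_(i < n) w ^+ i) * (1 - w) <= 1.
    have := subrXX 1 w n; rewrite expr1n.
    under [X in _ = _ * X -> _]eq_bigr do rewrite expr1n mul1r.
    by rewrite mulrC => <-; rewrite gerBl exprn_ge0.
  rewrite -ler_pdivlMr ?subr_gt0// div1r; apply: le_trans.
  rewrite (_ : n%:R * w ^+ n = \sum_(i < n) w ^+ n); last first.
    by rewrite sumr_const card_ord mulr_natl.
  by apply: ler_sum => i _; rewrite ler_wiXn2l ?(ltW w1)// ltnW.
apply: (@squeeze_cvgr _ _ _ _ (cst 0) (fun n => (1 - w)^-1 * w ^+ n)).
- apply: nearW => n; rewrite mulr_ge0 ?exprn_ge0//= zw exprMn mulrA.
  by rewrite ler_wpM2r ?exprn_ge0.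
- exact: cvg_cst.
- rewrite -[X in _ --> X](mulr0 (1 - w)^-1); apply: cvgM; first exact: cvg_cst.
  by apply: cvg_expr; rewrite ger0_norm.
Qed.

Lemma bernoulli_ge (u : R) k : 0 <= u <= 1 -> 1 - k%:R * u <= (1 - u) ^+ k.
Proof.
move=> /andP[u0 u1]; elim: k => [|k IH]; first by rewrite expr0 mul0r subr0.
rewrite exprS -natr1.
have : (1 - u) * (1 - k%:R * u) <= (1 - u) * (1 - u) ^+ k.
  by rewrite ler_wpM2l// subr_ge0.
have : 0 <= k%:R * (u * u) by rewrite mulr_ge0// mulr_ge0.
lra.
Qed.

(* The exponent n * 2 ^ n makes the powers tend to 0 also at the threshold y = 1/2. *)
Lemma threshold_cvg1 (y : R) : 0 <= y < 1 / 2 ->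
  (1 - y ^+ n) ^+ (n * 2 ^ n) @[n --> \oo] --> (1 : R).
Proof.
move=> /andP[y0 y2].
have yn n : 0 <= y ^+ n <= 1 by rewrite exprn_ge0// exprn_ile1//; lra.
apply: (@squeeze_cvgr _ _ _ _ (fun n => 1 - n%:R * (2 * y) ^+ n) (cst 1)).
- apply: nearW => n; apply/andP; split; last first.
    by rewrite exprn_ile1//; have /andP[] := yn n; lra.
  by apply: le_trans (bernoulli_ge _ (yn n)); rewrite natrM natrX exprMn mulrA.
- rewrite -[X in _ --> X]subr0; apply: cvgB; first exact: cvg_cst.
  by apply: muln_expr_cvg0; apply/andP; split; lra.
- exact: cvg_cst.
Qed.

(** From 1 - t <= e^(-t) and 2 y >= 1, the power is at most e^(-n). *)
Lemma threshold_cvg0 (y : R) : 1 / 2 <= y <= 1 ->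
  (1 - y ^+ n) ^+ (n * 2 ^ n) @[n --> \oo] --> (0 : R).
Proof.
move=> /andP[y2 y1].
have y0 : 0 <= y by lra.
have yn n : 0 <= 1 - y ^+ n by rewrite subr_ge0 exprn_ile1.
apply: (@squeeze_cvgr _ _ _ _ (cst 0) (fun n => expR (-1) ^+ n)).
- apply: nearW => n; rewrite exprn_ge0//=.
  apply: (@le_trans _ _ (expR (- y ^+ n) ^+ (n * 2 ^ n))).
    by rewrite lerXn2r ?nnegrE ?expR_ge0//; exact: expR_ge1Dx.
  rewrite -!expRM_natl ler_expR natrM mulrN mulrN1 lerN2 -mulrA.
  rewrite -[leLHS]mulr1 ler_wpM2l// natrX -exprMn exprn_ege1//; lra.
- exact: cvg_cst.
- apply: cvg_expr; rewrite ger0_norm ?expR_ge0// -[ltRHS]expR0 ltr_expR; lra.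
Qed.

(** The additional frequency c makes the induction on k possible: removing one factor 1 - e^(-a x)
    turns an integral at c into the difference of those at c and c + a. *)
Let integral_threshold (tau1 tau2 : {measure set TR -> \bar R}) :
  (tau1 setT < +oo)%E -> (tau2 setT < +oo)%E ->
  (forall s : R, 0 <= s ->
    (\int[tau1]_(x in posreals R) (expR (- (s * x)))%:E =
     \int[tau2]_(x in posreals R) (expR (- (s * x)))%:E)%E) ->
  forall k (c a : R), 0 <= c -> 0 <= a ->
    (\int[tau1]_(x in posreals R) (expR (- (c * x)) * (1 - expR (- (a * x))) ^+ k)%:E =
     \int[tau2]_(x in posreals R) (expR (- (c * x)) * (1 - expR (- (a * x))) ^+ k)%:E)%E.
Proof.
move=> fin1 fin2 L.
have mf k (c a : R) : measurable_fun (posreals R)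
    (fun x : TR => expR (- (c * x)) * (1 - expR (- (a * x))) ^+ k).
  apply: measurable_funM; first exact: measurable_expRN.
  apply: measurable_funX; apply: measurable_funB => //; exact: measurable_expRN.
have int tau k (c a : R) : (tau setT < +oo)%E -> 0 <= c -> 0 <= a ->
    tau.-integrable (posreals R)
      (EFin \o (fun x : TR => expR (- (c * x)) * (1 - expR (- (a * x))) ^+ k)).
  move=> fin c0 a0; apply: measurable_bounded_integrable => //.
    by apply: le_lt_trans fin; apply: le_measure; rewrite ?inE.
  have e1 (b x : R) : 0 <= b -> 0 < x -> 0 <= expR (- (b * x)) <= 1.
    move=> b0 x0; rewrite expR_ge0 -[leRHS]expR0 ler_expR oppr_le0.
    by rewrite mulr_ge0// ltW.
  exists 1; split => // M M1 x /= x0; rewrite (le_trans _ (ltW M1))//.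
  have /andP[ec0 ec1] := e1 c x c0 x0; have /andP[ea0 ea1] := e1 a x a0 x0.
  have b0 : 0 <= (1 - expR (- (a * x))) ^+ k by rewrite exprn_ge0//; lra.
  have b1 : (1 - expR (- (a * x))) ^+ k <= 1 by rewrite exprn_ile1//; lra.
  by rewrite ger0_norm ?mulr_ge0// mulr_ile1.
elim=> [|k IH] c a c0 a0.
  by under eq_integral do rewrite expr0 mulr1; under [RHS]eq_integral do rewrite expr0 mulr1; exact: L.
have E tau : (tau setT < +oo)%E ->
  (\int[tau]_(x in posreals R) (expR (- (c * x)) * (1 - expR (- (a * x))) ^+ k.+1)%:E =
   \int[tau]_(x in posreals R) (expR (- (c * x)) * (1 - expR (- (a * x))) ^+ k)%:E -
   \int[tau]_(x in posreals R) (expR (- ((c + a) * x)) * (1 - expR (- (a * x))) ^+ k)%:E)%E.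
  move=> fin; rewrite -integralB_EFin//; last 2 first.
  - exact: int.
  - by apply: int => //; exact: addr_ge0.
  apply: eq_integral => x _; rewrite -EFinB; congr EFin.
  rewrite mulrDl opprD expRD exprS; ring.
by rewrite !E// !IH// addr_ge0.
Qed.

Lemma laplace_unique (tau1 tau2 : {measure set TR -> \bar R}) :
  (tau1 setT < +oo)%E -> (tau2 setT < +oo)%E ->
  tau1 (~` posreals R) = 0%E -> tau2 (~` posreals R) = 0%E ->
  (forall s : R, 0 <= s ->
    (\int[tau1]_(x in posreals R) (expR (- (s * x)))%:E =
     \int[tau2]_(x in posreals R) (expR (- (s * x)))%:E)%E) ->
  forall A, measurable A -> tau1 A = tau2 A.
Proof.
move=> fin1 fin2 z1 z2 L.
(* With y = e^(-x ln 2 / t) the integrand is (1 - y^n)^(n 2^n), and y < 1/2 exactly when x > t.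
   Hence it tends to the indicator of ]t, +oo[, and these half lines generate the Borel sets. *)
pose thr tau (t : R) n := (\int[tau]_(x in posreals R)
    (expR (- (0 * x)) * (1 - expR (- ((n%:R * (ln 2 / t)) * x))) ^+ (n * 2 ^ n))%:E)%E.
have tail_cvg tau (t : R) : 0 < t -> (tau setT < +oo)%E ->
    thr tau t @ \oo --> tau `]t, +oo[%classic.
  move=> t0 fin.
  have finp : (tau (posreals R) < +oo)%E.
    by apply: le_lt_trans fin; apply: le_measure; rewrite ?inE.
  have mtail : measurable (`]t, +oo[%classic : set TR) by exact: measurable_itv.
  have -> : tau `]t, +oo[%classic = (\int[tau]_(x in posreals R) (\1_(`]t, +oo[%classic : set TR) x)%:E)%E.
    rewrite integral_indic//; congr (tau _); apply/seteqP; split => x /=.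
      by rewrite in_itv/= andbT => tx; split => //; exact: lt_trans t0 tx.
    by case.
  have ln2 : 0 < ln (2 : R) by rewrite ln_gt0// ltr1n.
  pose f n (x : TR) :=
    expR (- (0 * x)) * (1 - expR (- ((n%:R * (ln 2 / t)) * x))) ^+ (n * 2 ^ n).
  have mf n : measurable_fun (posreals R) (EFin \o f n).
    apply/measurable_EFinP; apply: measurable_funM; first exact: measurable_expRN.
    apply: measurable_funX; apply: measurable_funB => //; exact: measurable_expRN.
  pose ind : TR -> R := \1_(`]t, +oo[%classic : set TR).
  have mi : measurable_fun (posreals R) (EFin \o ind).
    by apply/measurable_EFinP; exact: measurable_indic.
  pose y x := expR (- (ln 2 / t * x)).
  have yE n x : expR (- (n%:R * (ln 2 / t) * x)) = y x ^+ n.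
    by rewrite /y -expRM_natl; congr expR; ring.
  have y1 x : 0 < x -> 0 <= y x <= 1.
    move=> x0; rewrite expR_ge0 -[leRHS]expR0 ler_expR oppr_le0.
    by rewrite mulr_ge0 ?divr_ge0// ltW.
  have e12 : expR (- ln 2) = 1 / 2 :> R by rewrite expRN lnK ?posrE// div1r.
  have fcvg : {ae tau, forall x, posreals R x ->
      (EFin \o f n) x @[n --> \oo] --> (EFin \o ind) x}.
    apply: aeW => x x0; apply: cvg_EFin; first by apply: nearW.
    have -> : fine \o (fun n => (EFin \o f n) x) = (fun n => (1 - y x ^+ n) ^+ (n * 2 ^ n)).
      by apply/funext => n /=; rewrite /f mul0r oppr0 expR0 mul1r yE.
    rewrite /ind /= indicE; have [tx|tx] := ltP t x.
      rewrite mem_set; last by rewrite /= in_itv/= tx.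
      apply: threshold_cvg1; have /andP[-> _]/= := y1 x x0.
      by rewrite -e12 ltr_expR ltrN2 mulrAC ltr_pdivlMr// ltr_pM2l.
    rewrite memNset; last by rewrite /= in_itv/= andbT; apply/negP; rewrite -leNgt.
    apply: threshold_cvg0; have /andP[_ ->] := y1 x x0; rewrite andbT.
    rewrite -e12 ler_expR lerN2 mulrAC ler_pdivrMr//.
    by rewrite ler_pM2l.
  have fle : {ae tau, forall x n, posreals R x -> (`|(EFin \o f n) x| <= cst 1 x)%E}.
    apply: aeW => x n x0 /=; rewrite lee_fin /f mul0r oppr0 expR0 mul1r yE.
    have /andP[y0 yy1] := y1 x x0.
    have h : 0 <= 1 - y x ^+ n <= 1 by rewrite subr_ge0 exprn_ile1//= gerBl exprn_ge0.
    have /andP[h0 h1] := h.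
    by rewrite ger0_norm ?exprn_ge0// exprn_ile1.
  have i1 : tau.-integrable (posreals R) (cst 1%E).
    apply: (@measurable_bounded_integrable _ _ _ tau (cst 1) _ measurable_posreals finp).
      exact: measurable_cst.
    by exists 1; split => // M M1 x _; rewrite /= normr1 ltW.
  by have [_ _] := dominated_convergence measurable_posreals mf mi fcvg i1 fle.
have tail (t : R) : 0 < t -> tau1 `]t, +oo[%classic = tau2 `]t, +oo[%classic.
  move=> t0; have T1 := tail_cvg tau1 t t0 fin1; have T2 := tail_cvg tau2 t t0 fin2.
  have E : thr tau1 t = thr tau2 t.
    apply/funext => n; apply: integral_threshold => //.
    by rewrite mulr_ge0// divr_ge0 ?(ltW t0)// ln_ge0// ler1n.
  by rewrite E in T1; exact: (cvg_unique _ T1 T2).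
have posE tau (t : R) : tau (~` posreals R) = 0%E -> t <= 0 -> tau `]t, +oo[%classic = tau (posreals R).
  move=> z t0; have sub : posreals R `<=` (`]t, +oo[%classic : set TR).
    by move=> x /= x0; rewrite in_itv/= andbT (le_lt_trans t0).
  have mt : measurable (`]t, +oo[%classic : set TR) by exact: measurable_itv.
  apply/eqP; rewrite eq_le; apply/andP; split; last by apply: le_measure => //; rewrite inE.
  rewrite -[leRHS]adde0 -z -measureU//; [|exact: measurableC|by rewrite setICr].
  by apply: le_measure => //; rewrite ?inE ?setUv.
move=> A mA; apply: (@measure_unique _ R TR (@RGenOInfty.G R) (fun n => `](- (n%:R : R)), +oo[%classic)) => //.
- exact: RGenOInfty.measurableE.
- move=> _ _ [x ->] [z ->]; exists (Num.max x z).
  apply/seteqP; split => w; rewrite /= !in_itv/= !andbT gt_max; first by move=> [-> ->].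
  by move=> /andP[].
- by move=> n; exists (- n%:R).
- apply/seteqP; split => // x _; exists (Num.truncn `|x|).+1 => //=.
  rewrite in_itv/= andbT ltrNl (le_lt_trans (ler_norm _))// normrN.
  by rewrite truncnS_gt.
(* For t <= 0 the half line carries the whole mass, which is the transform at s = 0. *)
- move=> _ [t ->]; have [t0|t0] := ltP 0 t; first exact: tail.
  rewrite !posE//.
  have := L 0 (lexx 0); under eq_integral do rewrite mul0r oppr0 expR0.
  under [in X in _ = X -> _]eq_integral do rewrite mul0r oppr0 expR0.
  by rewrite !integral_cst// !mul1e.
- by move=> n; apply: le_lt_trans fin1; apply: le_measure; rewrite ?inE.
Qed.

End laplace_unique.

(** * Helly selection: subsequences and monotone envelopes *)

Section diagonal.
Context {R : realType}.

(** In place of nested subsequences, Tychonoff's theorem gives a cluster point l in a product of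
    segments. The j-th index is then chosen beyond j and within 1 / (j + 1) of l on the first j + 1
    coordinates. *)
Lemma diagonal_extraction (N : nat -> nat -> R) (B : nat -> R) :
  (forall n i, 0 <= N n i <= B i) ->
  exists (k : nat -> nat) (l : nat -> R),
    (forall j, (j <= k j)%N) /\ forall i, N (k j) i @[j --> \oo] --> l i.
Proof.
move=> NB; pose K := prod_topology (fun _ : nat => R).
have cK : compact [set f : K | forall i, `[0, B i]%classic (f i)].
  by apply: (@tychonoff nat (fun _ => R) (fun i => `[0, B i]%classic)) => i; exact: segment_compact.
pose F : set_system K := (fun n => N n : K) @ \oo.
have [l [_ clu]] : [set f : K | forall i, `[0, B i]%classic (f i)] `&` cluster F !=set0.
  have FF : ProperFilter F by exact: fmap_proper_filter.
  apply: (cK F FF); exists 0%N => // n _ i /=.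
  by rewrite in_itv/=.
have pick j : exists n, (j <= n)%N /\ forall i, (i <= j)%N -> `|l i - N n i| < j.+1%:R^-1.
  have e0 : 0 < j.+1%:R^-1 :> R by rewrite invr_gt0 ltr0n.
  have nb m : nbhs l [set f : K | forall i, (i < m)%N -> `|l i - f i| < j.+1%:R^-1].
    elim: m => [|m IH]; first by apply: filterS filterT => f _ i.
    have H : nbhs l [set f : K | `|l m - f m| < j.+1%:R^-1].
      apply: (@proj_continuous nat (fun _ => R) m l [set y | `|l m - y| < j.+1%:R^-1]).
      exact: (nbhsx_ballx (l m) _ e0).
    apply: filterS2 IH H => f h1 h2 i; rewrite ltnS leq_eqVlt => /predU1P[->//|].
    exact: h1.
  have FA : F [set f : K | exists2 n, (j <= n)%N & f = N n].
    by exists j => // n /= jn; exists n.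
  have [_ [[n jn ->] h]] := clu _ _ FA (nb j.+1).
  by exists n; split => // i ij; exact: h.
have [k hk] := choice pick.
exists k, l; split => [j|i]; first by have [] := hk j.
apply/cvgrPdist_lt => e e0.
have [M _ hM] := near_infty_natSinv_lt (PosNum e0).
exists (maxn M i) => // j Mij.
have /andP[Mj ij] : (M <= j)%N && (i <= j)%N by rewrite -geq_max.
have [_ /(_ i ij) h] := hk j.
by apply: lt_trans h _; exact: hM.
Qed.

End diagonal.

Section right_envelope.
Context {R : realType}.
Variables (q l : nat -> R) (B : R -> R).
Hypothesis q_dense : forall x y : R, x < y -> exists i, x < q i < y.
Hypothesis l0 : forall i, 0 <= l i.
Hypothesis l_nd : forall i j, q i <= q j -> l i <= l j.

(** The strict inequality x < q i makes [renv] right continuous. [lenv] is its left limit, so that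
    the two differ exactly at the jumps. *)
Definition renv (x : R) : R := inf [set l i | i in [set i | x < q i]].
Definition lenv (x : R) : R := sup [set l i | i in [set i | q i < x]].

Let renv_has_inf x : has_inf [set l i | i in [set i | x < q i]].
Proof.
split; last by exists 0 => _ [i _ <-].
have [i /andP[xi _]] := @q_dense x (x + 1) (ltr_pwDr ltr01 (lexx x)).
by exists (l i); exists i.
Qed.

Let lenv_has_sup x : has_sup [set l i | i in [set i | q i < x]].
Proof.
have x1 : x - 1 < x by rewrite gtrBl.
split.
  by have [i /andP[_ xi]] := q_dense x1; exists (l i); exists i.
have [i /andP[xi _]] := @q_dense x (x + 1) (ltr_pwDr ltr01 (lexx x)).
exists (l i) => _ [j /= jx <-]; apply: l_nd.
exact: ltW (lt_trans jx xi).
Qed.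

Lemma renv_le x i : x < q i -> renv x <= l i.
Proof. by move=> xi; apply: ge_inf; [exact: (renv_has_inf x).2|exists i]. Qed.

Lemma renv_ge0 x : 0 <= renv x.
Proof. by apply: lb_le_inf; [exact: (renv_has_inf x).1|move=> _ [i _ <-]]. Qed.

Lemma le_lenv x i : q i < x -> l i <= lenv x.
Proof. by move=> xi; apply: ub_le_sup; [exact: (lenv_has_sup x).2|exists i]. Qed.

Lemma renv_adherent x e : 0 < e -> exists2 i, x < q i & l i < renv x + e.
Proof.
by move=> e0; have [_ [i xi <-] h] := inf_adherent e0 (renv_has_inf x); exists i.
Qed.

Lemma lenv_adherent x e : 0 < e -> exists2 i, q i < x & lenv x - e < l i.
Proof.
by move=> e0; have [_ [i xi <-] h] := sup_adherent e0 (lenv_has_sup x); exists i.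
Qed.

Lemma renv_le_lenv x y : x < y -> renv x <= lenv y.
Proof.
move=> xy; have [i /andP[xi iy]] := q_dense xy.
exact: le_trans (renv_le xi) (le_lenv iy).
Qed.

Lemma renv_nd : nondecreasing_fun renv.
Proof.
move=> x y xy; apply: lb_le_inf; first exact: (renv_has_inf y).1.
by move=> _ [i /= yi <-]; apply: renv_le; exact: le_lt_trans xy yi.
Qed.

Lemma renv_rc (x : R) : renv @ x^'+ --> renv x.
Proof.
apply/cvgrPdist_lt => e e0; have [i xi li] := renv_adherent x e0.
near=> y.
have xy : x < y by near: y; exact: nbhs_right_gt.
have yi : y < q i by near: y; exact: nbhs_right_lt.
have h1 := renv_nd (ltW xy); have h2 := renv_le yi.
rewrite distrC ger0_norm; lra.
Unshelve. all: by end_near. Qed.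

(** The gaps ]lenv x, renv x[ at distinct jumps are disjoint, and each contains a member of the
    dense sequence. *)
Lemma env_discontinuity_countable : countable [set x | lenv x < renv x].
Proof.
have /choice[f hf] : forall x : R, exists i, lenv x < renv x -> lenv x < q i < renv x.
  move=> x; have [lr|nlr] := pselect (lenv x < renv x); last by exists 0%N.
  by have [i hi] := q_dense lr; exists i.
apply/countable_injP; exists f => x y; rewrite !inE /= => /hf /andP[x1 x2] /hf /andP[y1 y2] fxy.
have [xy|xy|//] := ltgtP x y.
- by have := renv_le_lenv xy; rewrite fxy in x2; lra.
- by have := renv_le_lenv xy; rewrite fxy in x1 x2; lra.
Qed.

(** Monotonicity traps N n x between its values at some q j < x < q i, whose limits l j and l i are
    close to [lenv x] and [renv x]. *)
Lemma env_cvg (N : nat -> R -> R) (x : R) : (forall n, nondecreasing_fun (N n)) ->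
  (forall i, N n (q i) @[n --> \oo] --> l i) -> renv x <= lenv x ->
  N n x @[n --> \oo] --> renv x.
Proof.
move=> Nnd Nl rl; apply/cvgrPdist_lt => e e0; have e20 : 0 < e / 2 by lra.
have [i xi li] := renv_adherent x e20; have [j jx lj] := lenv_adherent x e20.
have /cvgrPdist_lt /(_ _ e20) Ni := Nl i; have /cvgrPdist_lt /(_ _ e20) Nj := Nl j.
apply: filterS2 Ni Nj => n; rewrite !ltr_norml => /andP[i1 i2] /andP[j1 j2].
have h1 := Nnd n _ _ (ltW xi); have h2 := Nnd n _ _ (ltW jx).
have h3 : lenv x - e / 2 < l j by [].
by apply/andP; split; lra.
Qed.

End right_envelope.

Section as_sigma_finite.
Context d (T : measurableType d) (R : realType) (mu : {measure set T -> \bar R}).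
Hypothesis mu_sf : sigma_finite setT mu.

(** A copy of mu indexed by the proof, so that the structure required by Tonelli's theorem can be
    inferred. *)
Definition as_sigma_finite of sigma_finite setT mu : set T -> \bar R := mu.

HB.instance Definition _ := Measure.copy (as_sigma_finite mu_sf) mu.
HB.instance Definition _ := Measure_isSigmaFinite.Build _ _ _ (as_sigma_finite mu_sf) mu_sf.

End as_sigma_finite.

Section laplace_tonelli.
Context {R : realType}.
Local Notation TR := (measurableTypeR R).
Local Notation mu := (@lebesgue_measure R).

Lemma integral_exp_tail (s y : R) : 0 < s ->
  (\int[mu]_(x in `[y, +oo[) (s * expR (- (s * x)))%:E = (expR (- (s * y)))%:E)%E.
Proof.
move=> s0; pose F (x : R) := - expR (- (s * x)).
have dF (x : R) : is_derive x 1 F (s * expR (- (s * x))).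
  rewrite /F.
  have -> : s * expR (- (s * x)) = - (- s * expR (- (s * x))) by rewrite mulNr opprK.
  apply: is_deriveN.
  have -> : (fun x0 : R => expR (- (s * x0))) = expR \o (fun x0 => - s * x0).
    by apply/funext => z /=; rewrite mulNr.
  have h : is_derive x 1 (fun x0 : R => - s * x0) (- s).
    by apply: is_derive_eq; rewrite /GRing.scale /= mulr1.
  have := is_derive1_comp (is_derive_expR (- s * x)) h.
  by rewrite mulNr mulrC.
have cF : continuous F.
  by move=> x; apply/differentiable_continuous/derivable1_diffP; case: (dF x).
have cf : continuous (fun x : R => s * expR (- (s * x))).
  move=> x; apply: cvgM; first exact: cvg_cst.
  apply: (@continuous_comp _ _ _ (fun x => - (s * x)) expR); last exact: continuous_expR.
  by apply: cvgN; apply: cvgM; [exact: cvg_cst|exact: cvg_id].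
rewrite (@ge0_continuous_FTC2y _ _ F y 0).
- by rewrite /F EFinN oppeK add0e.
- by move=> x _; rewrite mulr_ge0 ?expR_ge0// ltW.
- exact: continuous_subspaceT.
- rewrite /F -oppr0; apply: cvgN.
  rewrite (_ : (fun x => expR _) = (fun z => expR (- z)) \o (fun z => s * z))//.
  apply: (@cvg_comp _ _ _ _ _ _ (pinfty_nbhs R)); last exact: cvgr_expR.
  exact: gt0_cvgMry.
- by move=> x _; case: (dF x).
- exact/cvg_at_right_filter/cF.
- by move=> x _; rewrite derive1E; apply: derive_val.
Qed.

(** Write e^(-s y) as the integral of s e^(-s x) over x >= y and exchange. Laplace transforms become
    Lebesgue integrals of distribution functions, for which almost everywhere convergence is
    enough. *)
Lemma laplace_tonelli (kap : {measure set TR -> \bar R}) (s : R) : 0 < s ->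
  (forall x : R, kap `]-oo, x]%classic < +oo)%E ->
  (\int[kap]_(y in `[0%R, +oo[) (expR (- (s * y)))%:E =
   \int[mu]_(x in `[0%R, +oo[) ((s * expR (- (s * x)))%:E * kap `[0%R, x]%classic))%E.
Proof.
move=> s0 koo.
have sf : sigma_finite setT kap.
  exists (fun n => `]-oo, n%:R]%classic).
    apply/esym/seteqP; split => // x _; exists (Num.truncn `|x|).+1 => //=.
    by rewrite in_itv/= (le_trans (ler_norm _))// ltW// truncnS_gt.
  by move=> n; split => //; exact: measurable_itv.
pose k' : {sigma_finite_measure set TR -> \bar R} := as_sigma_finite sf.
pose A : set (TR * TR) := [set z | 0 <= z.2] `&` [set z | z.2 <= z.1].
have mA : measurable A.
  have m1 : measurable_fun setT (fun z : TR * TR => (0 : R) <= z.2).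
    by apply: measurable_fun_ler => //; exact: measurable_snd.
  have m2 : measurable_fun setT (fun z : TR * TR => (z.2 : R) <= z.1).
    by apply: measurable_fun_ler; [exact: measurable_snd|exact: measurable_fst].
  apply: measurableI.
    by have := m1 measurableT [set true]; rewrite setTI; apply.
  by have := m2 measurableT [set true]; rewrite setTI; apply.
pose f (z : TR * TR) : \bar R := ((s * expR (- (s * z.1))) * \1_A z)%:E.
have f0 z : (0 <= f z)%E.
  by rewrite lee_fin mulr_ge0// ?mulr_ge0 ?expR_ge0// ltW.
have mf : measurable_fun setT f.
  apply/measurable_EFinP; apply: measurable_funM; last exact: measurable_indic.
  apply: measurable_funM => //.
  rewrite (_ : (fun z : TR * TR => expR (- (s * z.1))) =
    (fun y : TR => expR (- (s * y))) \o fst)//.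
  apply: measurableT_comp; first exact: measurable_expRN.
  exact: measurable_fst.
have F : (\int[mu]_x \int[k']_y f (x, y) = \int[k']_y \int[mu]_x f (x, y))%E.
  exact: (fubini_tonelli f).
have L : (\int[k']_y \int[mu]_x f (x, y) =
   \int[kap]_(y in `[0%R, +oo[) (expR (- (s * y)))%:E)%E.
  rewrite [RHS]integral_mkcond; apply: eq_integral => y _.
  rewrite patchE; case: ifPn; rewrite ?inE /= ?in_itv/= ?andbT => y0; last first.
    apply: integral0_eq => x _; rewrite /f indicE memNset ?mulr0//= => -[/= y0' _].
    by move: y0; rewrite notin_setE/= in_itv/= y0'.
  rewrite -(integral_exp_tail y s0) [RHS]integral_mkcond; apply: eq_integral => x _.
  rewrite /f patchE; case: ifPn; rewrite ?inE /= ?in_itv/= ?andbT => yx.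
    by rewrite indicE mem_set ?mulr1.
  rewrite indicE memNset ?mulr0// => -[/= _ yx'].
  by move: yx; rewrite notin_setE/= in_itv/= yx'.
rewrite -L -F [RHS]integral_mkcond; apply: eq_integral => x _.
rewrite patchE; case: ifPn; rewrite ?inE /= ?in_itv/= ?andbT => x0; last first.
  apply: integral0_eq => y _; rewrite /f indicE memNset ?mulr0//= => -[/= y0 yx].
  by move: x0; rewrite notin_setE/= in_itv/= (le_trans y0 yx).
transitivity (\int[kap]_y ((s * expR (- (s * x)))%:E * (\1_(`[0%R, x]%classic : set TR) y)%:E))%E.
  apply: eq_integral => y _; rewrite /f EFinM; congr (_ * _%:E)%E.
  rewrite !indicE; congr ((nat_of_bool _)%:R); apply/idP/idP; rewrite !inE /= in_itv/=.
    by move=> [/= -> ->].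
  by move=> /andP[].
rewrite ge0_integralZl//.
- by rewrite integral_indic ?setIT//; exact: measurable_itv.
- by apply/measurable_EFinP/measurable_indic; exact: measurable_itv.
- by rewrite lee_fin mulr_ge0 ?expR_ge0// ltW.
Qed.

End laplace_tonelli.

Section laplace_continuity.
Context {R : realType}.
Local Notation TR := (measurableTypeR R).
Local Notation mu := (@lebesgue_measure R).
Local Notation R0 := (`[0, +oo[%classic : set TR).
Implicit Types x y s a b : R.

Lemma stieltjes_itvoc (F : cumulative R R) (a b : R) : a <= b ->
  lebesgue_stieltjes_measure F `]a, b]%classic = (F b - F a)%:E.
Proof.
move=> ab; rewrite /lebesgue_stieltjes_measure/= /measure_extension/= measurable_mu_extE//; last exact: is_ocitv.
exact: wlength_itv_bnd.
Qed.

Section stieltjes_ge0.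
Variable F : cumulative R R.
Hypothesis F0 : forall x : R, x < 0 -> F x = 0.
Local Notation K := (lebesgue_stieltjes_measure F).

Lemma stieltjes_lt0 : K `]-oo, 0[%classic = 0%E.
Proof.
pose A n : set TR := `](- n.+1%:R), (- n.+1%:R^-1)]%classic.
have mA n : measurable (A n) by exact: measurable_itv.
have KA n : K (A n) = 0%E.
  have h : 0 < n.+1%:R^-1 :> R by rewrite invr_gt0 ltr0n.
  have h' : n.+1%:R^-1 <= n.+1%:R :> R.
    by rewrite (@le_trans _ _ 1)// ?invf_le1 ?ler1n ?ltr0n.
  by rewrite stieltjes_itvoc ?lerN2// !F0 ?subrr// oppr_lt0.
have sub : `]-oo, 0[%classic `<=` \bigcup_n A n.
  move=> x /=; rewrite in_itv/= => x0.
  pose n := maxn (Num.truncn (- x)).+1 (Num.truncn ((- x)^-1)).+1.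
  have xn : - x < n.+1%:R.
    by rewrite (lt_le_trans (truncnS_gt _))// ler_nat /n leqW// leq_maxl.
  have xn' : (- x)^-1 < n.+1%:R.
    by rewrite (lt_le_trans (truncnS_gt _))// ler_nat /n leqW// leq_maxr.
  exists n => //; rewrite /A /= in_itv/= ltrNl xn/= lerNr.
  rewrite invf_ple ?posrE ?oppr_gt0//; exact: ltW.
apply/eqP; rewrite eq_le measure_ge0 andbT.
apply: le_trans (measure_sigma_subadditive _ mA _ sub) _; first exact: measurable_itv.
by rewrite eseries0// => i _ _; exact: KA.
Qed.

(** The interval contains 0, where F may jump from the value 0; so the mass is F x and not F x - F
    0. *)
Lemma stieltjes_itvcc x : 0 <= x -> K `[0, x]%classic = (F x)%:E.
Proof.
move=> x0.
have E : `](-1), x]%classic = `](-1), 0[%classic `|` `[0, x]%classic :> set R.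
  by rewrite -itv_bndbnd_setU// bnd_simp; lra.
have Z : K `](-1), 0[%classic = 0%E.
  apply/eqP; rewrite eq_le measure_ge0 andbT -stieltjes_lt0.
  apply: le_measure; rewrite ?inE; [exact: measurable_itv|exact: measurable_itv|].
  by move=> y /=; rewrite !in_itv/= => /andP[].
have m1x : -1 <= x by lra.
have m10 : -1 < 0 :> R by lra.
have -> : F x = F x - F (-1) by rewrite (F0 m10) subr0.
rewrite -stieltjes_itvoc// E -[LHS]add0e -Z; symmetry; apply: measureU.
- exact: measurable_itv.
- exact: measurable_itv.
by apply/seteqP; split => // y [/=]; rewrite !in_itv/= => /andP[_ y0] /andP[]; rewrite leNgt y0.
Qed.

Lemma stieltjes_itvNyc x : (K `]-oo, x]%classic < +oo)%E.
Proof.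
apply: (@le_lt_trans _ _ (K (`]-oo, 0[%classic `|` `[0, Num.max 0 x]%classic))).
  apply: le_measure; rewrite ?inE; [exact: measurable_itv| |].
    by apply: measurableU; exact: measurable_itv.
  move=> y /=; rewrite !in_itv/= => yx; have [y0|y0] := ltP y 0; [by left|right].
  by rewrite le_max yx orbT.
have -> : K (`]-oo, 0[%classic `|` `[0, Num.max 0 x]%classic) =
    (K `]-oo, 0%R[%classic + K `[0%R, Num.max 0%R x]%classic)%E.
  apply: measureU; [exact: measurable_itv|exact: measurable_itv|].
  by apply/seteqP; split => // y [/=]; rewrite !in_itv/= => y0 /andP[]; rewrite leNgt y0.
by rewrite stieltjes_lt0 add0e stieltjes_itvcc ?ltry// le_max lexx.
Qed.

End stieltjes_ge0.

Lemma rat_enum_dense : exists q : nat -> R, forall x y : R, x < y -> exists i, x < q i < y.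
Proof.
exists (fun i => if @choice.unpickle rat i is Some r then ratr r else 0) => x y.
move=> /rat_in_itvoo[r]; rewrite in_itv/= => h.
by exists (choice.pickle r); rewrite choice.pickleK.
Qed.

(** Helly selection for the distribution functions, followed by dominated convergence in the form of
    [laplace_tonelli]. Transforms are only given for s > 0, so total masses may be infinite, and the
    limit is taken on [0, +oo[ because mass may accumulate at 0. *)
Theorem laplace_continuity (kap : nat -> {measure set TR -> \bar R})
    (ph : nat -> R -> R) (phi : R -> R) :
  (forall n, kap n (~` posreals R) = 0%E) ->
  (forall n s, 0 < s ->
    (\int[kap n]_(x in posreals R) (expR (- (s * x)))%:E = (ph n s)%:E)%E) ->
  (forall s, 0 < s -> ph n s @[n --> \oo] --> phi s) ->
  exists K : {measure set TR -> \bar R},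
    (forall x : R, K `]-oo, x]%classic < +oo)%E /\
    forall s, 0 < s ->
        (\int[K]_(x in `[0%R, +oo[) (expR (- (s * x)))%:E = (phi s)%:E)%E.
Proof.
move=> kap0 L Lphi.
have bnd s : exists C, 0 < s -> 0 <= C /\ forall n, ph n s <= C.
  have [s0|] := ltP 0 s; last by exists 0.
  have /cvg_seq_bounded[M [_ hM]] : cvgn (ph ^~ s) by apply/cvg_ex; exists (phi s); exact: Lphi.
  exists (M + 1) => _; have h n : `|ph n s| <= M + 1 by apply: hM => //; rewrite ltrDl.
  by split => [|n]; [exact: le_trans (normr_ge0 (ph 0%N s)) (h 0%N)|exact: le_trans (ler_norm _) (h n)].
have [C hC] := choice bnd.
have mpos : measurable (posreals R) by exact: measurable_posreals.
have kapN n (A : set TR) : measurable A -> kap n A = kap n (A `&` posreals R).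
  move=> mA; rewrite -[in LHS](setIT A) -(setUv (posreals R)) setIUr measureU.
  - rewrite [X in (_ + X)%E](_ : _ = 0%E) ?adde0//.
    apply/eqP; rewrite eq_le measure_ge0 andbT -(kap0 n).
    apply: le_measure; rewrite ?inE; last exact: subIsetr.
      by apply: measurableI => //; exact: measurableC.
    exact: measurableC.
  - exact: measurableI.
  - by apply: measurableI => //; exact: measurableC.
  - by rewrite setIACA setICr setI0.
(* A Chernoff bound: e^(s (x - y)) >= 1 for y <= x. Keeping s free allows s / 2 in the domination
   below. *)
have kap_le n s (x : R) : 0 < s ->
    (kap n `]-oo, x]%classic <= (expR (s * x) * ph n s)%:E)%E.
  move=> s0; rewrite kapN; last exact: measurable_itv.
  set A := _ `&` _; have mA : measurable A by apply: measurableI => //; exact: measurable_itv.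
  have mexpE : measurable_fun (posreals R) (fun y : TR => (expR (- (s * y)))%:E).
    by apply/measurable_EFinP; exact: measurable_expRN.
  rewrite EFinM -L// -ge0_integralZl ?lee_fin ?expR_ge0//.
  rewrite -[leLHS]mul1e -integral_cst//.
  apply: (@le_trans _ _ (\int[kap n]_(y in A) ((expR (s * x))%:E * (expR (- (s * y)))%:E))%E).
    apply: ge0_le_integral => //.
    - apply: emeasurable_funM => //; by apply/measurable_EFinP; exact: measurable_expRN.
    - move=> y [/=]; rewrite in_itv/= => yx _; rewrite -EFinM -expRD lee_fin.
      rewrite -[leLHS]expR0 ler_expR subr_ge0 ler_pM2l//.
  apply: ge0_subset_integral => //.
  - exact: emeasurable_funM.
  - exact: subIsetr.
have koo n (x : R) : (kap n `]-oo, x]%classic < +oo)%E.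
  by apply: le_lt_trans (kap_le n 1 x ltr01) (ltry _).
pose N n (x : R) := fine (kap n `[0, x]%classic).
have mcc (x y : R) : measurable (`[x, y]%classic : set TR) by exact: measurable_itv.
have cc_le n (x : R) : (kap n `[0%R, x]%classic <= kap n `]-oo, x]%classic)%E.
  apply: le_measure; rewrite ?inE; [exact: mcc|exact: measurable_itv|].
  by move=> y /=; rewrite !in_itv/= => /andP[].
have NE n x : kap n `[0, x]%classic = (N n x)%:E.
  by rewrite fineK// ge0_fin_numE//; exact: le_lt_trans (cc_le n x) (koo n x).
have N0 n x : 0 <= N n x by rewrite fine_ge0.
have Nle n s x : 0 < s -> N n x <= expR (s * x) * C s.
  move=> s0; rewrite -lee_fin -NE; apply: le_trans (cc_le n x) _.
  apply: le_trans (kap_le n s x s0) _; rewrite lee_fin ler_wpM2l ?expR_ge0//.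
  exact: (hC s s0).2.
have Nnd n : nondecreasing_fun (N n).
  move=> x y xy; rewrite -lee_fin -!NE; apply: le_measure; rewrite ?inE//.
  by move=> z /=; rewrite !in_itv/= => /andP[-> /le_trans->].
have Nneg n x : x < 0 -> N n x = 0.
  by move=> x0; rewrite /N set_itv_ge ?measure0// bnd_simp -ltNge.
have [q q_dense] := rat_enum_dense.
have [i|k [l [kj kl]]] := @diagonal_extraction R (fun n i => N n (q i)) (fun i => expR (1 * q i) * C 1).
  by move=> j; rewrite N0/= Nle.
have l0 i : 0 <= l i.
  by apply: (ler_cvg_to (cvg_cst 0) (kl i)); apply: nearW => j; exact: N0.
have l_nd i j : q i <= q j -> l i <= l j.
  by move=> qij; apply: (ler_cvg_to (kl i) (kl j)); apply: nearW => n; exact: Nnd.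
have renvneg x : x < 0 -> renv q l x = 0.
  move=> x0; apply/eqP; rewrite eq_le renv_ge0// andbT.
  have [i /andP[xi i0]] := q_dense _ _ x0.
  apply: le_trans (renv_le q_dense l0 xi) _.
  by apply: (ler_cvg_to (kl i) (cvg_cst 0)); apply: nearW => j; rewrite Nneg.
pose F : cumulative R R := HB.pack (renv q l)
  (isCumulative.Build R _ R (renv q l) (renv_nd q_dense l0) (renv_rc q_dense l0)).
have F0 x : x < 0 -> F x = 0 by exact: renvneg.
exists (lebesgue_stieltjes_measure F); split.
  exact: stieltjes_itvNyc.
move=> s s0.
pose f j (x : TR) : \bar R := (s * expR (- (s * x)) * N (k j) x)%:E.
pose g (x : TR) : \bar R := (s * expR (- (s * x)) * renv q l x)%:E.
have mexp : measurable_fun R0 (fun x : TR => s * expR (- (s * x))).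
  by apply: measurable_funM => //; exact: measurable_expRN.
have fL j : (\int[mu]_(x in `[0%R, +oo[) f j x = (ph (k j) s)%:E)%E.
  rewrite -L//.
  transitivity (\int[kap (k j)]_(y in `[0%R, +oo[) (expR (- (s * y)))%:E)%E.
    rewrite laplace_tonelli//; apply: eq_integral => x _.
    by rewrite /f EFinM NE.
  have m1 : measurable ([set 0] : set TR) by exact: measurable_set1.
  have z : kap (k j) [set 0] = 0%E.
    apply/eqP; rewrite eq_le measure_ge0 andbT -(kap0 (k j)).
    apply: le_measure; rewrite ?inE; [exact: m1|exact: measurableC|].
    by move=> x /= ->; rewrite /posreals /= ltxx.
  rewrite (ge0_negligible_integral m1 _ _ _ z)//.
  - congr integral; apply/seteqP; split => x; rewrite /posreals /= in_itv/= andbT.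
      by move=> [x0 /eqP xn0]; rewrite lt_neqAle eq_sym xn0.
    by move=> x0; split; [exact: ltW|move=> x00; rewrite x00 ltxx in x0].
  - by apply/measurable_EFinP; exact: measurable_expRN.
have gK : (\int[mu]_(x in `[0%R, +oo[) g x =
    \int[lebesgue_stieltjes_measure F]_(y in `[0%R, +oo[) (expR (- (s * y)))%:E)%E.
  rewrite laplace_tonelli//; last exact: stieltjes_itvNyc.
  apply: eq_integral => x; rewrite inE/= in_itv/= andbT => x0.
  by rewrite stieltjes_itvcc// /g EFinM.
have s20 : 0 < s / 2 by rewrite divr_gt0.
(* The Chernoff bound at s / 2 costs e^(s x / 2) and leaves an integrable e^(-s x / 2); the factor 2
   compensates for writing s / 2 in place of s. *)
pose h (x : TR) : \bar R := ((2 * C (s / 2)) * (s / 2 * expR (- (s / 2 * x))))%:E.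
have C0 : 0 <= 2 * C (s / 2) by rewrite mulr_ge0// (hC _ s20).1.
have mD : measurable R0 by exact: measurable_itv.
have ih : mu.-integrable R0 h.
  have mh : measurable_fun R0 (fun x : TR => s / 2 * expR (- (s / 2 * x))).
    by apply: measurable_funM => //; exact: measurable_expRN.
  apply/integrableP; split.
    by apply/measurable_EFinP; apply: measurable_funM.
  under eq_integral.
    move=> x _; rewrite gee0_abs; last first.
      by rewrite lee_fin mulr_ge0// mulr_ge0 ?expR_ge0// ltW.
    rewrite /h EFinM; over.
  rewrite ge0_integralZl ?lee_fin//.
  - by rewrite integral_exp_tail// -EFinM ltry.
  - by apply/measurable_EFinP.
  - by move=> x _; rewrite lee_fin mulr_ge0 ?expR_ge0// ltW.
have mf j : measurable_fun R0 (f j).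
  apply/measurable_EFinP; apply: measurable_funM => //.
  by apply: nondecreasing_measurable => //; exact: Nnd.
have mg : measurable_fun R0 g.
  apply/measurable_EFinP; apply: measurable_funM => //.
  by apply: nondecreasing_measurable => //; exact: renv_nd.
(* Convergence can fail only at the jumps of the envelope, a countable and hence Lebesgue null
   set. *)
have fg : {ae mu, forall x : TR, R0 x -> f j x @[j --> \oo] --> g x}.
  have D0 := env_discontinuity_countable q_dense l0 l_nd.
  exists [set x | lenv q l x < renv q l x]; split.
  - exact: countable_measurable.
  - exact: countable_lebesgue_measure0.
  move=> x /=; apply: contra_notP => /negP; rewrite -leNgt => rl _.
  apply: cvg_EFin; first by apply: nearW.
  apply: (@cvgM _ _ _ _ (fun=> _)); first exact: cvg_cst.
  exact: (env_cvg q_dense l0 l_nd (N := fun j => N (k j))).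
have fh : {ae mu, forall (x : TR) j, R0 x -> (`|f j x| <= h x)%E}.
  apply: aeW => x j _; rewrite /f /h gee0_abs ?lee_fin; last first.
    by rewrite mulr_ge0// mulr_ge0 ?expR_ge0// ltW.
  apply: (@le_trans _ _ (s * expR (- (s * x)) * (expR (s / 2 * x) * C (s / 2)))).
    by rewrite ler_wpM2l ?mulr_ge0 ?expR_ge0 ?(ltW s0)// Nle.
  rewrite le_eqVlt; apply/orP; left; apply/eqP.
  have -> : expR (- (s / 2 * x)) = expR (- (s * x)) * expR (s / 2 * x).
    by rewrite -expRD; congr expR; field.
  by field.
have [_ _ cv] := dominated_convergence mD mf mg fg ih fh; rewrite gK in cv.
(* All transforms converge along the full sequence, so the selected subsequence has the same limit
   phi s. *)
have kinf : k j @[j --> \oo] --> \oo.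
  by apply/cvgnyPge => M; exists M => // j /= Mj; exact: leq_trans Mj (kj j).
have Lp : (ph (k j) s)%:E @[j --> \oo] --> (phi s)%:E.
  apply: cvg_EFin; first by apply: nearW.
  exact: (cvg_comp _ _ kinf (Lphi s s0)).
apply: (cvg_unique _ _ Lp) => //; apply: cvg_trans cv.
by apply: near_eq_cvg; apply: nearW => j /=; rewrite fL.
Qed.

End laplace_continuity.

(** * Scale-invariant Levy measures *)

Section levy_kernel.
Context {R : realType}.
Local Notation TR := (measurableTypeR R).
Implicit Types (al s t u x : R) (Lam : {measure set TR -> \bar R}).

(** At s = 1 - H(r) and t = 1 this is the integrand of the representation at a real point r. A free
    t gives additivity and scaling. *)
Definition wker al s t x : R := (expR (- (s * x)) - expR (- (t * x))) * x `^ (- al).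

Definition wint Lam al s t : \bar R := (\int[Lam]_(x in posreals R) (wker al s t x)%:E)%E.

Lemma measurable_wker al s t (D : set TR) : measurable_fun D (wker al s t : TR -> R).
Proof.
apply: measurable_funTS; apply: measurable_funM; last exact: measurable_powR.
by apply: measurable_funB; exact: measurable_expRN.
Qed.

Lemma wker_ge0 al s t x : 0 <= x -> s <= t -> 0 <= wker al s t x.
Proof.
move=> x0 st; rewrite mulr_ge0 ?powR_ge0// subr_ge0 ler_expR lerN2.
by rewrite ler_wpM2r.
Qed.

Lemma wker_le al s t x : 0 <= s -> s <= t -> 0 < x ->
  wker al s t x <= (t - s) * x `^ (1 - al).
Proof.
move=> s0 st x0.
have -> : x `^ (1 - al) = x * x `^ (- al).
  by rewrite powRD ?powRr1 ?(ltW x0)//; apply/implyP => _; rewrite gt_eqF.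
rewrite mulrA ler_wpM2r ?powR_ge0//.
have e1 : expR (- (s * x)) <= 1.
  by rewrite -[leRHS]expR0 ler_expR oppr_le0 mulr_ge0// ltW.
have -> : expR (- (t * x)) = expR (- (s * x)) * expR (- ((t - s) * x)).
  by rewrite -expRD; congr expR; ring.
have e2 := expR_ge1Dx (- ((t - s) * x)).
have ts : 0 <= (t - s) * x by rewrite mulr_ge0 ?subr_ge0// ltW.
have e3 : expR (- (s * x)) * (1 - expR (- ((t - s) * x))) <= expR (- (s * x)) * ((t - s) * x).
  by rewrite ler_wpM2l ?expR_ge0//; lra.
have e4 : expR (- (s * x)) * ((t - s) * x) <= 1 * ((t - s) * x) by rewrite ler_wpM2r.
lra.
Qed.

Lemma wker_scale (m : R) al s t x : 0 < m -> 0 < x ->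
  wker al (m * s) (m * t) x = m `^ al * wker al s t (m * x).
Proof.
move=> m0 x0; rewrite /wker powRM ?(ltW m0) ?(ltW x0)//.
have mm : m `^ al * m `^ (- al) = 1.
  by rewrite powRN divff// gt_eqF// powR_gt0.
have -> : m * s * x = s * (m * x) by ring.
have -> : m * t * x = t * (m * x) by ring.
by rewrite -[LHS]mul1r -mm; ring.
Qed.

Lemma wint_ge0 Lam al s t : s <= t -> (0 <= wint Lam al s t)%E.
Proof.
by move=> st; apply: integral_ge0 => x x0; rewrite lee_fin wker_ge0// ltW.
Qed.

Lemma wintD Lam al s t u : s <= t -> t <= u ->
  (wint Lam al s u = wint Lam al s t + wint Lam al t u)%E.
Proof.
move=> st tu; rewrite /wint -ge0_integralD//.
- by apply: eq_integral => x _; rewrite -EFinD; congr EFin; rewrite /wker; ring.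
- exact: measurable_posreals.
- by move=> x x0; rewrite lee_fin wker_ge0// ltW.
- by apply/measurable_EFinP; exact: measurable_wker.
- by move=> x x0; rewrite lee_fin wker_ge0// ltW.
- by apply/measurable_EFinP; exact: measurable_wker.
Qed.

Section scaling.
Variables (m : R) (Lam : {measure set TR -> \bar R}).
Hypothesis m0 : 0 < m.
Hypothesis Lam_scale : scale_invariant m Lam.

Lemma scale_integral (f : TR -> \bar R) :
  measurable_fun (posreals R) f -> (forall x, posreals R x -> (0 <= f x)%E) ->
  (\int[Lam]_(x in posreals R) f (m * x)%R = \int[Lam]_(x in posreals R) f x)%E.
Proof.
move=> mf f0; pose phi (x : TR) : TR := m * x.
have mphi : measurable_fun setT phi by exact: measurable_funM.
have pre : phi @^-1` posreals R = posreals R.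
  by apply/seteqP; split => x; rewrite /phi /posreals /= pmulr_rgt0.
have f0' : {in posreals R, forall y, (0 <= f y)%E} by move=> x; rewrite inE => /f0.
have := ge0_integral_pushforward mphi Lam measurable_posreals mf f0'.
rewrite pre => <-; apply: eq_measure_integral => A mA Apos.
have mpA : measurable (phi @^-1` A) by rewrite -[X in measurable X]setTI; exact: mphi.
have pA : phi @^-1` A `<=` posreals R by rewrite -pre; exact: preimage_subset.
apply: (etrans (Lam_scale mpA pA)).
congr (Lam _); apply/seteqP; split => x /=; first by move=> [y yA <-].
move=> Ax; exists (m^-1 * x); last by rewrite mulrA divff ?mul1r// gt_eqF.
by rewrite /phi mulrA divff ?mul1r// gt_eqF.
Qed.

Lemma wint_scale al s t : s <= t ->
  (wint Lam al (m * s) (m * t) = (m `^ al)%:E * wint Lam al s t)%E.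
Proof.
move=> st; rewrite /wint -[in RHS]scale_integral; last 2 first.
- by apply/measurable_EFinP; exact: measurable_wker.
- by move=> x x0; rewrite lee_fin wker_ge0// ltW.
rewrite -ge0_integralZl//.
- apply: eq_integral => x; rewrite inE => x0.
  by rewrite -EFinM -wker_scale.
- exact: measurable_posreals.
- apply/measurable_EFinP.
  apply: (measurableT_comp (f := wker al s t)); first exact: measurable_wker.
  exact: measurable_funM.
- by move=> x x0; rewrite lee_fin wker_ge0// mulr_ge0 ?ltW.
- by rewrite lee_fin powR_ge0.
Qed.

End scaling.

End levy_kernel.

Section levy_measure.
Context {R : realType}.
Local Notation TR := (measurableTypeR R).
Implicit Types (al s t u x a b : R) (Lam : {measure set TR -> \bar R}).

Lemma geometric_lty (c z : R) : 0 <= c -> 0 <= z < 1 ->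
  (\sum_(k <oo) (c * z ^+ k)%:E < +oo)%E.
Proof.
move=> c0 /andP[z0 z1]; apply: (@le_lt_trans _ _ (c / (1 - z))%:E); last exact: ltry.
apply: lime_le.
  by apply: is_cvg_nneseries => k _ _; rewrite lee_fin mulr_ge0// exprn_ge0.
apply: nearW => n; rewrite big_mkord sumEFin lee_fin -mulr_sumr ler_wpM2l//.
rewrite -[leRHS]div1r ler_pdivlMr ?subr_gt0//.
have := subrXX 1 z n; rewrite expr1n.
under [X in _ = _ * X -> _]eq_bigr do rewrite expr1n mul1r.
by rewrite mulrC => <-; rewrite gerBl exprn_ge0.
Qed.

(** The compact interval is covered by finitely many open sets of finite mass. *)
Lemma levy_compact_lty Lam a b : posreals_measure Lam -> 0 < a ->
  (Lam `[a, b]%classic < +oo)%E.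
Proof.
move=> [_ lf] a0.
have [x0|] := ltP b a.
  by rewrite set_itv_ge ?measure0// bnd_simp -ltNge.
move=> ab.
have /choice[U hU] : forall x : R, exists U : set R, 0 < x -> [/\ open U, U x & (Lam U < +oo)%E].
  move=> x; have [x0|] := ltP 0 x; last by exists setT.
  by have [U hU] := lf x x0; exists U.
have pos x : `[a, b]%classic x -> 0 < x by rewrite /= in_itv/= => /andP[/(lt_le_trans a0)].
have := @segment_compact R a b; rewrite compact_cover => /(_ R `[a, b]%classic U).
case.
- by move=> x /pos /hU [].
- by move=> x abx; exists x => //; have [] := hU x (pos x abx).
move=> D Dab cov.
have mU x : x \in D -> measurable (U x : set TR).
  move=> /Dab; rewrite inE => /pos /hU[oU _ _]; exact: open_measurable.
have : (Lam `[a, b]%classic <= \sum_(i \in [set` D]) Lam (U i))%E.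
  apply: content_sub_fsum; [exact: finite_fset|by move=> x /= /mU| |exact: cov].
  exact: measurable_itv.
move=> /le_lt_trans; apply; rewrite fsbig_finite//= big_seq.
apply/lte_sum_pinfty => i; rewrite in_fset_set// inE /= => iD.
by have /pos/hU[] : `[a, b]%classic i by have := Dab _ iD; rewrite inE.
Qed.

Section finiteness.
Variables (m : R) (Lam : {measure set TR -> \bar R}).
Hypothesis m0 : 0 < m.
Hypothesis m1 : m < 1.
Hypothesis Lam_pos : posreals_measure Lam.
Hypothesis Lam_scale : scale_invariant m Lam.

Lemma levy_scale_itv a b : 0 < a -> Lam `[m * a, m * b]%classic = Lam `[a, b]%classic.
Proof.
move=> a0; rewrite [RHS]Lam_scale.
- congr (Lam _); apply/seteqP; split => x /=; rewrite in_itv/=.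
    move=> /andP[ax xb]; exists (m^-1 * x); last by rewrite mulrA divff ?mul1r// gt_eqF.
    by rewrite /= in_itv/= ler_pdivlMl// ax ler_pdivrMl.
  by move=> [y /=]; rewrite in_itv/= => /andP[ay yb] <-; rewrite !ler_pM2l// ay.
- exact: measurable_itv.
- by move=> x /=; rewrite in_itv/= => /andP[/(lt_le_trans a0)].
Qed.

Lemma levy_shell_lo k : Lam `[m ^+ k.+1, m ^+ k]%classic = Lam `[m, 1]%classic.
Proof.
elim: k => [|k IH]; first by rewrite expr1 expr0.
transitivity (Lam `[m * m ^+ k.+1, m * m ^+ k]%classic); first by rewrite -!exprS.
by rewrite levy_scale_itv ?exprn_gt0.
Qed.

Lemma levy_shell_hi k : Lam `[m ^- k, m ^- k.+1]%classic = Lam `[m, 1]%classic.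
Proof.
have mN0 : m != 0 by rewrite gt_eqF.
elim: k => [|k IH].
  by rewrite expr0 invr1 expr1 -levy_scale_itv// mulr1 mulfV.
rewrite -IH -levy_scale_itv ?invr_gt0 ?exprn_gt0//.
by rewrite (exprS m k.+1) (exprS m k) !invfM !mulVKf.
Qed.

Lemma expR_powR_bound (s be : R) : 0 < s ->
  exists2 K, 0 <= K & forall x, 1 <= x -> expR (- (s * x)) * x `^ be <= K.
Proof.
move=> s0; pose n := (Num.truncn `|be|).
(* From the Taylor term (s x)^(n+1) / (n+1)! <= e^(s x), where n + 1 exceeds |be|. *)
exists (n.+1`!%:R / s ^+ n.+1); first by rewrite divr_ge0 ?exprn_ge0// ltW.
move=> x x1; have x0 : 0 < x by lra.
have h1 : x `^ be <= x ^+ n.+1.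
  rewrite -powR_mulrn ?(ltW x0)//; apply: ler_powR => //.
  by rewrite (le_trans (ler_norm _))// ltW// truncnS_gt.
have h2 : (s * x) ^+ n.+1 / n.+1`!%:R <= expR (s * x).
  by apply: le_trans (expR_ge1Dxn n _); rewrite ?lerDr// mulr_ge0 ?ltW.
rewrite ler_pdivlMr ?exprn_gt0//.
apply: (@le_trans _ _ (expR (- (s * x)) * x ^+ n.+1 * s ^+ n.+1)).
  by rewrite ler_wpM2r ?exprn_ge0 ?(ltW s0)// ler_wpM2l ?expR_ge0.
rewrite -mulrA mulrC expRN ler_pdivrMr ?expR_gt0// -exprMn (mulrC x) [leRHS]mulrC.
by rewrite -ler_pdivrMr ?ltr0n ?fact_gt0.
Qed.

(** All shells between consecutive powers of m have the same mass. On [m^(k+1), m^k] the kernel is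
    at most (t - s) m^(k (1 - al)), summable since al < 1; on [m^(-k), m^(-k-1)] exponential decay,
    available because s > 0, bounds it by K m^k. *)
Lemma wint_lty al s t : al < 1 -> 0 < s -> s <= t -> (wint Lam al s t < +oo)%E.
Proof.
move=> al1 s0 st.
pose f x := if 0 < x then wker al s t x else 0.
have f0 x : 0 <= f x by rewrite /f; case: ifPn => // x0; rewrite wker_ge0// ltW.
have mf : measurable_fun setT (f : TR -> R).
  apply: measurable_fun_ifT => //; last exact: measurable_wker.
  exact: measurable_fun_ltr.
pose M : {measure set TR -> \bar R} := mdensity Lam mf f0.
pose C0 := fine (Lam `[m, 1]%classic).
have C0E : Lam `[m, 1]%classic = C0%:E.
  by rewrite fineK// ge0_fin_numE//; exact: levy_compact_lty.
have C00 : 0 <= C0 by exact: fine_ge0.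
have mcc a b : measurable (`[a, b]%classic : set TR) by exact: measurable_itv.
have Mle a b c : 0 <= c -> (forall x, a <= x <= b -> f x <= c) ->
    (M `[a, b]%classic <= c%:E * Lam `[a, b]%classic)%E.
  move=> c0 h; rewrite -integral_cst//; apply: ge0_le_integral => //.
  - by move=> x _; rewrite lee_fin.
  - by apply/measurable_EFinP; exact: measurable_funTS.
pose z := m `^ (1 - al).
have z0 : 0 <= z by exact: powR_ge0.
have z1 : z < 1.
  rewrite /z /powR gt_eqF// -[ltRHS]expR0 ltr_expR pmulr_rlt0 ?subr_gt0//.
  by apply: ln_lt0; rewrite m0.
pose Slo k : set TR := `[m ^+ k.+1, m ^+ k]%classic.
pose Shi k : set TR := `[m ^- k, m ^- k.+1]%classic.
have lo : (M `]0%R, 1%R]%classic < +oo)%E.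
  apply: (@le_lt_trans _ _ (\sum_(k <oo) M (Slo k))%E).
    have mS k : measurable (Slo k) by exact: mcc.
    have m01 : measurable (`]0, 1]%classic : set TR) by exact: measurable_itv.
    apply: (measure_sigma_subadditive M mS m01) => x /=; rewrite in_itv/= => /andP[x0 x1].
    have ex : exists k, m ^+ k.+1 <= x.
      have [n mx] := exists_expr_lt m0 m1 x0.
      exists n; rewrite exprS (le_trans _ (ltW mx))// ler_piMl ?exprn_ge0 ?ltW//.
    case: (ex_minnP ex) => k kx kmin; exists k => //.
    rewrite /Slo /= in_itv/= kx/=; case: k kx kmin => [_ _|k kx kmin]; first by rewrite expr0.
    by rewrite leNgt; apply/negP => /ltW /kmin; rewrite ltnn.
  apply: le_lt_trans (geometric_lty (c := (t - s) * C0) (z := z) _ _); last 2 first.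
  - by rewrite mulr_ge0// subr_ge0.
  - by rewrite z0.
  apply: lee_nneseries => // k _.
  have -> : ((t - s) * C0 * z ^+ k)%:E = (((t - s) * z ^+ k)%:E * Lam (Slo k))%E.
    by rewrite /Slo levy_shell_lo C0E -EFinM; congr EFin; ring.
  apply: Mle; first by rewrite mulr_ge0 ?subr_ge0// exprn_ge0.
  move=> x /andP[mx xm]; have x0 : 0 < x by apply: lt_le_trans mx; rewrite exprn_gt0.
  rewrite /f x0; apply: le_trans (wker_le al (ltW s0) st x0) _.
  rewrite ler_wpM2l ?subr_ge0// /z -powR_mulrn ?powR_ge0// -powRrM mulrC powRrM.
  rewrite powR_mulrn ?(ltW m0)//; apply: ge0_ler_powR; rewrite ?nnegrE ?exprn_ge0 ?(ltW m0) ?(ltW x0)//.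
  by rewrite subr_ge0 ltW.
have hi : (M `[1%R, +oo[%classic < +oo)%E.
  (* The exponent has one power of x more than the kernel, which leaves the factor 1 / x <= m^k on
     the k-th shell. *)
  have [K K0 hK] := expR_powR_bound (1 - al) s0.
  apply: (@le_lt_trans _ _ (\sum_(k <oo) M (Shi k))%E).
    have mS k : measurable (Shi k) by exact: mcc.
    have m1y : measurable (`[1, +oo[%classic : set TR) by exact: measurable_itv.
    apply: (measure_sigma_subadditive M mS m1y) => x /=; rewrite in_itv/= andbT => x1.
    have x0 : 0 < x by lra.
    have ex : exists k, x <= m ^- k.+1.
      have [|n mx] := @exists_expr_lt _ m x^-1 m0 m1; first by rewrite invr_gt0.
      exists n; rewrite invf_pge ?posrE ?exprn_gt0//.
      rewrite exprS (le_trans _ (ltW mx))// ler_piMl ?exprn_ge0 ?ltW//.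
    case: (ex_minnP ex) => k kx kmin; exists k => //.
    rewrite /Shi /= in_itv/= kx andbT; case: k kx kmin => [_ _|k kx kmin].
      by rewrite expr0 invr1.
    by rewrite leNgt; apply/negP => /ltW /kmin; rewrite ltnn.
  apply: le_lt_trans (geometric_lty (c := K * C0) (z := m) _ _); last 2 first.
  - by rewrite mulr_ge0.
  - by rewrite ltW.
  apply: lee_nneseries => // k _.
  have -> : (K * C0 * m ^+ k)%:E = ((K * m ^+ k)%:E * Lam (Shi k))%E.
    by rewrite /Shi levy_shell_hi C0E -EFinM; congr EFin; ring.
  apply: Mle; first by rewrite mulr_ge0// exprn_ge0 ?ltW.
  move=> x /andP[mx xm]; have x1 : 1 <= x.
    by apply: le_trans mx; rewrite invf_ge1 ?exprn_gt0// exprn_ile1 ?ltW.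
  have x0 : 0 < x by lra.
  rewrite /f x0; apply: (@le_trans _ _ (K * x^-1)); last first.
    by rewrite ler_wpM2l// invf_ple ?posrE ?exprn_gt0.
  rewrite ler_pdivlMr// (le_trans _ (hK x x1))//.
  have -> : x `^ (1 - al) = x `^ (- al) * x.
    by rewrite addrC powRD ?powRr1 ?(ltW x0)//; apply/implyP => _; rewrite gt_eqF.
  rewrite mulrA ler_wpM2r ?(ltW x0)// /wker ler_wpM2r ?powR_ge0// gerBl expR_ge0//.
have -> : wint Lam al s t = M (posreals R).
  by apply: eq_integral => x; rewrite inE /posreals /= /f => ->.
apply: (@le_lt_trans _ _ (M (`]0, 1]%classic `|` `[1%R, +oo[%classic))).
  apply: le_measure; rewrite ?inE.
  - exact: measurable_posreals.
  - by apply: measurableU; exact: measurable_itv.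
  move=> x; rewrite /posreals /= !in_itv/= andbT => x0.
  by have [x1|/ltW x1] := leP x 1; [left; rewrite x0|right].
have mA : measurable (`]0, 1]%classic : set TR) by exact: measurable_itv.
have mB : measurable (`[1, +oo[%classic : set TR) by exact: measurable_itv.
apply: (le_lt_trans (measureU2 M mA mB)).
exact: lte_add_pinfty.
Qed.

End finiteness.

(** The kernel between s + 1 and s + 2 is e^(-s x) times the kernel between 1 and 2, so the data are
    the Laplace transforms of Lam1 and Lam2 weighted by the latter. These weighted measures are
    finite, and the weight is positive on ]0, +oo[, so it can be divided out again. *)
Lemma levy_unique al Lam1 Lam2 :
  Lam1 (~` posreals R) = 0%E -> Lam2 (~` posreals R) = 0%E ->
  (forall s, 1 <= s -> (wint Lam1 al s (s + 1) < +oo)%E) ->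
  (forall s, 1 <= s -> wint Lam1 al s (s + 1) = wint Lam2 al s (s + 1)) ->
  forall A, measurable A -> Lam1 A = Lam2 A.
Proof.
move=> Z1 Z2 fin E.
pose f x := if 0 < x then wker al 1 2 x else 0.
have f0 x : 0 <= f x.
  by rewrite /f; case: ifPn => // x0; rewrite wker_ge0 ?ltW// ltr1n.
have mf : measurable_fun setT (f : TR -> R).
  apply: measurable_fun_ifT => //; last exact: measurable_wker.
  exact: measurable_fun_ltr.
have fpos x : 0 < x -> 0 < f x.
  move=> x0; rewrite /f x0 mulr_gt0 ?powR_gt0// subr_gt0 ltr_expR ltrN2.
  by rewrite ltr_pM2r// ltr1n.
pose M Lam : {measure set TR -> \bar R} := mdensity Lam mf f0.
have MZ Lam : M Lam (~` posreals R) = 0%E.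
  rewrite /M /= /mdensity integral0_eq// => x; rewrite /posreals/= /f => /negP.
  by case: ifPn.
have MI Lam s : (\int[M Lam]_(x in posreals R) (expR (- (s * x)))%:E)%E = wint Lam al (s + 1) (s + 1 + 1).
  rewrite integral_mkcond ge0_integral_mdensity; last 2 first.
  - apply/(measurable_restrictT _ _).1; first exact: measurable_posreals.
    by apply/measurable_EFinP; exact: measurable_expRN.
  - by move=> x; rewrite patchE; case: ifPn => // _; rewrite lee_fin expR_ge0.
  rewrite /wint [RHS]integral_mkcond; apply: eq_integral => x _.
  rewrite !patchE; case: ifPn => [|_]; last by rewrite mul0e.
  rewrite inE /posreals /= /f => x0; rewrite x0 -EFinM; congr EFin.
  rewrite /wker mulrA mulrBr -!expRD; congr ((expR _ - expR _) * _); ring.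
have MT Lam : M Lam setT = wint Lam al 1 2.
  have mp := measurable_posreals (R := R).
  have : (M Lam (posreals R `|` ~` posreals R) =
      M Lam (posreals R) + M Lam (~` posreals R))%E.
    by apply: measureU => //; [exact: measurableC|rewrite setICr].
  rewrite setUv MZ adde0 => ->; have := MI Lam 0; rewrite add0r (_ : 1 + 1 = 2 :> R)//.
  under eq_integral do rewrite mul0r oppr0 expR0.
  by rewrite (integral_cst _ mp) mul1e => ->.
have MM : forall A, measurable A -> M Lam1 A = M Lam2 A.
  have e12 : (1 + 1 : R) = 2 by [].
  apply: laplace_unique.
  - by rewrite MT -e12 fin.
  - by rewrite MT -e12 -E// fin.
  - exact: MZ.
  - exact: MZ.
  - by move=> s s0; rewrite !MI E// lerDr.
have inv Lam A : measurable A -> Lam (~` posreals R) = 0%E ->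
    Lam A = (\int[M Lam]_(x in A `&` posreals R) ((f x)^-1)%:E)%E.
  move=> mA Z; have mp := measurable_posreals (R := R).
  have mAp : measurable (A `&` posreals R) by exact: measurableI.
  rewrite integral_mkcond ge0_integral_mdensity; last 2 first.
  - apply/(measurable_restrictT _ _).1 => //.
    apply/measurable_EFinP.
    rewrite (_ : (fun x => (f x)^-1) = (@powR R)^~ (-1) \o f).
      by apply: measurable_funTS; apply: measurableT_comp => //; exact: measurable_powR.
    by apply/funext => x /=; rewrite powR_inv1.
  - by move=> x; rewrite patchE; case: ifPn => // _; rewrite lee_fin invr_ge0.
  transitivity (\int[Lam]_x (\1_(A `&` posreals R) x)%:E)%E.
    rewrite integral_indic// setIT.
    rewrite -[in LHS](setIT A) -(setUv (posreals R)) setIUr measureU//.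
    - rewrite [X in (_ + X)%E](_ : _ = 0%E) ?adde0//.
      apply/eqP; rewrite eq_le measure_ge0 andbT -Z.
      apply: le_measure; rewrite ?inE; last exact: subIsetr.
        by apply: measurableI => //; exact: measurableC.
      exact: measurableC.
    - by apply: measurableI => //; exact: measurableC.
    - by rewrite setIACA setICr setI0.
  apply: eq_integral => x _; rewrite patchE indicE; case: ifPn => [|_]; last by rewrite mul0e.
  rewrite inE => -[_ x0]; rewrite -EFinM mulVf// gt_eqF//; exact: fpos.
move=> A mA; rewrite (inv Lam1)// (inv Lam2)//.
by apply: eq_measure_integral => B mB _; exact: MM.
Qed.

End levy_measure.

(** * Construction of Lambda from the unit differences of g *)

Section levy_existence.
Context {R : realType}.
Local Notation TR := (measurableTypeR R).
Implicit Types (s t u x a b : R).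
Variables (m al : R) (g : R -> R) (K : {measure set TR -> \bar R}).
Hypothesis m0 : 0 < m.
Hypothesis m1 : m < 1.
Hypothesis al1 : al < 1.
Hypothesis K_lty : forall x : R, (K `]-oo, x]%classic < +oo)%E.
Hypothesis K_laplace : forall s : R, 0 < s ->
  (\int[K]_(x in `[0%R, +oo[) (expR (- (s * x)))%:E = (g s - g (s + 1))%:E)%E.
Hypothesis g_ni : forall s t : R, 0 < s -> s <= t -> g t <= g s.
Hypothesis g_scale : forall s t : R, 0 < s -> 0 < t ->
  g s - g t = m `^ al * (g (s / m) - g (t / m)).

Let del s := g s - g (s + 1).

Let del_ni s t : 0 < s -> s <= t -> del t <= del s.
Proof.
move=> s0 st; have t0 := lt_le_trans s0 st.
rewrite -lee_fin /del -!K_laplace//; apply: ge0_le_integral.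
- exact: measurable_itv.
- by move=> x _; rewrite lee_fin expR_ge0.
- by apply/measurable_EFinP; exact: measurable_expRN.
- by apply/measurable_EFinP; exact: measurable_expRN.
- move=> x /=; rewrite in_itv/= andbT => x0.
  by rewrite lee_fin ler_expR lerN2 ler_wpM2r.
Qed.

Let g_shift b s k : 0 < s -> (forall t, 0 < t -> b <= del t) ->
  k%:R * b <= g s - g (s + k%:R).
Proof.
move=> s0 h; elim: k => [|k IH]; first by rewrite mul0r addr0 subrr.
have := h (s + k%:R); rewrite ltr_wpDr// => /(_ isT).
rewrite /del -addrA natr1 -(natr1 k); lra.
Qed.

Let g_pow j : g (m ^- j) - g (2 * m ^- j) = (m `^ al) ^- j * (g 1 - g 2).
Proof.
have la0 : 0 < m `^ al by rewrite powR_gt0.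
elim: j => [|j IH]; first by rewrite !expr0 !invr1 mul1r mulr1.
have p0 : 0 < m ^- j by rewrite invr_gt0 exprn_gt0.
have h := g_scale p0 (mulr_gt0 (ltr0n R 2) p0).
have e1 : m ^- j.+1 = m ^- j / m by rewrite exprSr invfM.
have e2 : (m `^ al) ^- j.+1 = (m `^ al)^-1 * (m `^ al) ^- j by rewrite exprS invfM.
by rewrite e1 e2 -mulrA -IH h mulKf ?(lt0r_neq0 la0)// mulrA.
Qed.

(* If del stayed above e, then g (m ^- j) - g (2 * m ^- j) would be at least of
   order m ^- j, whereas by scaling it is of order m ^- (al * j) and al < 1. *)
Let del_lt e : 0 < e -> exists2 s, 0 < s & del s < e.
Proof.
move=> e0; apply: contrapT => h.
have {}h t : 0 < t -> e <= del t.
  by move=> t0; rewrite leNgt; apply/negP => te; apply: h; exists t.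
have la0 : 0 < m `^ al by rewrite powR_gt0.
have mla : m < m `^ al.
  rewrite -[ltLHS]powRr1 ?(ltW m0)// /powR gt_eqF// ltr_expR mul1r.
  rewrite -subr_gt0 -[X in _ - X]mul1r -mulrBl nmulr_rgt0 ?subr_lt0//.
  by apply: ln_lt0; rewrite m0.
have S j : (1 - m ^+ j) * e <= (m / m `^ al) ^+ j * (g 1 - g 2).
  have mj : 0 < m ^+ j by rewrite exprn_gt0.
  have p0 : 0 < m ^- j by rewrite invr_gt0.
  pose k := Num.truncn (m ^- j).
  have k1 : k%:R <= m ^- j by rewrite truncn_le// ltW.
  have k2 : m ^- j < k%:R + 1 by rewrite natr1 truncnS_gt.
  have k0 : 0 <= k%:R :> R by [].
  have := g_shift k p0 h.
  have : g (2 * m ^- j) <= g (m ^- j + k%:R) by apply: g_ni; lra.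
  have := g_pow j => E E1 E2.
  have E3 : (m ^- j - 1) * e <= (m `^ al) ^- j * (g 1 - g 2).
    rewrite -E; apply: (@le_trans _ _ (k%:R * e)); last lra.
    by rewrite ler_wpM2r ?(ltW e0)//; lra.
  have := ler_wpM2l (ltW mj) E3.
  rewrite mulrA mulrBr mulr1 mulfV ?gt_eqF// => /le_trans; apply.
  by rewrite expr_div_n -mulrA.
have C1 : (1 - m ^+ j) * e @[j --> \oo] --> (1 - 0) * e.
  apply: cvgM; last exact: cvg_cst.
  apply: cvgB; first exact: cvg_cst.
  by apply: cvg_expr; rewrite ger0_norm ?ltW.
have C2 : (m / m `^ al) ^+ j * (g 1 - g 2) @[j --> \oo] --> 0 * (g 1 - g 2).
  apply: cvgM; last exact: cvg_cst.
  by apply: cvg_expr; rewrite ger0_norm ?divr_ge0 ?ltW// ltr_pdivrMr// mul1r.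
have : (1 - 0) * e <= 0 * (g 1 - g 2) by apply: (ler_cvg_to C1 C2); exact: nearW.
lra.
Qed.

Let m10 : measurable ([set 0] : set TR).
Proof. exact: measurable_set1. Qed.

(** An atom at 0 contributes its full mass to every [del s], and these values become arbitrarily
    small. *)
Let K_set0 : K [set 0] = 0%E.
Proof.
apply/eqP; rewrite eq_le measure_ge0 andbT; apply/lee_addgt0Pr => e e0; rewrite add0e.
have [s s0 se] := del_lt e0.
apply: (@le_trans _ _ (del s)%:E); last by rewrite lee_fin ltW.
rewrite /del -K_laplace//.
apply: (@le_trans _ _ (\int[K]_(x in [set 0%R]) (expR (- (s * x)))%:E)%E).
  rewrite (eq_integral (cst 1%E)) ?integral_cst ?mul1e//.
  by move=> x; rewrite inE => ->; rewrite mulr0 oppr0 expR0.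
apply: ge0_subset_integral => //.
- by apply/measurable_EFinP; exact: measurable_expRN.
- by move=> x /= ->; rewrite in_itv/= lexx.
Qed.

Let K_pos s : 0 < s ->
  (\int[K]_(x in posreals R) (expR (- (s * x)))%:E = (del s)%:E)%E.
Proof.
move=> s0; rewrite /del -K_laplace// [RHS](ge0_negligible_integral m10 _ _ _ K_set0)//.
- congr integral; apply/seteqP; split => x; rewrite /posreals /= in_itv/= andbT.
    by move=> x0; split; [exact: ltW|move=> x00; rewrite x00 ltxx in x0].
  by move=> [x0 /eqP xn0]; rewrite lt_neqAle eq_sym xn0.
- by apply/measurable_EFinP; exact: measurable_expRN.
Qed.

(** The density that undoes the weight: K is to be (1 - e^(-x)) x^(-al) Lambda(dx). The inverse is a
    power of exponent -1 to make measurability immediate. *)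
Let f x := if 0 < x then x `^ al * (1 - expR (- x)) `^ (-1) else 0.

Let f0 x : 0 <= f x.
Proof. by rewrite /f; case: ifPn => // _; rewrite mulr_ge0 ?powR_ge0. Qed.

Let mf : measurable_fun setT (f : TR -> R).
Proof.
apply: measurable_fun_ifT => //; first exact: measurable_fun_ltr.
apply: measurable_funM; first exact: measurable_powR.
apply: (measurableT_comp (measurable_powR (-1))).
apply: measurable_funB => //.
by apply: measurableT_comp => //.
Qed.

Let Lam : {measure set TR -> \bar R} := mdensity K mf f0.

Let Lam_pos : Lam (~` posreals R) = 0%E.
Proof.
rewrite /Lam /= /mdensity integral0_eq// => x; rewrite /posreals/= /f => /negP.
by case: ifPn.
Qed.

Let oneB_gt0 x : 0 < x -> 0 < 1 - expR (- x).
Proof. by move=> x0; rewrite subr_gt0 -[ltRHS]expR0 ltr_expR oppr_lt0. Qed.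

Let wint1 s : 0 < s -> wint Lam al s (s + 1) = (del s)%:E.
Proof.
move=> s0; rewrite /wint integral_mkcond ge0_integral_mdensity; last 2 first.
- apply/(measurable_restrictT _ _).1; first exact: measurable_posreals.
  by apply/measurable_EFinP; exact: measurable_wker.
- move=> x; rewrite patchE; case: ifPn => //; rewrite inE => x0.
  by rewrite lee_fin wker_ge0 ?ltW// ltrDl.
rewrite -K_pos// [RHS]integral_mkcond; apply: eq_integral => x _.
rewrite !patchE; case: ifPn => [|_]; last by rewrite mul0e.
rewrite inE /posreals /= /f => x0; rewrite x0 -EFinM; congr EFin.
rewrite /wker powRN powR_inv1; last by rewrite ltW// oneB_gt0.
have -> : expR (- ((s + 1) * x)) = expR (- (s * x)) * expR (- x).
  by rewrite -expRD; congr expR; ring.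
field; apply/andP; split; first by rewrite gt_eqF// oneB_gt0.
by rewrite gt_eqF// powR_gt0.
Qed.

Let wint_nat s k : 0 < s -> wint Lam al s (s + k%:R) = (g s - g (s + k%:R))%:E.
Proof.
move=> s0; elim: k => [|k IH].
  rewrite addr0 subrr /wint integral0_eq// => x _.
  by rewrite /wker subrr mul0r.
rewrite (wintD Lam al (t := s + k%:R)) ?lerDl// ?lerD2l ?ler_nat//.
have e : s + k.+1%:R = s + k%:R + 1 by rewrite -natr1 addrA.
by rewrite IH e wint1 ?ltr_wpDr// -EFinD /del; congr EFin; ring.
Qed.

Let wint_fin s t : 0 < s -> s <= t -> wint Lam al s t \is a fin_num.
Proof.
move=> s0 st; rewrite ge0_fin_numE ?wint_ge0//.
pose k := (Num.truncn (t - s)).+1.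
have tk : t <= s + k%:R by rewrite -lerBlDl ltW// truncnS_gt.
apply: (@le_lt_trans _ _ (wint Lam al s (s + k%:R))); last by rewrite wint_nat// ltry.
by rewrite (wintD Lam al st tk) leeDl// wint_ge0.
Qed.

Let W s t := fine (wint Lam al s t).

Let WD s t u : 0 < s -> s <= t -> t <= u -> W s u = W s t + W t u.
Proof.
move=> s0 st tu; have t0 := lt_le_trans s0 st.
by rewrite /W (wintD Lam al st tu) fineD// wint_fin.
Qed.

Let W1 s : 0 < s -> W s (s + 1) = del s.
Proof. by move=> s0; rewrite /W wint1. Qed.

Let W_ge0 s t : s <= t -> 0 <= W s t.
Proof. by move=> st; rewrite fine_ge0// wint_ge0. Qed.

(** The discrepancy g s - g t - W s t does not change when s and t move by 1, because unit
    differences agree. Both g s - g t and W s t lie in [0, del s], so the discrepancy is at most del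
    (s + k) for every k, which becomes arbitrarily small. *)
Let W_short s t : 0 < s -> s <= t -> t <= s + 1 -> W s t = g s - g t.
Proof.
move=> s0 st ts1; have t0 := lt_le_trans s0 st.
have shift k : g s - g t - W s t = g (s + k%:R) - g (t + k%:R) - W (s + k%:R) (t + k%:R).
  elim: k => [|k ->]; first by rewrite !addr0.
  set s' := s + k%:R; set t' := t + k%:R.
  have s'0 : 0 < s' by rewrite ltr_wpDr.
  have st' : s' <= t' by rewrite lerD2r.
  have ts' : t' <= s' + 1 by rewrite /t' /s' addrAC lerD2r.
  have st1 : s' + 1 <= t' + 1 by rewrite lerD2r.
  have t'0 : 0 < t' := lt_le_trans s'0 st'.
  rewrite -(natr1 k) !addrA -/s' -/t'.
  have e1 := WD s'0 st' (le_trans ts' st1).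
  have e2 := WD s'0 (le_trans st' ts') st1.
  move: e1; rewrite e2 (W1 s'0) (W1 t'0) /del.
  move: (W s' t') (W (s' + 1) (t' + 1)) (g s') (g t') (g (s' + 1)) (g (t' + 1)).
  by move=> w1 w2 a b c d; lra.
have bound k : `|g s - g t - W s t| <= del (s + k%:R).
  rewrite (shift k); set s' := s + k%:R; set t' := t + k%:R.
  have s'0 : 0 < s' by rewrite ltr_wpDr.
  have st' : s' <= t' by rewrite lerD2r.
  have ts' : t' <= s' + 1 by rewrite /t' /s' addrAC lerD2r.
  have t'0 : 0 < t' := lt_le_trans s'0 st'.
  have := W1 s'0; rewrite (WD s'0 st' ts') => e.
  have w1 := W_ge0 st'; have w2 := W_ge0 ts'.
  have g1 := g_ni s'0 st'; have g2 := g_ni t'0 ts'.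
  rewrite ler_norml; move: e w1 w2 g1 g2; rewrite /del.
  move: (W s' t') (W t' (s' + 1)) (g s') (g t') (g (s' + 1)) => w w' a b c.
  by move=> e w1 w2 g1 g2; apply/andP; split; lra.
apply/eqP; rewrite eq_sym -subr_eq0 -normr_le0; apply/ler_addgt0Pr => e e0; rewrite add0r.
have [u u0 ue] := del_lt e0.
pose k := (Num.truncn u).+1.
apply: le_trans (bound k) (le_trans _ (ltW ue)); apply: del_ni => //.
by rewrite (@le_trans _ _ k%:R) ?lerDr ?(ltW s0)// ltW// truncnS_gt.
Qed.

Let WE s t : 0 < s -> s <= t -> W s t = g s - g t.
Proof.
move=> s0 st; pose k := Num.truncn (t - s).
have ts0 : 0 <= t - s by rewrite subr_ge0.
have k1 : k%:R <= t - s by rewrite truncn_le.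
have k2 : t - s < k%:R + 1 by rewrite natr1 truncnS_gt.
have h0 : 0 <= k%:R :> R by [].
rewrite (@WD s (s + k%:R))//; [|lra|lra].
rewrite (@W_short (s + k%:R) t); [|lra|lra|lra].
by rewrite /W wint_nat//=; ring.
Qed.

Let wintE s t : 0 < s -> s <= t -> wint Lam al s t = (g s - g t)%:E.
Proof. by move=> s0 st; rewrite -WE// /W fineK// wint_fin. Qed.

Let mphi : measurable_fun setT (fun x : TR => m^-1 * x : TR).
Proof. exact: measurable_funM. Qed.

(** The image of Lam under division by m has the same integrals [wint], by the scaling relation of
    g; [levy_unique] identifies the two measures. *)
Let Lam_scale A : measurable A -> A `<=` posreals R -> Lam A = Lam [set m * a | a in A].
Proof.
move=> mA Apos.
have mN0 : m != 0 by rewrite gt_eqF.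
pose phi (x : TR) : TR := m^-1 * x.
pose L2' : {measure set TR -> \bar R} := pushforward Lam phi.
pose L2 := L2' mphi.
have phiE (B : set TR) : phi @^-1` B = [set m * a | a in B].
  apply/seteqP; split => x /=.
    by move=> Bx; exists (phi x) => //; rewrite /phi mulVKf.
  by move=> [y By <-]; rewrite /phi mulKf.
have pre : phi @^-1` posreals R = posreals R.
  by apply/seteqP; split => x; rewrite /phi /posreals /= pmulr_rgt0 ?invr_gt0.
have L2pos : L2 (~` posreals R) = 0%E.
  apply: (etrans _ Lam_pos); congr (Lam _).
  by apply/seteqP; split => x; rewrite /phi /posreals /= pmulr_rgt0 ?invr_gt0.
have wint2 s t : 0 < s -> s <= t -> wint L2 al s t = wint Lam al s t.
  move=> s0 st; rewrite /wint ge0_integral_pushforward//; last 3 first.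
  - exact: measurable_posreals.
  - by apply/measurable_EFinP; exact: measurable_wker.
  - by move=> x; rewrite inE => x0; rewrite lee_fin wker_ge0// ltW.
  rewrite pre.
  transitivity ((m `^ al)%:E * wint Lam al (s / m) (t / m))%E.
    rewrite /wint -ge0_integralZl//; last 4 first.
    - exact: measurable_posreals.
    - by apply/measurable_EFinP; exact: measurable_wker.
    - move=> x x0; rewrite lee_fin; apply: wker_ge0; first exact: ltW.
      by rewrite ler_pM2r ?invr_gt0.
    - by rewrite lee_fin powR_ge0.
    apply: eq_integral => x; rewrite inE => x0 /=; rewrite -EFinM; congr EFin.
    have mi0 : 0 < m^-1 by rewrite invr_gt0.
    rewrite /phi (mulrC s) (mulrC t) wker_scale// mulrA.
    have -> : m `^ al * m^-1 `^ al = 1.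
      by rewrite -powRM ?mulfV ?powR1// ltW// invr_gt0.
    by rewrite mul1r.
  have sm0 : 0 < s / m by rewrite divr_gt0.
  have stm : s / m <= t / m by rewrite ler_pM2r ?invr_gt0.
  have t0 := lt_le_trans s0 st.
  by rewrite -[RHS]/(wint Lam al s t) (wintE sm0 stm) (wintE s0 st) -EFinM -g_scale.
rewrite -phiE.
apply: (levy_unique (al := al) (Lam1 := Lam) (Lam2 := L2)) => //.
- move=> s s1; have s0 : 0 < s by lra.
  by rewrite wint1// ltry.
- move=> s s1; have s0 : 0 < s by lra.
  by rewrite wint2// lerDl.
Qed.

Let Lam_finite x : 0 < x -> exists U : set R, [/\ open U, U x & (Lam U < +oo)%E].
Proof.
move=> x0; exists `]x / 2, 2 * x[%classic; split.
- exact: interval_open.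
- by rewrite /= in_itv/=; apply/andP; split; lra.
(* B bounds the density on ]x/2, 2x[: the absolute values cover both signs of al and of the
   logarithm, and 1 / (1 - e^(-y)) is largest at the left end. *)
pose B := expR (`|al| * (`|ln (x / 2)| + `|ln (2 * x)|)) * (1 - expR (- (x / 2)))^-1.
pose U : set TR := `]x / 2, 2 * x[%classic.
have mU : measurable U by exact: measurable_itv.
apply: (@le_lt_trans _ _ (B%:E * K U)%E); last first.
  apply: lte_mul_pinfty => //.
    by rewrite lee_fin mulr_ge0 ?expR_ge0// invr_ge0 ltW// oneB_gt0; lra.
  apply: le_lt_trans (K_lty (2 * x)).
  apply: le_measure; rewrite ?inE; [exact: mU|exact: measurable_itv|].
  by move=> y /=; rewrite !in_itv/= => /andP[_ /ltW].
rewrite -integral_cst//; apply: ge0_le_integral => //.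
- by move=> y _; rewrite lee_fin.
- by apply/measurable_EFinP; exact: measurable_funTS.
- move=> y /=; rewrite in_itv/= => /andP[xy yx]; rewrite lee_fin /f.
  have y0 : 0 < y by lra.
  have x20 : 0 < x / 2 by lra.
  rewrite y0 powR_inv1; last by rewrite ltW// oneB_gt0.
  rewrite ler_pM ?powR_ge0//.
  + by rewrite invr_ge0 ltW// oneB_gt0.
  + rewrite /powR gt_eqF// ler_expR (le_trans (ler_norm _))// normrM.
    rewrite ler_wpM2l// ler_norml; apply/andP; split.
      have : ln (x / 2) <= ln y by rewrite ler_ln ?posrE// ltW.
      have := ler_norm (- ln (x / 2)); rewrite normrN.
      have := normr_ge0 (ln (2 * x)); lra.
    have : ln y <= ln (2 * x) by rewrite ler_ln ?posrE ?ltW//; lra.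
    have := ler_norm (ln (2 * x)); have := normr_ge0 (ln (x / 2)); lra.
  + rewrite lef_pV2 ?posrE ?oneB_gt0// lerB// ler_expR lerN2 ltW//.
Qed.

Theorem levy_existence : exists Lam : {measure set TR -> \bar R},
  [/\ posreals_measure Lam, scale_invariant m Lam
    & forall s t, 0 < s -> s <= t -> wint Lam al s t = (g s - g t)%:E].
Proof.
exists Lam; split; [split|exact: Lam_scale|exact: wintE].
- exact: Lam_pos.
- exact: Lam_finite.
Qed.

End levy_existence.

(** * The Levy measure of an invariant measure *)

Section survival_ratio.
Context {R : realType}.
Implicit Types (r s t : R) (q : probability nat R).

(** Squeeze by 1 - y <= - ln y <= (1 - y) / y, both from e^u >= 1 + u. *)
Lemma ln_compl_cvg (y : nat -> R) : (forall k, 0 < y k < 1) ->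
  y @ \oo --> (1 : R) -> - ln (y k) / (1 - y k) @[k --> \oo] --> (1 : R).
Proof.
move=> y01 y1.
apply: (@squeeze_cvgr _ _ _ _ (cst 1) (fun k => (y k)^-1)).
- apply: nearW => k; have /andP[y0 yl1] := y01 k.
  have b0 : 0 < 1 - y k by rewrite subr_gt0.
  rewrite ler_pdivlMr// ler_pdivrMr// mul1r; apply/andP; split.
    have := expR_ge1Dx (ln (y k)); rewrite lnK ?posrE//; lra.
  have := expR_ge1Dx (- ln (y k)); rewrite expRN lnK ?posrE//.
  have -> : (y k)^-1 * (1 - y k) = (y k)^-1 - 1 by rewrite mulrBr mulr1 mulVf ?gt_eqF.
  lra.
- exact: cvg_cst.
- by rewrite -[X in _ --> X]invr1; apply: cvgV => //; exact: oner_neq0.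
Qed.

(** Without mass at 0 the chord from 0 to r has positive slope, and by convexity the chord from r to
    s is at least as steep. *)
Lemma pgf_strict q r s : 0 < r -> r < s -> s < 1 ->
  weight q 0 = 0 -> pgf q r < pgf q s.
Proof.
move=> r0 rs s1 q0.
have r01 : 0 < r < 1 by rewrite r0 (lt_trans rs).
have := @gfr_slope R (weight q) 0 r r s (weight_ge0 q) (lexx 0) (ltW r0) (ltW r0) (ltW rs) (ltW r0) (ltW rs).
move=> /(_ _); rewrite prob_egf_lty; last by rewrite !ltW// (lt_trans r0).
move=> /(_ isT); rewrite -!/(pgf q _) [pgf q 0]gfr0; last by move=> k; exact: weight_ge0.
rewrite q0 !subr0 => h.
have : 0 < (pgf q s - pgf q r) * r.
  by apply: lt_le_trans h; rewrite mulr_gt0 ?subr_gt0// pgf_gt0.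
by rewrite pmulr_lgt0// subr_gt0.
Qed.

Lemma pgf_compl_gt0 q r : weight q 0 = 0 -> 0 <= r < 1 ->
  0 < 1 - pgf q r.
Proof.
move=> q0 /andP[r0 r1]; rewrite subr_gt0; pose s := (1 + r) / 2.
have rs : r <= s by rewrite /s; lra.
have s1 : s < 1 by rewrite /s; lra.
apply: (le_lt_trans (le_pgf q r0 rs (ltW s1))).
apply: (@lt_le_trans _ _ (pgf q ((1 + s) / 2))).
  by apply: pgf_strict => //; rewrite /s; lra.
by apply: pgf_le1; apply/andP; split; lra.
Qed.

Lemma pgf_onto q b v : 0 <= b < 1 -> pgf q 0 < v -> v < pgf q b ->
  exists2 r, 0 < r < 1 & pgf q r = v.
Proof.
move=> /andP[b0 b1] v0 vb.
have fin r : 0 <= r < 1 -> (egf (EFin \o weight q) r < +oo)%E.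
  by move=> /andP[r0 r1]; rewrite prob_egf_lty// r0 ltW.
have [K K0 lip] := @gfr_lip R (weight q) b (weight_ge0 q) (introT andP (conj b0 b1)) fin.
(* Clipping the argument to [0, b] extends the Lipschitz function to the whole line, where its
   continuity suits the intermediate value theorem. *)
pose c x := Num.max 0 (Num.min x b).
have c0 x : 0 <= c x by rewrite /c le_max lexx.
have cb x : c x <= b by rewrite /c ge_max b0 ge_min lexx orbT.
have cid x : 0 <= x <= b -> c x = x.
  by move=> /andP[x0 xb]; rewrite /c min_l// max_r.
have clip x y : x <= y -> 0 <= c y - c x <= y - x.
  move=> xy; rewrite /c.
  case: (leP x b) => xb; case: (leP y b) => yb; (try case: (leP 0 x) => x0);
    (try case: (leP 0 y) => y0); (try case: (leP 0 b) => b0'); apply/andP; split; lra.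
have cont : continuous (fun x => pgf q (c x)).
  move=> x; apply/cvgrPdist_lt => e e0.
  have eK : 0 < e / (K + 1) by rewrite divr_gt0// ltr_wpDl.
  near=> y; have h : `|x - y| < e / (K + 1).
    by near: y; exact: (nbhsx_ballx x _ eK).
  have step u w : u <= w -> `|pgf q (c w) - pgf q (c u)| <= K * (w - u).
    move=> uw; have /andP[c1 c2] := clip u w uw; have cc : c u <= c w by lra.
    rewrite ger0_norm; last by rewrite subr_ge0 le_pgf// (le_trans (cb w))// ltW.
    by apply: le_trans (lip _ _ (c0 u) cc (cb w)) _; rewrite ler_wpM2l.
  have : `|pgf q (c x) - pgf q (c y)| <= K * `|x - y|.
    have [xy|/ltW yx] := leP x y.
      by rewrite distrC (le_trans (step _ _ xy))// distrC ger0_norm ?subr_ge0.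
    by rewrite (le_trans (step _ _ yx))// ger0_norm ?subr_ge0.
  move=> /le_lt_trans; apply; apply: (@le_lt_trans _ _ ((K + 1) * `|x - y|)).
    by rewrite ler_wpM2r// lerDl.
  by rewrite mulrC -ltr_pdivlMr// ltr_wpDl.
have [||r] := @IVT R (fun x => pgf q (c x)) 0 b v b0.
- exact: continuous_subspaceT.
- rewrite !cid ?lexx ?b0//; rewrite ge_min le_max (ltW v0) (ltW vb) orbT//.
rewrite in_itv/= => /andP[r0 rb]; rewrite cid ?r0// => rv; exists r => //.
rewrite (le_lt_trans rb b1) andbT lt_neqAle r0 andbT; apply/eqP => r00.
by move: v0; rewrite -rv -r00 ltxx.
Unshelve. all: by end_near. Qed.

End survival_ratio.

(** * Rescaled generating functions and their limit g *)

Section chi.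
Context {R : realType} (p : probability nat R) (m : R).
Hypothesis m0 : 0 < m.
Hypothesis m1 : m < 1.
Hypothesis mean : (\int[p]_k (k%:R : R)%:E)%E = m%:E.
Context (d : measure_display) (Omega : measurableType d)
    (P1 : probability Omega R) (Z : nat -> {RV P1 >-> nat}).
Hypothesis hZ : bgw_process p 1 Z.
Context (nu_min : probability nat R).
Hypothesis hY : yaglom_limit Z nu_min.
Variables (al : R) (nu : {measure set nat -> \bar R}).
Hypothesis hnu : Nstar_measure nu.
Hypothesis inv : invariant_measure p (m `^ al) nu.
Implicit Types (r s t : R).

Let la := m `^ al.
Let la0 : 0 < la. Proof. exact: powR_gt0. Qed.
Let G := ngf nu.
Let H := pgf nu_min.
Let F := pgfn p.
(** The index is shifted by one since F_0(0) = 0 would leave no usable logarithm. *)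
Let X n := F n.+1 0.
Let L n := - ln (X n).

Let z01 : 0 <= (0 : R) < 1. Proof. by rewrite lexx ltr01. Qed.

Let nuoo : gf_finite nu.
Proof. exact: ((invariantP m0 m1 mean hnu (ltW la0)).1 inv).1. Qed.

Let Geq r : 0 <= r < 1 -> G (pgf p r) = G (pgf p 0) + la * G r.
Proof. exact: ((invariantP m0 m1 mean hnu (ltW la0)).1 inv).2. Qed.

Let X01 n : 0 < X n < 1.
Proof.
rewrite /X /F (pgfn_gt0 m1 mean) ?lexx ?ler01//=.
by have /andP[] := pgfn_01 m0 mean n.+1 z01.
Qed.

Let L_gt0 n : 0 < L n.
Proof. by rewrite /L oppr_gt0; apply: ln_lt0. Qed.

Let expL n : expR (- L n) = X n.
Proof. by rewrite /L opprK lnK// posrE; case/andP: (X01 n). Qed.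

(** Up to a constant, the Laplace transform of the measure with mass la^(-n-1) nu(k) at k L_n; the
    constant makes it vanish at s = 1. *)
Definition chi n s := la ^- n.+1 * (G (expR (- (s * L n))) - G (X n)).

Let expL01 n s : 0 < s -> 0 < expR (- (s * L n)) < 1.
Proof.
by move=> s0; rewrite expR_gt0/= -[ltRHS]expR0 ltr_expR oppr_lt0 mulr_gt0.
Qed.

Let lan_gt0 n : 0 < la ^- n. Proof. by rewrite invr_gt0 exprn_gt0. Qed.

Let chi_ni n s t : 0 < s -> s <= t -> chi n t <= chi n s.
Proof.
move=> s0 st; rewrite /chi ler_wpM2l// ?(ltW (lan_gt0 _))// lerB//.
have /andP[_ e1] := expL01 n s0.
apply: le_ngf; rewrite ?expR_ge0//.
by rewrite ler_expR lerN2 ler_wpM2r// ltW.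
Qed.

Let chi1 n : chi n 1 = 0.
Proof. by rewrite /chi mul1r expL subrr mulr0. Qed.

(* chi takes an exact value at sig j r k, which tends to tau j r as k grows; chi
   being monotone, it converges at tau j r, and the tau j r exhaust ]0, +oo[. *)
Let tau j r := m ^- j * (1 - H r).
Let gam j r := la ^- j * (G r - G (F j 0)).
Let sig j r k := - ln (F k.+1 r) / L (k + j).

(** At s = sig j r k, e^(-s L_(k+j)) is F_(k+1)(r), and X_(k+j) is F_(k+1)(F_j(0)). The k + 1 common
    steps contribute la^(k+1) to the increment of G, which cancels and leaves a value free of k. *)
Let chi_sig j r k : 0 <= r < 1 -> chi (k + j) (sig j r k) = gam j r.
Proof.
move=> r01; have /andP[r0 r1] := r01.
rewrite /chi /sig divfK ?gt_eqF// opprK lnK; last first.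
  by rewrite posrE (pgfn_gt0 m1 mean)// r0 ltW.
rewrite /X -addSn /F pgfnD.
have Fj01 : 0 <= pgfn p j 0 < 1 by exact: (pgfn_01 m0 mean).
have e1 := ngf_iter m0 mean k.+1 nuoo Geq r01 hnu.
have e2 := ngf_iter m0 mean k.+1 nuoo Geq Fj01 hnu.
rewrite /G e1 e2 /gam exprD invfM.
have lan := lt0r_neq0 (exprn_gt0 k.+1 la0).
have laj := lt0r_neq0 (exprn_gt0 j la0).
by rewrite /G /F; field; rewrite lan laj.
Qed.

Let sig_cvg j r : 0 <= r < 1 -> sig j r k @[k --> \oo] --> tau j r.
Proof.
move=> r01; have /andP[r0 r1] := r01; have r01' : 0 <= r <= 1 by rewrite r0 ltW.
pose y k := F k.+1 r.
have y01 k : 0 < y k < 1.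
  rewrite /y /F (pgfn_gt0 m1 mean)//=.
  by have /andP[] := pgfn_01 m0 mean k.+1 r01.
have y1 : y @ \oo --> (1 : R).
  by have := pgfn_cvg m0 m1 mean r01'; rewrite -(cvg_shiftS (fun k => pgfn p k r)).
have X1 : X @ \oo --> (1 : R).
  have z01' : 0 <= (0 : R) <= 1 by rewrite lexx ler01.
  by have := pgfn_cvg m0 m1 mean z01'; rewrite -(cvg_shiftS (fun k => pgfn p k 0)).
have c1 := ln_compl_cvg y01 y1.
have c2 := yaglom_survival_cvg m0 mean hZ hY r01'.
have c3 := @pgfn_ratio_cvg _ p m m0 m1 mean 0 j z01.
have c4 := ln_compl_cvg X01 X1.
have q0 n t : 0 <= t < 1 -> 0 < 1 - F n t by exact: (pgfn_compl_gt0 m0 mean).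
(* Each logarithm is compared with the complement of its argument; what remains is a survival ratio
   tending to 1 - H(r), divided by a ratio of j steps tending to m^j. *)
have -> : sig j r = (fun k => (- ln (y k) / (1 - y k)) *
   ((1 - pgfn p k.+1 r) / (1 - pgfn p k.+1 0) *
   (((1 - pgfn p (j + k.+1) 0) / (1 - pgfn p k.+1 0))^-1 *
    (- ln (X (k + j)) / (1 - X (k + j)))^-1))).
  apply/funext => k; rewrite /sig /L /y /X /F.
  have -> : (k + j).+1 = (j + k.+1)%N by rewrite addnC addnS.
  have n1 := lt0r_neq0 (q0 k.+1 r r01); have n2 := lt0r_neq0 (q0 k.+1 0 z01).
  have n3 := lt0r_neq0 (q0 (j + k.+1)%N 0 z01).
  have n4 := lt0r_neq0 (L_gt0 (k + j)).
  have n4' : ln (pgfn p (j + k.+1) 0) != 0.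
    by move: n4; rewrite /L /X /F oppr_eq0 addnC addnS.
  by rewrite /F in n1 n2 n3; field; rewrite n1 n2 n3 n4'.
have -> : tau j r = 1 * ((1 - pgf nu_min r) * ((m ^+ j)^-1 * 1^-1)).
  by rewrite /tau invr1 mulr1 mul1r mulrC.
apply: cvgM => //; apply: cvgM.
  by rewrite (cvg_shiftS (fun k => (1 - pgfn p k r) / (1 - pgfn p k 0))).
apply: cvgM; apply: cvgV => //.
- by rewrite gt_eqF// exprn_gt0.
- by rewrite (cvg_shiftS (fun k => (1 - pgfn p (j + k) 0) / (1 - pgfn p k 0))).
- by rewrite (cvg_shiftn j (fun k => - ln (X k) / (1 - X k))).
Qed.

(** These exact values show that 1 - H becomes arbitrarily small on [0, 1), as the surjectivity in
    [survival_onto] requires. *)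
Lemma yaglom_pgfn n : 1 - pgf nu_min (pgfn p n 0) = m ^+ n.
Proof.
elim: n => [|n IH]; first by rewrite expr0 /= (yaglom_pgf0 hY) subr0.
have h := pgfn_01 m0 mean n z01.
by rewrite pgfnS (yaglom_pgfE m0 m1 mean hZ hY h) IH exprS.
Qed.

Let w0 : weight nu_min 0 = 0.
Proof. by rewrite /weight hY.1.1. Qed.

Let tau_strict j r s : 0 < r -> r < s -> s < 1 -> tau j s < tau j r.
Proof.
move=> r0 rs s1; rewrite /tau ltr_pM2l ?invr_gt0 ?exprn_gt0// ltrD2l ltrN2.
exact: pgf_strict.
Qed.

Lemma survival_onto s : 0 < s < 1 -> exists2 r, 0 < r < 1 & 1 - pgf nu_min r = s.
Proof.
move=> /andP[s0 s1]; have [n hn] := exists_expr_lt m0 m1 s0.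
have [|||r r01 rv] := @pgf_onto R nu_min (F n 0) (1 - s).
- exact: (pgfn_01 m0 mean).
- by rewrite (yaglom_pgf0 hY) subr_gt0.
- by have := yaglom_pgfn n; rewrite /F; lra.
by exists r => //; rewrite rv opprB addrC subrK.
Qed.

Let tau_onto s : 0 < s -> exists j r, 0 < r < 1 /\ tau j r = s.
Proof.
move=> s0; have [j hj] : exists j, m ^+ j * s < 1.
  have [|n h] := @exists_expr_lt _ m s^-1 m0 m1; first by rewrite invr_gt0.
  by exists n; rewrite -ltr_pdivlMr// mul1r.
have mj0 : 0 < m ^+ j by rewrite exprn_gt0.
have [|r r01 rE] := @survival_onto (m ^+ j * s); first by rewrite mulr_gt0.
by exists j, r; split => //; rewrite /tau /H rE mulKf// gt_eqF.
Qed.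

Let chi_cvg j r : 0 < r < 1 -> chi n (tau j r) @[n --> \oo] --> gam j r.
Proof.
move=> /andP[r0 r1]; rewrite -(cvg_shiftn j (fun n => chi n (tau j r))).
pose c := (1 + r) / 2; have rc : r < c by rewrite /c; lra.
have c1 : c < 1 by rewrite /c; lra.
have [K K0 lip] := @gfr_lip R (weight nu) c (weight_ge0 nu)
  (introT andP (conj (ltW (lt_trans r0 rc)) c1)) nuoo.
apply/cvgrPdist_lt => e e0.
have laj : 0 < la ^- j by exact: lan_gt0.
pose D := la ^- j * (K + 1).
have D0 : 0 < D by rewrite mulr_gt0// ltr_wpDl.
(* h keeps r - h and r + h inside ]0, c] and the values of gam there within e of gam j r. As tau
   decreases in r, tau j r eventually lies between sig j r2 k and sig j r1' k, where chi is known;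
   the 1 in D makes the estimate strict. *)
pose h := Num.min (e / D) (Num.min (r / 2) ((1 - r) / 2)).
have h0 : 0 < h by rewrite !lt_min divr_gt0//=; apply/andP; split; lra.
have hr : h <= r / 2 by rewrite !ge_min lexx orbT.
have hr' : h <= (1 - r) / 2 by rewrite !ge_min lexx !orbT.
have he : D * h <= e by rewrite mulrC -ler_pdivlMr// ge_min lexx.
pose r1' := r - h; pose r2 := r + h.
have r1'0 : 0 < r1' by rewrite /r1'; lra.
have r2c : r2 <= c by rewrite /r2 /c; lra.
have r21 : r2 < 1 by lra.
have t2 : tau j r2 < tau j r by apply: tau_strict => //; rewrite /r2; lra.
have t1 : tau j r < tau j r1' by apply: tau_strict => //; rewrite /r1'; lra.
have s2 : sig j r2 k @[k --> \oo] --> tau j r2 by apply: sig_cvg; rewrite r21 andbT /r2; lra.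
have s1 : sig j r1' k @[k --> \oo] --> tau j r1'.
  by apply: sig_cvg; rewrite (ltW r1'0)/= /r1'; lra.
have tau0 t : t < 1 -> 0 < t -> 0 < tau j t.
  by move=> t1' t0'; rewrite /tau mulr_gt0 ?invr_gt0 ?exprn_gt0// pgf_compl_gt0// ltW.
have t20 : 0 < tau j r2 by apply: tau0 => //; rewrite /r2; lra.
near=> k.
have a2 : sig j r2 k < tau j r by near: k; exact: (cvgr_lt _ s2 _ t2).
have a1 : tau j r < sig j r1' k by near: k; exact: (cvgr_gt _ s1 _ t1).
have sig2_gt0 : 0 < sig j r2 k by near: k; exact: (cvgr_gt _ s2 _ t20).
have tr0 : 0 < tau j r by exact: tau0.
have b1 := chi_ni (k + j) tr0 (ltW a1); have b2 := chi_ni (k + j) sig2_gt0 (ltW a2).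
rewrite chi_sig in b1; last by rewrite (ltW r1'0)/= /r1'; lra.
rewrite chi_sig in b2; last by rewrite r21 andbT /r2; lra.
have l1 : G r - G r1' <= K * h.
  have -> : h = r - r1' by rewrite /r1'; ring.
  by apply: lip; rewrite ?(ltW r1'0) ?(ltW rc)// /r1'; lra.
have l2 : G r2 - G r <= K * h.
  have -> : h = r2 - r by rewrite /r2; ring.
  by apply: lip; rewrite ?(ltW r0)// /r2; lra.
have Dh : la ^- j * (K * h) < e.
  apply: lt_le_trans he; by rewrite /D -mulrA ltr_pM2l// ltr_pM2r// ltrDl.
have m1' := ler_wpM2l (ltW laj) l1; have m2' := ler_wpM2l (ltW laj) l2.
have g1 : gam j r - gam j r1' = la ^- j * (G r - G r1') by rewrite /gam; ring.
have g2 : gam j r2 - gam j r = la ^- j * (G r2 - G r) by rewrite /gam; ring.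
rewrite -g1 in m1'; rewrite -g2 in m2'.
move: b1 b2 Dh m1' m2'; rewrite /=.
set c1' := chi _ _; set c2' := gam j r; set c3' := gam j r1'; set c4' := gam j r2.
set c5' := la ^- j * (K * h) => b1 b2 Dh m1' m2'.
by rewrite ltr_norml; apply/andP; split; lra.
Unshelve. all: by end_near. Qed.

Let g s := lim (chi n s @[n --> \oo]).

Let g_tau j r : 0 < r < 1 -> g (tau j r) = gam j r.
Proof. by move=> r01; apply/cvg_lim => //; exact: chi_cvg. Qed.

Let g_cvg s : 0 < s -> chi n s @[n --> \oo] --> g s.
Proof.
move=> s0; have [j [r [r01 <-]]] := tau_onto s0.
by rewrite g_tau//; exact: chi_cvg.
Qed.

Let g_ni s t : 0 < s -> s <= t -> g t <= g s.
Proof.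
move=> s0 st; have t0 := lt_le_trans s0 st.
by apply: (ler_cvg_to (g_cvg t0) (g_cvg s0)); apply: nearW => n; exact: chi_ni.
Qed.

Let g1 : g 1 = 0.
Proof.
apply/cvg_lim => //; rewrite (_ : (fun n => chi n 1) = cst 0); first exact: cvg_cst.
by apply/funext => n; exact: chi1.
Qed.

(** Division by m is the passage from tau j r to tau (j + 1) r. The constant G(F(0)) that appears
    cancels in differences of g. *)
Let g_div s : 0 < s -> g (s / m) = la^-1 * (g s - G (F 1 0)).
Proof.
move=> s0; have [j [r [r01 <-]]] := tau_onto s0.
have -> : tau j r / m = tau j.+1 r.
  by rewrite /tau exprS invfM; ring.
rewrite (g_tau j r01) (g_tau j.+1 r01) /gam exprS invfM.
have := ngf_iter m0 mean j nuoo Geq (pgfn_01 m0 mean 1 z01) hnu.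
rewrite -pgfnD addn1 /F /G => ->; rewrite -/la; field.
by rewrite expf_neq0 ?(lt0r_neq0 la0).
Qed.

Let g_scale s t : 0 < s -> 0 < t -> g s - g t = la * (g (s / m) - g (t / m)).
Proof. move=> s0 t0; rewrite (g_div s0) (g_div t0) -mulrBr mulVKf ?lt0r_neq0//.
by rewrite opprB addrA subrK. Qed.

Let g_survival r : 0 < r < 1 -> g (1 - H r) = G r.
Proof.
move=> r01; have -> : 1 - H r = tau 0 r by rewrite /tau expr0 invr1 mul1r.
by rewrite g_tau// /gam expr0 invr1 mul1r /F /= /G ngf0// subr0.
Qed.

(** The mass la^(-n-1) nu(k) at x = k L_n, already weighted by 1 - e^(-x), so that the Laplace
    transform is a unit difference of chi. *)
Let coef n k := la ^- n.+1 * weight nu k * (1 - expR (- (k%:R * L n))).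

Let coef_ge0 n k : 0 <= coef n k.
Proof.
rewrite /coef mulr_ge0 ?mulr_ge0 ?weight_ge0 ?(ltW (lan_gt0 _))// subr_ge0.
by rewrite -[leRHS]expR0 ler_expR oppr_le0 mulr_ge0// ltW.
Qed.

Let coef0 n : coef n 0 = 0.
Proof. by rewrite /coef mul0r oppr0 expR0 subrr mulr0. Qed.

Let kap n : {measure set (measurableTypeR R) -> \bar R} :=
  mseries (fun k => mscale (NngNum (coef_ge0 n k))
    (dirac (k%:R * L n : measurableTypeR R))) 0.

Let kap_integral n (f : measurableTypeR R -> \bar R) (D : set (measurableTypeR R)) :
  measurable D -> measurable_fun D f -> (forall x, D x -> (0 <= f x)%E) ->
  (\int[kap n]_(x in D) f x =
   \sum_(k <oo) (coef n k)%:E * (\d_(k%:R * L n)%R D * f (k%:R * L n)%R))%E.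
Proof.
move=> mD mf f0; rewrite ge0_integral_measure_series//.
by apply: eq_eseriesr => k _; rewrite ge0_integral_mscale// integral_dirac.
Qed.

Let kap_pos n : kap n (~` posreals R) = 0%E.
Proof.
have mp := measurable_posreals (R := R).
rewrite /kap /= /mseries eseries0// => k _ _.
transitivity ((coef n k)%:E * \d_(k%:R * L n)%R (~` posreals R))%E; first by [].
rewrite diracE; case: k => [|k]; first by rewrite coef0 mul0e.
by rewrite memNset ?mule0// => h; apply: h; rewrite /posreals /= mulr_gt0.
Qed.

Let ngf_sub y z : 0 <= z -> z <= y -> y < 1 ->
  (\sum_(k <oo) (weight nu k * (y ^+ k - z ^+ k))%:E = (G y - G z)%:E)%E.
Proof.
move=> z0 zy y1; have y0 := le_trans z0 zy; have z1 := le_lt_trans zy y1.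
have w0' k : (0 <= (EFin \o weight nu) k)%E by rewrite lee_fin weight_ge0.
have t0 k : 0 <= weight nu k * (y ^+ k - z ^+ k).
  by rewrite mulr_ge0 ?weight_ge0// subr_ge0 lerXn2r.
have S : (\sum_(k <oo) (weight nu k * (y ^+ k - z ^+ k))%:E + (G z)%:E = (G y)%:E)%E.
  rewrite -!ngf_egf ?z0 ?y0// -nneseriesD.
  - by apply: eq_eseriesr => k _; rewrite -EFinM -EFinD; congr EFin; ring.
  - by move=> k _ _; rewrite lee_fin.
  - by move=> k _ _; exact: egf_term_ge0.
by rewrite EFinB -S addeK.
Qed.

Let kap_laplace n s : 0 < s ->
  (\int[kap n]_(x in posreals R) (expR (- (s * x)))%:E = (chi n s - chi n (s + 1))%:E)%E.
Proof.
move=> s0; rewrite kap_integral; last 3 first.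
- exact: measurable_posreals.
- by apply/measurable_EFinP; exact: measurable_expRN.
- by move=> x _; rewrite lee_fin expR_ge0.
pose y := expR (- (s * L n)); pose z := expR (- ((s + 1) * L n)).
have /andP[y0 y1] := expL01 n s0.
have zy : z <= y by rewrite ler_expR lerN2 ler_wpM2r ?lerDl// ltW.
transitivity (\sum_(k <oo) (la ^- n.+1)%:E * (weight nu k * (y ^+ k - z ^+ k))%:E)%E.
  apply: eq_eseriesr => -[|k] _; first by rewrite coef0 mul0e !expr0 subrr mulr0 mule0.
  rewrite diracE mem_set; last by rewrite /posreals /= mulr_gt0.
  rewrite mul1e -!EFinM /coef /y /z -!expRM_natl; congr EFin.
  have -> : expR (- (s * (k.+1%:R * L n))) = expR (k.+1%:R * - (s * L n)) by congr expR; ring.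
  have -> : expR (k.+1%:R * - ((s + 1) * L n)) =
      expR (k.+1%:R * - (s * L n)) * expR (- (k.+1%:R * L n)).
    by rewrite -expRD; congr expR; ring.
  ring.
rewrite nneseriesZl; last first.
  move=> k _; rewrite lee_fin mulr_ge0 ?weight_ge0// subr_ge0 lerXn2r// nnegrE ?expR_ge0//.
rewrite ngf_sub ?expR_ge0// -EFinM /chi; congr EFin; rewrite -/y -/z; ring.
Qed.

Theorem levy_of_invariant : al < 1 ->
  exists Lam : {measure set (measurableTypeR R) -> \bar R},
    [/\ posreals_measure Lam, scale_invariant m Lam
      & forall r, 0 <= r < 1 -> wint Lam al (1 - H r) 1 = (G r)%:E].
Proof.
move=> al1.
have [s s0|K [Ky KL]] := laplace_continuity (ph := fun n s => chi n s - chi n (s + 1))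
    (phi := fun s => g s - g (s + 1)) kap_pos kap_laplace.
  by apply: cvgB; apply: g_cvg => //; rewrite addr_gt0.
have [Lam [Lpos Lscale Lint]] := levy_existence m0 m1 al1 Ky KL g_ni g_scale.
exists Lam; split => // r /andP[r0 r1].
(* [g_survival] is available for r > 0 only; at r = 0 both limits of the kernel are 1. *)
have [->|rn0] := eqVneq r 0.
  rewrite /H (yaglom_pgf0 hY) subr0 Lint//.
  by rewrite subrr /G ngf0.
have r01 : 0 < r < 1 by rewrite lt_neqAle eq_sym rn0 r0.
have /andP[rr _] := r01.
have H1 : 0 < 1 - H r by apply: pgf_compl_gt0; rewrite ?r0.
rewrite Lint//; last by rewrite gerBl pgf_ge0.
by rewrite g1 subr0 g_survival.
Qed.

End chi.

(** * Complex power series and compound Poisson laws *)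

Section complex_limits.
Context {R : realType}.
Local Notation C := R[i].
Local Notation N := (@Normc.normc R).
Implicit Types (u v : nat -> C) (z w : C) (x y r : R).

Lemma normcC x : N x%:C%C = `|x|.
Proof. by rewrite /Normc.normc /= expr0n /= addr0 sqrtr_sqr. Qed.

Lemma norm_normc z : `|z| = (N z)%:C%C. Proof. by case: z. Qed.

Lemma ler_normcD z w : N (z + w) <= N z + N w.
Proof. exact: (le_normcD (z : Rcomplex R) w). Qed.

Lemma normc_opp z : N (- z) = N z.
Proof. exact: (normcN (z : Rcomplex R)). Qed.

Lemma normcB z w : N (z - w) = N (w - z).
Proof. by rewrite -normc_opp opprB. Qed.

Lemma normc_ge0 z : 0 <= N z.
Proof. by case: z => a b; exact: sqrtr_ge0. Qed.

Lemma normcX z n : N (z ^+ n) = N z ^+ n.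
Proof.
elim: n => [|n IH]; first by rewrite !expr0 (normcC 1) normr1.
by rewrite !exprS Normc.normcM IH.
Qed.

Lemma ler_normc_sum I (s : seq I) (P : pred I) (f : I -> C) :
  N (\sum_(i <- s | P i) f i) <= \sum_(i <- s | P i) N (f i).
Proof.
elim/big_rec2 : _ => [|i y z _ h]; first by rewrite (normcC 0) normr0.
by apply: le_trans (ler_normcD _ _) _; rewrite lerD2l.
Qed.

Lemma Re_le_normc z : `|complex.Re z| <= N z.
Proof.
have := normc_ge_Re z; rewrite norm_normc lecE /= => /andP[_].
by [].
Qed.

Lemma Im_le_normc z : `|complex.Im z| <= N z.
Proof.
case: z => a b /=; rewrite -sqrtr_sqr ler_wsqrtr// lerDr sqr_ge0//.
Qed.

Lemma normc_le_ReIm z : N z <= `|complex.Re z| + `|complex.Im z|.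
Proof.
case: z => a b /=; rewrite -(@ger0_norm _ (`|a| + `|b|)) ?addr_ge0//.
rewrite -sqrtr_sqr ler_wsqrtr// sqrrD !real_normK ?num_real//.
by rewrite -addrA (addrC (_ *+ 2)) addrA lerDl mulrn_wge0// mulr_ge0.
Qed.

(** Convergence expressed by the real modulus, which gives access to real squeeze arguments; [ccvgP]
    relates it to the topology of the complex numbers. *)
Definition ccvg u z := N (u n - z) @[n --> \oo] --> (0 : R).

Lemma ccvg_le u z (e : nat -> R) : (forall n, N (u n - z) <= e n) ->
  e @ \oo --> (0 : R) -> ccvg u z.
Proof.
move=> h e0; apply: (@squeeze_cvgr _ _ _ _ (cst 0) e) => //; last exact: cvg_cst.
by apply: nearW => n; rewrite h normc_ge0.
Qed.

(** A general additive functional treats real and imaginary parts together. *)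
Lemma ccvg_additive (phi : {additive C -> R}) u z : (forall w, `|phi w| <= N w) ->
  ccvg u z -> phi (u n) @[n --> \oo] --> phi z.
Proof.
move=> phiN h; apply/cvgrPdist_lt => e e0.
have /cvgrPdist_lt /(_ e e0) := h; apply: filterS => n.
rewrite sub0r normrN ger0_norm ?normc_ge0//; apply: le_lt_trans.
by rewrite -raddfB normcB.
Qed.

Lemma ccvg_Re u z : ccvg u z -> complex.Re (u n) @[n --> \oo] --> complex.Re z.
Proof. exact: (ccvg_additive Re_le_normc). Qed.

Lemma ccvg_Im u z : ccvg u z -> complex.Im (u n) @[n --> \oo] --> complex.Im z.
Proof. exact: (ccvg_additive Im_le_normc). Qed.

Lemma ccvg_ReIm u z : complex.Re (u n) @[n --> \oo] --> complex.Re z ->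
  complex.Im (u n) @[n --> \oo] --> complex.Im z -> ccvg u z.
Proof.
have h (phi : {additive C -> R}) : phi (u n) @[n --> \oo] --> phi z ->
    `|phi (u n - z)| @[n --> \oo] --> (0 : R).
  move=> uz; rewrite -[X in _ --> X](normr0 R) -(subrr (phi z)).
  under eq_fun do rewrite raddfB.
  by apply: cvg_norm; apply: cvgB => //; exact: cvg_cst.
move=> hr hi; apply: (ccvg_le (fun n => normc_le_ReIm (u n - z))).
by rewrite -[X in _ --> X](addr0 0); apply: cvgD; apply: h.
Qed.

Lemma ccvg_unique u z w : ccvg u z -> ccvg u w -> z = w.
Proof.
move=> hz hw; have e1 := cvg_unique (@norm_hausdorff _ _) (ccvg_Re hz) (ccvg_Re hw).
have e2 := cvg_unique (@norm_hausdorff _ _) (ccvg_Im hz) (ccvg_Im hw).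
by apply/eqP; rewrite eq_complex e1 e2 !eqxx.
Qed.

Lemma ccvgP u z : ccvg u z <-> u @ \oo --> (z : C^o).
Proof.
split=> h.
  apply/(@cvgrPdist_lt _ C^o) => e e0; have [e1 e2] : complex.Im e = 0 /\ 0 < complex.Re e.
    by move: e0; rewrite ltcE /= => /andP[/eqP].
  have /cvgrPdist_lt /(_ _ e2) := h; apply: filterS => n.
  rewrite sub0r normrN ger0_norm ?normc_ge0// normcB norm_normc ltcE /= e1 eqxx.
  by move=> ->.
apply/cvgrPdist_lt => e e0.
have /(@cvgrPdist_lt _ C^o) /(_ e%:C%C) := h.
rewrite ltcR => /(_ e0); apply: filterS => n.
by rewrite norm_normc ltcR sub0r normrN ger0_norm ?normc_ge0// normcB.
Qed.

Lemma ccvg_eq u v z : (forall n, u n = v n) -> ccvg u z -> ccvg v z.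
Proof. by move=> /funext ->. Qed.

Lemma ccvg_tail_le u z (V : nat -> R) L n :
  (forall k, (n <= k)%N -> N (u k - u n) <= V k - V n) ->
  ccvg u z -> V @ \oo --> L -> N (z - u n) <= L - V n.
Proof.
move=> uV uz VL.
have h : (V k - V n) + N (u k - z) @[k --> \oo] --> (L - V n) + 0.
  by apply: cvgD => //; apply: cvgB => //; exact: cvg_cst.
rewrite -[leRHS]addr0; apply: (ler_cvg_to (cvg_cst _) h).
near=> k; have nk : (n <= k)%N by near: k; exact: nbhs_infty_ge.
move: (uV k nk) => h1; have {h1} := lerD (lexx (N (u k - z))) h1; rewrite [leRHS]addrC; apply: le_trans.
have -> : z - u n = (z - u k) + (u k - u n) by rewrite addrA subrK.
by apply: le_trans (ler_normcD _ _) _; rewrite (normcB z).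
Unshelve. all: by end_near. Qed.

Lemma conv_partialE (K : pzRingType) (a b : nat -> K) n :
  \sum_(k < n) \sum_(j < k.+1) a j * b (k - j)%N =
  \sum_(j < n) a j * \sum_(i < n - j) b i.
Proof.
elim: n => [|n IH]; first by rewrite !big_ord0.
rewrite big_ord_recr IH /= [RHS]big_ord_recr /= subSnn big_ord1.
rewrite [X in _ + X]big_ord_recr/= subnn addrA; congr (_ + _).
rewrite -big_split/=; apply: eq_bigr => j _.
by rewrite -mulrDr subSn ?(ltnW (ltn_ord j))// big_ord_recr.
Qed.

(** The product of partial sums exceeds the partial Cauchy product by the terms a_j b_i with i, j <
    n <= i + j. Bounding these one by one gives the same defect for the majorants. *)
Lemma normc_conv_le (a b : nat -> C) (A B : nat -> R) n :
  (forall k, N (a k) <= A k) -> (forall k, N (b k) <= B k) ->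
  N ((\sum_(k < n) a k) * (\sum_(k < n) b k) -
     \sum_(k < n) \sum_(j < k.+1) a j * b (k - j)%N) <=
  (\sum_(k < n) A k) * (\sum_(k < n) B k) -
     \sum_(k < n) \sum_(j < k.+1) A j * B (k - j)%N.
Proof.
move=> aA bB; rewrite !conv_partialE !mulr_suml -!sumrB.
apply: le_trans (ler_normc_sum _ _ _) _; apply: ler_sum => j _.
rewrite -!mulrBr Normc.normcM ler_pM ?normc_ge0//.
have split (K : pzRingType) (f : nat -> K) :
    \sum_(i < n) f i - \sum_(i < n - j) f i = \sum_(n - j <= i < n) f i.
  by rewrite -!(big_mkord xpredT f) (@big_cat_nat _ _ _ (n - j)%N 0 n) ?leq_subr//= addrC addrK.
rewrite !split; apply: le_trans (ler_normc_sum _ _ _) _.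
by apply: ler_sum.
Qed.

(** The last premise says that the Cauchy product converges correctly for the real majorants, so
    their defect tends to 0 and forces that of a and b to 0. *)
Lemma ccvg_conv (a b : nat -> C) (A B : nat -> R) z w x y :
  (forall k, N (a k) <= A k) -> (forall k, N (b k) <= B k) ->
  ccvg (fun n => \sum_(k < n) a k) z -> ccvg (fun n => \sum_(k < n) b k) w ->
  \sum_(k < n) A k @[n --> \oo] --> x -> \sum_(k < n) B k @[n --> \oo] --> y ->
  \sum_(k < n) \sum_(j < k.+1) A j * B (k - j)%N @[n --> \oo] --> x * y ->
  ccvg (fun n => \sum_(k < n) \sum_(j < k.+1) a j * b (k - j)%N) (z * w).
Proof.
move=> aA bB az bw Ax By ABxy.
pose sa n := \sum_(k < n) a k; pose sb n := \sum_(k < n) b k.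
apply: (@ccvg_le _ _ (fun n => ((\sum_(k < n) A k) * (\sum_(k < n) B k) -
   \sum_(k < n) \sum_(j < k.+1) A j * B (k - j)%N) +
   ((\sum_(k < n) A k) * N (sb n - w) + N (sa n - z) * N w))) => [n|].
  set c := \sum_(k < n) _.
  have -> : c - z * w = (c - sa n * sb n) + (sa n * (sb n - w) + (sa n - z) * w).
    ring.
  apply: le_trans (ler_normcD _ _) _; apply: lerD.
    by rewrite normcB; exact: normc_conv_le.
  apply: le_trans (ler_normcD _ _) _; rewrite !Normc.normcM lerD2r.
  apply: ler_wpM2r; first exact: normc_ge0.
  by apply: le_trans (ler_normc_sum _ _ _) _; apply: ler_sum.
rewrite [X in _ --> X](_ : 0 = (x * y - x * y) + (x * 0 + 0 * N w)); last by rewrite subrr mulr0 mul0r !addr0.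
have ABxy' : (\sum_(k < n) A k) * (\sum_(k < n) B k) @[n --> \oo] --> x * y.
  by apply: (@cvgM _ _ \oo _ (fun n => \sum_(k < n) A k) (fun n => \sum_(k < n) B k)).
by apply: cvgD; [exact: cvgB|apply: cvgD; apply: cvgM => //; exact: cvg_cst].
Qed.

End complex_limits.

Section complex_exponential.
Context {R : realType}.
Local Notation C := R[i].
Local Notation N := (@Normc.normc R).
Implicit Types (z w : C) (x y : R).

Lemma exp_partial_cvg x : \sum_(k < n) x ^+ k / k`!%:R @[n --> \oo] --> expR x.
Proof.
have -> : (fun n => \sum_(k < n) x ^+ k / k`!%:R) = series (exp_coeff x).
  by apply/funext => n; rewrite /series /= big_mkord.
exact: is_cvg_series_exp_coeff.
Qed.

Lemma exp_partial_le x n : 0 <= x -> \sum_(k < n) x ^+ k / k`!%:R <= expR x.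
Proof.
move=> x0; apply: (@ler_cvg_to nat \oo _ R (cst (\sum_(k < n) x ^+ k / k`!%:R)) (fun n => \sum_(k < n) x ^+ k / k`!%:R)); [exact: cvg_cst|exact: exp_partial_cvg|rewrite /cst /=].
near=> k; have nk : (n <= k)%N by near: k; exact: nbhs_infty_ge.
rewrite -!(big_mkord xpredT (fun k => x ^+ k / k`!%:R)) (big_cat_nat _ nk)//= lerDl.
by apply: sumr_ge0 => i _; rewrite divr_ge0// exprn_ge0.
Unshelve. all: by end_near. Qed.

Definition exp_term (K : fieldType) (z : K) k : K := z ^+ k / k`!%:R.

Lemma exp_term_conv (K : numFieldType) (z w : K) n :
  \sum_(j < n.+1) exp_term z j * exp_term w (n - j)%N = exp_term (z + w) n.
Proof.
have fn0 k : (k`!%:R : K) != 0 by rewrite pnatr_eq0 -lt0n fact_gt0.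
rewrite /exp_term addrC exprDn mulr_suml; apply: eq_bigr => j _.
have jn : (j <= n)%N by rewrite -ltnS.
apply: (mulIf (fn0 n)); rewrite divfK// -(bin_fact jn) !natrM -mulr_natl.
by field; rewrite !fn0.
Qed.

Lemma normc_exp_term z k : N (exp_term z k) = exp_term (N z) k.
Proof.
rewrite /exp_term Normc.normcM Normc.normcV normcX; congr (_ / _).
by rewrite -(rmorph_nat (real_complex R)) normcC normr_nat.
Qed.

Lemma exp_term_real x k : exp_term x%:C%C k = (exp_term x k)%:C%C.
Proof. by rewrite /exp_term rmorphM rmorphXn fmorphV rmorph_nat. Qed.

Lemma ccvg_exp_real x : ccvg (fun n => \sum_(k < n) exp_term x%:C%C k) (expR x)%:C%C.
Proof.
apply: (@ccvg_eq _ (fun n => (\sum_(k < n) exp_term x k)%:C%C)).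
  by move=> n; rewrite rmorph_sum; apply: eq_bigr => k _; rewrite exp_term_real.
by apply: ccvg_ReIm => /=; [exact: exp_partial_cvg|exact: cvg_cst].
Qed.

Lemma exp_term_imag x k :
  exp_term (0 +i* x)%C k = (cos_coeff x k +i* sin_coeff x k)%C.
Proof.
have -> : (0 +i* x)%C = 'i%C * x%:C%C by simpc.
rewrite /exp_term exprMn -rmorphXn -(rmorph_nat (real_complex R)) -fmorphV -mulrA -rmorphM.
have -> : 'i%C ^+ k = ((~~ odd k)%:R * (-1) ^+ k./2 +i* ((odd k)%:R * (-1) ^+ k.-1./2))%C :> C.
  elim: k => [|k IH]; first by rewrite !expr0 !mulr1.
  rewrite exprS IH; simpc; rewrite /= negbK; congr (_ +i* _)%C.
  by case: k {IH} => [|k] /=; rewrite ?mul0r ?oppr0// exprS mulN1r mulrN.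
simpc; rewrite /cos_coeff /sin_coeff /=. by rewrite !mulrA.
Qed.

Lemma ccvg_exp_imag x :
  ccvg (fun n => \sum_(k < n) exp_term (0 +i* x)%C k) (cos x +i* sin x)%C.
Proof.
apply: (@ccvg_eq _ (fun n => (series (cos_coeff x) n +i* series (sin_coeff x) n)%C)).
  move=> n; rewrite /series/= !big_mkord.
  elim: n => [|n IH]; first by rewrite !big_ord0.
  by rewrite !big_ord_recr /= -IH exp_term_imag; simpc.
apply: ccvg_ReIm => /=; rewrite ?cos.unlock ?sin.unlock.
  exact: is_cvg_series_cos_coeff.
exact: is_cvg_series_sin_coeff.
Qed.

(** [cexp] is defined through its real and imaginary parts; its power series is recovered as the
    Cauchy product of those at a and at i b. *)
Lemma ccvg_exp z : ccvg (fun n => \sum_(k < n) exp_term z k) (cexp z).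
Proof.
case: z => a b; rewrite /cexp /=.
pose A k := exp_term `|a| k; pose B k := exp_term `|b| k.
have -> : (a +i* b)%C = a%:C%C + (0 +i* b)%C by simpc.
apply: (@ccvg_eq _ (fun n => \sum_(k < n) \sum_(j < k.+1)
    exp_term a%:C%C j * exp_term (0 +i* b)%C (k - j)%N)).
  by move=> n; apply: eq_bigr => k _; rewrite exp_term_conv.
apply: (@ccvg_conv _ _ _ A B _ _ (expR `|a|) (expR `|b|)).
- by move=> k; rewrite normc_exp_term normcC.
- move=> k; rewrite normc_exp_term (_ : N (0 +i* b)%C = `|b|)//.
  by rewrite /Normc.normc /= expr0n /= add0r sqrtr_sqr.
- exact: ccvg_exp_real.
- exact: ccvg_exp_imag.
- exact: exp_partial_cvg.
- exact: exp_partial_cvg.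
rewrite -expRD.
have -> : (fun n => \sum_(k < n) \sum_(j < k.+1) A j * B (k - j)%N) =
    (fun n => \sum_(k < n) exp_term (`|a| + `|b|) k).
  by apply/funext => n; apply: eq_bigr => k _; rewrite exp_term_conv.
exact: exp_partial_cvg.
Qed.

Lemma cexp_real x : cexp x%:C%C = (expR x)%:C%C.
Proof. by rewrite /cexp /= cos0 sin0 mulr1. Qed.

Lemma cexp_subR z x : cexp (z - x%:C%C) = cexp z * (expR (- x))%:C%C.
Proof. by case: z => a b; rewrite /cexp /= subr0 expRD rmorphM mulrAC. Qed.

End complex_exponential.

(** * Power series with nonnegative coefficients at complex points *)

Section egf_partial.
Context {R : realType}.
Implicit Types (a : nat -> R) (r L : R).

Lemma egf_cvg a r L : (forall k, 0 <= a k) -> 0 <= r ->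
  egf (EFin \o a) r = L%:E <-> \sum_(k < n) a k * r ^+ k @[n --> \oo] --> L.
Proof.
move=> a0 r0.
have E n : (\sum_(0 <= k < n) (EFin \o a) k * (r ^+ k)%:E)%E =
    (\sum_(k < n) a k * r ^+ k)%:E.
  by rewrite -sumEFin big_mkord; apply: eq_bigr => k _; rewrite EFinM.
have h : (fun n => (\sum_(0 <= k < n) (EFin \o a) k * (r ^+ k)%:E)%E) @ \oo -->
    egf (EFin \o a) r.
  by apply: is_cvg_nneseries => k _ _; exact: egf_term_ge0.
split=> [eL|aL].
  move: h; rewrite eL (_ : (fun n => _) = EFin \o (fun n => \sum_(k < n) a k * r ^+ k)).
    by move=> /fine_cvg.
  by apply/funext => n; exact: E.
apply: (cvg_unique (@ereal_hausdorff R) h).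
rewrite (_ : (fun n => _) = EFin \o (fun n => \sum_(k < n) a k * r ^+ k)).
  by apply: cvg_EFin => //; exact: nearW.
by apply/funext => n; exact: E.
Qed.

Lemma partial_le a r n k : (forall k, 0 <= a k) -> 0 <= r -> (n <= k)%N ->
  \sum_(i < n) a i * r ^+ i <= \sum_(i < k) a i * r ^+ i.
Proof.
move=> a0 r0 nk; rewrite -!(big_mkord xpredT (fun i => a i * r ^+ i)) (big_cat_nat _ nk)//=.
by rewrite lerDl; apply: sumr_ge0 => i _; rewrite mulr_ge0// exprn_ge0.
Qed.

Lemma partial_le_lim a r n L : (forall k, 0 <= a k) -> 0 <= r ->
  \sum_(k < n) a k * r ^+ k @[n --> \oo] --> L -> \sum_(k < n) a k * r ^+ k <= L.
Proof.
move=> a0 r0 aL.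
apply: (@ler_cvg_to nat \oo _ R (cst (\sum_(k < n) a k * r ^+ k)) _ _ _ _ aL).
  exact: cvg_cst.
by near=> k; apply: partial_le => //; near: k; exact: nbhs_infty_ge.
Unshelve. all: by end_near. Qed.

Local Notation N := (@Normc.normc R).

Lemma normc_real_term a (z : R[i]) k : 0 <= a k ->
  N ((a k)%:C%C * z ^+ k) = a k * N z ^+ k.
Proof. by move=> a0; rewrite Normc.normcM normcC normcX ger0_norm. Qed.

Lemma normc_partialB a (z : R[i]) n k : (forall k, 0 <= a k) -> (n <= k)%N ->
  N (\sum_(i < k) (a i)%:C%C * z ^+ i - \sum_(i < n) (a i)%:C%C * z ^+ i) <=
  \sum_(i < k) a i * N z ^+ i - \sum_(i < n) a i * N z ^+ i.
Proof.
move=> a0 nk; have split (K : pzRingType) (f : nat -> K) :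
    \sum_(i < k) f i - \sum_(i < n) f i = \sum_(n <= i < k) f i.
  by rewrite -!(big_mkord xpredT f) (big_cat_nat _ nk)//= addrC addrK.
rewrite (split R[i] (fun i => (a i)%:C%C * z ^+ i)) (split R (fun i => a i * N z ^+ i)).
apply: le_trans (ler_normc_sum _ _ _) _; apply: ler_sum => i _.
by rewrite normc_real_term.
Qed.

Lemma power_series_ccvg a (z : R[i]) L : (forall k, 0 <= a k) ->
  \sum_(k < n) a k * N z ^+ k @[n --> \oo] --> L ->
  exists w, ccvg (fun n => \sum_(k < n) (a k)%:C%C * z ^+ k) w.
Proof.
move=> a0 aL.
have cv (phi : {additive R[i] -> R}) : (forall u, `|phi u| <= N u) ->
    exists l, phi (\sum_(k < n) (a k)%:C%C * z ^+ k) @[n --> \oo] --> (l : R).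
  move=> phiN; exists (limn (series (fun k => phi ((a k)%:C%C * z ^+ k)))).
  rewrite (_ : (fun n => _) = series (fun k => phi ((a k)%:C%C * z ^+ k))).
    apply: normed_cvg.
    have h : cvgn (series (fun k => a k * N z ^+ k)).
      rewrite (_ : series _ = (fun n => \sum_(k < n) a k * N z ^+ k)).
        by apply/cvg_ex; exists L.
      by apply/funext => n; rewrite /series/= big_mkord.
    apply: (series_le_cvg _ _ _ h) => k /=.
    - exact: normr_ge0.
    - by rewrite mulr_ge0// exprn_ge0// normc_ge0.
    - by rewrite -normc_real_term.
  by apply/funext => n; rewrite /series/= big_mkord raddf_sum.
have [x hx] := cv (@complex.Re R) (@Re_le_normc R).
have [y hy] := cv (@complex.Im R) (@Im_le_normc R).
by exists (x +i* y)%C; apply: ccvg_ReIm.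
Qed.

End egf_partial.

Section compound_poisson.
Context {R : realType} (q : probability nat R).
Hypothesis q0 : weight q 0 = 0.
Local Notation C := R[i].
Local Notation N := (@Normc.normc R).
Implicit Types (z : C) (x r : R).

Lemma gf_partialE (nu : {measure set nat -> \bar R}) z n : weight nu 0 = 0 ->
  gf_partial nu z n = \sum_(k < n) (weight nu k)%:C%C * z ^+ k.
Proof.
move=> nu0; rewrite /gf_partial; case: n => [|n]; first by rewrite big_geq// big_ord0.
by rewrite big_ord_recl nu0 /= mul0r add0r big_add1 big_mkord.
Qed.

Let wq0 k : 0 <= weight q k. Proof. exact: weight_ge0. Qed.

Let N01 z : N z < 1 -> 0 <= N z < 1.
Proof. by rewrite normc_ge0. Qed.

Lemma pgf_cvg r : 0 <= r < 1 -> \sum_(k < n) weight q k * r ^+ k @[n --> \oo] --> pgf q r.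
Proof.
by move=> /andP[r0 r1]; apply/egf_cvg => //; rewrite pgf_egf// r0 ltW.
Qed.

Lemma gf_ccvg z : N z < 1 -> ccvg (fun n => \sum_(k < n) (weight q k)%:C%C * z ^+ k) (gf q z).
Proof.
move=> z1; have [w hw] := power_series_ccvg wq0 (pgf_cvg (N01 z1)).
suff -> : gf q z = w by [].
apply: (@cvg_lim C^o) => //.
by apply/ccvgP; apply: ccvg_eq hw => n; rewrite gf_partialE.
Qed.

Lemma gf_real r : 0 <= r < 1 -> gf q r%:C%C = (pgf q r)%:C%C.
Proof.
move=> r01; have /andP[r0 r1] := r01.
have Nr : N r%:C%C < 1 by rewrite normcC ger0_norm.
apply: ccvg_unique (gf_ccvg Nr) _; apply: ccvg_ReIm => /=.
  rewrite (_ : (fun n => _) = (fun n => \sum_(k < n) weight q k * r ^+ k)); first exact: pgf_cvg.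
  by apply/funext => n; rewrite raddf_sum; apply: eq_bigr => k _; rewrite -rmorphXn -rmorphM.
rewrite (_ : (fun n => _) = cst 0); first exact: cvg_cst.
apply/funext => n; rewrite raddf_sum /=; apply: big1 => k _.
by rewrite -rmorphXn -rmorphM.
Qed.

Let b0 := bgw_trans_ge0 q.

(** [bgw_trans] reappears here with the jump law q in place of the offspring law: its rows are the
    k-fold convolutions of q. *)
Lemma bgw_trans_cvg k r : 0 <= r < 1 ->
  \sum_(n < M) bgw_trans q k n * r ^+ n @[M --> \oo] --> pgf q r ^+ k.
Proof.
by move=> /andP[r0 r1]; apply/egf_cvg; [exact: b0|exact: r0|rewrite bgw_trans_egf// r0 ltW].
Qed.

Lemma bgw_trans_ccvg k z : N z < 1 ->
  ccvg (fun M => \sum_(n < M) (bgw_trans q k n)%:C%C * z ^+ n) (gf q z ^+ k).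
Proof.
move=> z1; have Nz := N01 z1; elim: k => [|k IH].
  rewrite /ccvg -cvg_shiftS (_ : (fun n => _) = cst 0); first exact: cvg_cst.
  apply/funext => n; rewrite big_ord_recl /= big1 => [|i _]; last by rewrite mul0r.
  by rewrite addr0 !expr0 mulr1 subrr (normcC 0) normr0.
pose a n := (weight q n)%:C%C * z ^+ n; pose b n := (bgw_trans q k n)%:C%C * z ^+ n.
apply: (@ccvg_eq _ (fun M => \sum_(n < M) \sum_(j < n.+1) a j * b (n - j)%N)).
  move=> M; apply: eq_bigr => n _; rewrite /= rmorph_sum mulr_suml.
  apply: eq_bigr => j _; rewrite rmorphM /a /b mulrACA -exprD subnKC//.
  by rewrite -ltnS.
rewrite exprS; apply: (@ccvg_conv _ _ _ (fun n => weight q n * N z ^+ n)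
    (fun n => bgw_trans q k n * N z ^+ n) _ _ (pgf q (N z)) (pgf q (N z) ^+ k)).
- by move=> n; rewrite normc_real_term.
- by move=> n; rewrite normc_real_term.
- exact: gf_ccvg.
- exact: IH.
- exact: pgf_cvg.
- exact: bgw_trans_cvg.
rewrite -exprS; have h := @bgw_trans_cvg k.+1 _ Nz; move: h.
rewrite (_ : (fun M => _) = (fun M => \sum_(n < M) \sum_(j < n.+1)
   (weight q j * N z ^+ j) * (bgw_trans q k (n - j) * N z ^+ (n - j)%N)))//.
apply/funext => M; apply: eq_bigr => n _; rewrite /= mulr_suml.
by apply: eq_bigr => j _; rewrite mulrACA -exprD subnKC// -ltnS.
Qed.

(** Each jump is at least 1, so k jumps reach at least k. This is what makes the sum in [cpw]
    finite. *)
Lemma bgw_trans_lt k n : (n < k)%N -> bgw_trans q k n = 0.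
Proof.
elim: k n => [//|k IH] n nk; rewrite /= big_ord_recl q0 mul0r add0r.
apply: big1 => j _; rewrite lift0 IH ?mulr0//; case: n nk j => [_ [//]|n nk j].
by rewrite subSS; apply: leq_ltn_trans (leq_subr _ _) _.
Qed.

(* exp(x) times the mass at n of the q-compound Poisson law of intensity x. *)
Definition cpw x n : R := \sum_(k < n.+1) exp_term x k * bgw_trans q k n.

Lemma cpw_ge0 x n : 0 <= x -> 0 <= cpw x n.
Proof.
move=> x0; apply: sumr_ge0 => k _.
by rewrite mulr_ge0 ?bgw_trans_ge0// /exp_term divr_ge0// exprn_ge0.
Qed.

Lemma cpw0 x : cpw x 0 = 1.
Proof. by rewrite /cpw big_ord1 /= mulr1 /exp_term expr0 fact0 divr1. Qed.

Lemma cpwE K x n : (n < K)%N -> cpw x n = \sum_(k < K) exp_term x k * bgw_trans q k n.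
Proof.
move=> nK; rewrite /cpw -!(big_mkord xpredT (fun k => exp_term x k * bgw_trans q k n)).
rewrite [RHS](big_cat_nat _ nK)//= [X in _ = _ + X]big_nat [X in _ = _ + X]big1 ?addr0// => k /andP[nk _].
by rewrite bgw_trans_lt ?mulr0.
Qed.

(** A ring morphism f lets one identity serve both the real series and its complex counterpart. *)
Lemma cpw_partialE (S : comPzRingType) (f : {rmorphism R -> S}) (z : S) K M x : (M <= K)%N ->
  \sum_(n < M) f (cpw x n) * z ^+ n =
  \sum_(k < K) f (exp_term x k) * \sum_(n < M) f (bgw_trans q k n) * z ^+ n.
Proof.
move=> MK; under [RHS]eq_bigr do rewrite mulr_sumr.
rewrite exchange_big/=; apply: eq_bigr => n _.
rewrite (@cpwE K) ?(leq_trans (ltn_ord n))// rmorph_sum mulr_suml.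
by apply: eq_bigr => k _; rewrite rmorphM mulrA.
Qed.

(** The two limits are exchanged by monotonicity. Partial sums increase and stay below the
    exponential; conversely, for fixed K, letting M grow shows that the first K exponential terms
    stay below the limit. *)
Lemma cpw_cvg x r : 0 <= x -> 0 <= r < 1 ->
  \sum_(n < M) cpw x n * r ^+ n @[M --> \oo] --> expR (x * pgf q r).
Proof.
move=> x0 r01; have /andP[r0 r1] := r01.
have c0 n : 0 <= cpw x n by exact: cpw_ge0.
have e0 k : 0 <= exp_term x k by rewrite /exp_term divr_ge0// exprn_ge0.
have PE K M : (M <= K)%N -> \sum_(n < M) cpw x n * r ^+ n =
    \sum_(k < K) exp_term x k * \sum_(n < M) bgw_trans q k n * r ^+ n.
  exact: (@cpw_partialE R idfun).
have tE K : \sum_(k < K) exp_term x k * pgf q r ^+ k =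
    \sum_(k < K) (x * pgf q r) ^+ k / k`!%:R.
  by apply: eq_bigr => k _; rewrite /exp_term exprMn mulrAC.
have up M : \sum_(n < M) cpw x n * r ^+ n <= expR (x * pgf q r).
  rewrite (PE M)//; apply: le_trans (@exp_partial_le _ _ M (mulr_ge0 x0 (pgf_ge0 q r0))).
  rewrite -tE; apply: ler_sum => k _; rewrite ler_wpM2l//.
  exact: (partial_le_lim _ (b0 k) r0 (@bgw_trans_cvg k r r01)).
have nd : nondecreasing_seq (fun M => \sum_(n < M) cpw x n * r ^+ n).
  by move=> M M' MM; exact: partial_le.
have ub : has_ubound (range (fun M => \sum_(n < M) cpw x n * r ^+ n)).
  by exists (expR (x * pgf q r)) => _ [M _ <-].
have cv := nondecreasing_cvgn nd ub; set L := sup _ in cv.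
suff -> : expR (x * pgf q r) = L by [].
apply/eqP; rewrite eq_le; apply/andP; split; last first.
  apply: (@ler_cvg_to nat \oo _ R _ (cst (expR (x * pgf q r))) _ _ cv); first exact: cvg_cst.
  exact: nearW.
have h K : \sum_(k < K) (x * pgf q r) ^+ k / k`!%:R <= L.
  rewrite -tE.
  have cK : \sum_(k < K) exp_term x k * \sum_(n < M) bgw_trans q k n * r ^+ n
      @[M --> \oo] --> \sum_(k < K) exp_term x k * pgf q r ^+ k.
    elim: K => [|K IH].
      rewrite big_ord0 (_ : (fun M => _) = cst 0); first exact: cvg_cst.
      by apply/funext => M; rewrite big_ord0.
    rewrite big_ord_recr (_ : (fun M => _) = (fun M => \sum_(k < K) exp_term x k *
        \sum_(n < M) bgw_trans q k n * r ^+ n +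
        exp_term x K * \sum_(n < M) bgw_trans q K n * r ^+ n)).
      by apply: cvgD => //; apply: cvgM; [exact: cvg_cst|exact: bgw_trans_cvg].
    by apply/funext => M; rewrite big_ord_recr.
  apply: (@ler_cvg_to nat \oo _ R _ _ _ _ cK cv).
  near=> M; have KM : (K <= M)%N by near: M; exact: nbhs_infty_ge.
  rewrite (PE M)// -!(big_mkord xpredT (fun k =>
    exp_term x k * \sum_(n < M) bgw_trans q k n * r ^+ n)) (big_cat_nat _ KM)//= lerDl.
  apply: sumr_ge0 => k _; rewrite mulr_ge0// sumr_ge0// => i _.
  by rewrite mulr_ge0 ?bgw_trans_ge0// exprn_ge0.
apply: (@ler_cvg_to nat \oo _ R (fun K => \sum_(k < K) (x * pgf q r) ^+ k / k`!%:R) (cst L)).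
- exact: exp_partial_cvg.
- exact: cvg_cst.
- exact: nearW.
Unshelve. all: by end_near. Qed.

(* The coefficients are nonnegative, so the tail of the power series at z is
   bounded by its tail at the real point |z|, which tends to 0. *)
Lemma cpw_normc_le x z M : 0 <= x -> N z < 1 ->
  N (cexp (gf q z * x%:C%C) - \sum_(n < M) (cpw x n)%:C%C * z ^+ n) <=
  expR (x * pgf q (N z)) - \sum_(n < M) cpw x n * N z ^+ n.
Proof.
move=> x0 z1; have Nz := N01 z1; have /andP[n0 _] := Nz.
have e0 k : 0 <= exp_term x k by rewrite /exp_term divr_ge0// exprn_ge0.
set w := gf q z * x%:C%C; set S := \sum_(n < M) (cpw x n)%:C%C * _.
have hE := @exp_partial_cvg R (x * pgf q (N z)).
have hc := @ccvg_exp R w.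
have h : (\sum_(k < K) (x * pgf q (N z)) ^+ k / k`!%:R - \sum_(n < M) cpw x n * N z ^+ n)
   + N (\sum_(k < K) exp_term w k - cexp w) @[K --> \oo] -->
   (expR (x * pgf q (N z)) - \sum_(n < M) cpw x n * N z ^+ n) + 0.
  by apply: cvgD => //; apply: cvgB => //; exact: cvg_cst.
rewrite -[leRHS]addr0.
apply: (@ler_cvg_to nat \oo _ R (cst (N (cexp w - S))) _ _ _ (cvg_cst _) h).
near=> K; have MK : (M <= K)%N by near: K; exact: nbhs_infty_ge.
have -> : cexp w - S = (cexp w - \sum_(k < K) exp_term w k) +
    (\sum_(k < K) exp_term w k - S) by rewrite addrA subrK.
rewrite /cst; apply: le_trans (ler_normcD _ _) _; rewrite normcB addrC lerD2r.
rewrite /S (@cpw_partialE C (real_complex R) z K M x MK).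
rewrite (@cpw_partialE R idfun (N z) K M x MK) /= -!sumrB.
apply: le_trans (ler_normc_sum _ _ _) _; apply: ler_sum => k _.
have -> : exp_term w k = (exp_term x k)%:C%C * gf q z ^+ k.
  by rewrite -exp_term_real /exp_term /w exprMn -mulrA mulrC.
have -> : (x * pgf q (N z)) ^+ k / k`!%:R = exp_term x k * pgf q (N z) ^+ k.
  by rewrite /exp_term exprMn mulrAC.
rewrite -!mulrBr Normc.normcM normcC ger0_norm// ler_wpM2l//.
apply: (ccvg_tail_le (u := fun M => \sum_(n < M) (bgw_trans q k n)%:C%C * z ^+ n)
  (V := fun M => \sum_(n < M) bgw_trans q k n * N z ^+ n)).
- by move=> j Mj; apply: normc_partialB => //; exact: b0.
- exact: bgw_trans_ccvg.
- exact: bgw_trans_cvg.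
Unshelve. all: by end_near. Qed.

Lemma cpw_ccvg x z : 0 <= x -> N z < 1 ->
  ccvg (fun M => \sum_(n < M) (cpw x n)%:C%C * z ^+ n) (cexp (gf q z * x%:C%C)).
Proof.
move=> x0 z1; apply: (ccvg_le (e := fun M => expR (x * pgf q (N z)) -
    \sum_(n < M) cpw x n * N z ^+ n)) => [M|].
  by rewrite normcB; exact: cpw_normc_le.
rewrite -[X in _ --> X](subrr (expR (x * pgf q (N z)))); apply: cvgB; first exact: cvg_cst.
by apply: cpw_cvg => //; exact: N01.
Qed.

End compound_poisson.

(** * The integral representation *)

Section representation.
Context {R : realType} (q : probability nat R).
Hypothesis q0 : weight q 0 = 0.
Local Notation C := R[i].
Local Notation N := (@Normc.normc R).
Local Notation TR := (measurableTypeR R).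
Variables (al : R) (Lam : {measure set TR -> \bar R}).
Implicit Types (z : C) (x r : R) (nu : {measure set nat -> \bar R}).

(** The coefficient of z^n in the integrand of the representation; omitting n = 0 amounts to the
    subtraction of e^(-x) there. *)
Definition cpd n x : R :=
  (if n is 0%N then 0 else cpw q x n) * (expR (- x) * x `^ (- al)).

Lemma cpd_ge0 n x : 0 <= x -> 0 <= cpd n x.
Proof.
move=> x0; rewrite /cpd mulr_ge0 ?mulr_ge0 ?expR_ge0 ?powR_ge0//.
by case: n => // n; exact: cpw_ge0.
Qed.

Lemma measurable_cpd n (D : set TR) : measurable_fun D (cpd n : TR -> R).
Proof.
apply: measurable_funTS; apply: measurable_funM; last first.
  apply: measurable_funM; last exact: measurable_powR.
  have := @measurable_expRN R 1 setT; congr (measurable_fun _ _).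
  by apply/funext => x; rewrite mul1r.
case: n => [|n]; first exact: measurable_cst.
rewrite /cpw (_ : (fun x : TR => _) = (fun x : TR => \sum_(k < n.+2)
    (x ^+ k * k`!%:R^-1) * bgw_trans q k n.+1)); last by [].
apply: measurable_sum => k; apply: measurable_funM; last exact: measurable_cst.
apply: measurable_funM; last exact: measurable_cst.
exact: measurable_funX.
Qed.

Lemma cpd_partialE (S : comPzRingType) (f : {rmorphism R -> S}) (z : S) M x :
  \sum_(n < M.+1) f (cpd n x) * z ^+ n =
  (\sum_(n < M.+1) f (cpw q x n) * z ^+ n - 1) * f (expR (- x) * x `^ (- al)).
Proof.
rewrite !big_ord_recl /= /cpd mul0r rmorph0 mul0r add0r cpw0 rmorph1 expr0 mul1r.
rewrite [X in (X - 1)]addrC addrK mulr_suml; apply: eq_bigr => k _.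
by rewrite rmorphM mulrAC.
Qed.

Lemma wker_pgfE x r : wker al (1 - pgf q r) 1 x =
  (expR (x * pgf q r) - 1) * (expR (- x) * x `^ (- al)).
Proof.
rewrite /wker mul1r.
have -> : - ((1 - pgf q r) * x) = x * pgf q r + - x by ring.
by rewrite expRD; ring.
Qed.

Lemma cpd_cvg x r : 0 <= x -> 0 <= r < 1 ->
  \sum_(n < M) cpd n x * r ^+ n @[M --> \oo] --> wker al (1 - pgf q r) 1 x.
Proof.
move=> x0 r01; rewrite -cvg_shiftS wker_pgfE.
rewrite (_ : (fun M => _) = (fun M => (\sum_(n < M.+1) cpw q x n * r ^+ n - 1) *
    (expR (- x) * x `^ (- al)))); last first.
  by apply/funext => M; exact: (@cpd_partialE R idfun).
apply: cvgM; last exact: cvg_cst.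
apply: cvgB; last exact: cvg_cst.
by rewrite (cvg_shiftS (fun M => \sum_(n < M) cpw q x n * r ^+ n)); exact: cpw_cvg.
Qed.

Lemma cpd_ccvg x z : 0 <= x -> N z < 1 ->
  ccvg (fun M => \sum_(n < M) (cpd n x)%:C%C * z ^+ n) (gf_integrand q al z x).
Proof.
move=> x0 z1; rewrite /ccvg -cvg_shiftS.
have h := cpw_ccvg q0 x0 z1; pose c := expR (- x) * x `^ (- al).
have -> : gf_integrand q al z x = (cexp (gf q z * x%:C%C) - 1) * c%:C%C.
  rewrite /gf_integrand -powRN [(gf q z - 1) * _]mulrBl mul1r cexp_subR /c rmorphM.
  ring.
rewrite (_ : (fun M => _) = (fun M => N (\sum_(n < M.+1) (cpw q x n)%:C%C * z ^+ n -
    cexp (gf q z * x%:C%C)) * `|c|)); last first.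
  apply/funext => M; rewrite (@cpd_partialE C (real_complex R)) -mulrBl.
  by rewrite Normc.normcM normcC opprB addrA subrK.
suff : N (\sum_(n < M.+1) (cpw q x n)%:C%C * z ^+ n - cexp (gf q z * x%:C%C)) * `|c|
    @[M --> \oo] --> 0 * `|c| by rewrite mul0r.
apply: cvgM; last exact: cvg_cst.
by rewrite (cvg_shiftS (fun M => N (\sum_(n < M) (cpw q x n)%:C%C * z ^+ n -
    cexp (gf q z * x%:C%C)))).
Qed.

Lemma cpd_normc_le x z M : 0 <= x -> N z < 1 ->
  N (\sum_(n < M) (cpd n x)%:C%C * z ^+ n) <= wker al (1 - pgf q (N z)) 1 x.
Proof.
move=> x0 z1; have Nz : 0 <= N z < 1 by rewrite normc_ge0.
have c0 n : 0 <= cpd n x by exact: cpd_ge0.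
apply: le_trans (partial_le_lim M c0 (normc_ge0 z) (@cpd_cvg _ _ x0 Nz)).
apply: le_trans (ler_normc_sum _ _ _) _; apply: ler_sum => n _.
by rewrite (@normc_real_term R (cpd^~ x)).
Qed.

(** The representation read coefficientwise: the value that nu must take at n. *)
Definition levy_weight n : \bar R := (\int[Lam]_(x in posreals R) (cpd n x)%:E)%E.

Lemma levy_weight_ge0 n : (0 <= levy_weight n)%E.
Proof. by apply: integral_ge0 => x x0; rewrite lee_fin cpd_ge0// ltW. Qed.

Lemma levy_weight_egf r : 0 <= r < 1 ->
  egf levy_weight r = wint Lam al (1 - pgf q r) 1.
Proof.
move=> r01; have /andP[r0 _] := r01; have mp := measurable_posreals (R := R).
transitivity (\sum_(n <oo) \int[Lam]_(x in posreals R) (cpd n x * r ^+ n)%:E)%E.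
  apply: eq_eseriesr => n _; under eq_integral do rewrite EFinM.
  rewrite ge0_integralZr//.
  - by apply/measurable_EFinP; exact: measurable_cpd.
  - by move=> x x0; rewrite lee_fin cpd_ge0// ltW.
  - by rewrite lee_fin exprn_ge0.
rewrite -integral_nneseries//; last 2 first.
- move=> n; apply/measurable_EFinP; apply: measurable_funM; last exact: measurable_cst.
  exact: measurable_cpd.
- by move=> n x x0; rewrite lee_fin mulr_ge0 ?exprn_ge0 ?cpd_ge0// ltW.
apply: eq_integral => x; rewrite inE => /ltW x0.
have -> : (wker al (1 - pgf q r) 1 x)%:E = egf (EFin \o (cpd^~ x)) r.
  by apply/esym/egf_cvg => // [n|]; [exact: cpd_ge0|exact: cpd_cvg].
by apply: eq_eseriesr => n _; rewrite EFinM.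
Qed.

Lemma weight_levy_weight nu : gf_finite nu ->
  (forall r, 0 <= r < 1 -> wint Lam al (1 - pgf q r) 1 = (ngf nu r)%:E) ->
  levy_weight = EFin \o weight nu.
Proof.
move=> nuoo h; apply: (@egf_inj _ _ _ 1) => //.
- exact: levy_weight_ge0.
- by move=> k; rewrite lee_fin weight_ge0.
- by move=> r /andP[/ltW r0 r1]; apply: nuoo; rewrite r0.
- by move=> r /andP[/ltW r0 r1]; rewrite levy_weight_egf ?h ?ngf_egf// r0.
Qed.

Lemma exists_measure_nat (a : nat -> R) : (forall k, 0 <= a k) ->
  exists nu, forall k, nu [set k] = (a k)%:E.
Proof.
move=> a0; exists (mseries (fun k => mscale (NngNum (a0 k)) (dirac k)) 0) => k.
rewrite /= /mseries (@nneseriesD1 _ _ k)//= /mscale/= diracE mem_set// mule1.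
rewrite eseries0 ?adde0// => j _ jk.
by rewrite diracE memNset ?mule0// => /= e; move: jk; rewrite -e eqxx.
Qed.

Lemma exists_levy_gf :
  (forall r, 0 <= r < 1 -> (wint Lam al (1 - pgf q r) 1 < +oo)%E) ->
  exists nu, [/\ Nstar_measure nu, gf_finite nu
    & forall r, 0 <= r < 1 -> wint Lam al (1 - pgf q r) 1 = (ngf nu r)%:E].
Proof.
move=> fin; have h12 : 0 <= (1 / 2 : R) < 1 by apply/andP; split; lra.
(* Convergence of the series at the single point 1/2 makes every coefficient finite. *)
have lw n : (levy_weight n < +oo)%E.
  apply: (@egf_coef_lty _ levy_weight (1 / 2)); first exact: levy_weight_ge0.
    lra.
  by rewrite levy_weight_egf// fin.
have lwf n : levy_weight n \is a fin_num by rewrite ge0_fin_numE ?levy_weight_ge0.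
have [|nu hnu] := @exists_measure_nat (fine \o levy_weight).
  by move=> k; rewrite fine_ge0// levy_weight_ge0.
have wE : EFin \o weight nu = levy_weight.
  by apply/funext => k; rewrite /weight /= hnu /= fineK.
have nuoo : gf_finite nu by move=> r r01; rewrite wE levy_weight_egf// fin.
exists nu; split => //; last by move=> r r01; rewrite -ngf_egf// wE levy_weight_egf.
split; last by move=> n; rewrite hnu ltry.
rewrite hnu /= /levy_weight integral0_eq// => x _.
by rewrite /cpd mul0r.
Qed.

Lemma posreals_integrable (f : R -> R) (l : R) : measurable_fun (posreals R) (f : TR -> R) ->
  (forall x, 0 <= x -> 0 <= f x) ->
  (\int[Lam]_(x in posreals R) (f x)%:E = l%:E)%E ->
  Lam.-integrable (posreals R) (EFin \o (f : TR -> R)).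
Proof.
move=> mf f0 fl; apply/integrableP; split; first exact/measurable_EFinP.
suff -> : (\int[Lam]_(x in posreals R) `|(EFin \o f) x| = l%:E)%E by rewrite ltry.
by rewrite -fl; apply: eq_integral => x; rewrite inE => /ltW x0; rewrite gee0_abs// lee_fin f0.
Qed.

(** phi stands for the real or the imaginary part. Partial sums at z are dominated, whatever their
    length, by the kernel at the real point |z|, whose integral is finite by hypothesis. *)
Lemma levy_integral (phi : {additive C -> R}) nu z :
  (forall (a : R) (u : C), phi (a%:C%C * u) = a * phi u) ->
  (forall u, `|phi u| <= N u) ->
  gf_finite nu ->
  (forall r, 0 <= r < 1 -> wint Lam al (1 - pgf q r) 1 = (ngf nu r)%:E) ->
  N z < 1 ->
  Lam.-integrable (posreals R) (fun x => (phi (gf_integrand q al z x))%:E) /\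
  phi (\sum_(k < n) (weight nu k)%:C%C * z ^+ k) @[n --> \oo] -->
    \int[Lam]_(x in posreals R) phi (gf_integrand q al z x).
Proof.
move=> phiZ phiN nuoo h z1; have Nz : 0 <= N z < 1 by rewrite normc_ge0.
have mp := measurable_posreals (R := R).
have lw n : levy_weight n = (weight nu n)%:E by rewrite (weight_levy_weight nuoo h).
pose f_ M (x : TR) := (phi (\sum_(n < M) (cpd n x)%:C%C * z ^+ n))%:E.
have f_E M (x : TR) : f_ M x = (\sum_(n < M) (cpd n x)%:E * (phi (z ^+ n))%:E)%E.
  by rewrite /f_ raddf_sum -sumEFin; apply: eq_bigr => n _; rewrite phiZ EFinM.
have mcpd n (D : set TR) : measurable_fun D (fun x : TR => (cpd n x)%:E).
  by apply/measurable_EFinP; exact: measurable_cpd.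
have mf M : measurable_fun (posreals R) (f_ M).
  rewrite (_ : f_ M = (fun x => (\sum_(n < M) cpd n x * phi (z ^+ n))%:E)); last first.
    by apply/funext => x; rewrite f_E -sumEFin.
  apply/measurable_EFinP; apply: measurable_sum => n.
  by apply: measurable_funM; [exact: measurable_cpd|exact: measurable_cst].
have fcvg x : posreals R x ->
    f_ M x @[M --> \oo] --> (phi (gf_integrand q al z x))%:E.
  move=> /ltW x0; apply: cvg_EFin; first exact: nearW.
  exact: (ccvg_additive phiN (cpd_ccvg x0 z1)).
have [|||||i1 _ i2] := @dominated_convergence _ _ _ Lam (posreals R) mp f_
  (fun x => (phi (gf_integrand q al z x))%:E)
  (fun x => (wker al (1 - pgf q (N z)) 1 x)%:E).
- exact: mf.
- by apply: (emeasurable_fun_cvg f_) => // x px; exact: fcvg.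
- by apply: aeW => x px; exact: fcvg.
- apply: (posreals_integrable _ _ (h _ Nz)); first exact: measurable_wker.
  by move=> x x0; rewrite wker_ge0// gerBl pgf_ge0// normc_ge0.
- apply: aeW => x M /ltW x0; rewrite abse_EFin lee_fin.
  by apply: le_trans (phiN _) _; exact: cpd_normc_le.
split => //; move: i2.
rewrite (_ : [sequence _]_n = EFin \o
  (fun n => phi (\sum_(k < n) (weight nu k)%:C%C * z ^+ k))).
  have -> : (\int[Lam]_(x in posreals R) (phi (gf_integrand q al z x))%:E)%E =
      (\int[Lam]_(x in posreals R) phi (gf_integrand q al z x))%:E.
    by rewrite /Rintegral fineK//; exact: integrable_fin_num.
  by move=> /fine_cvg.
apply/funext => M; rewrite /=.
have icpd n : Lam.-integrable (posreals R) (fun x : TR => (cpd n x)%:E).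
  by apply: (posreals_integrable _ _ (lw n)); [exact: measurable_cpd|exact: cpd_ge0].
under eq_integral do rewrite f_E.
rewrite integral_sum//; last by move=> n; exact: integrableZr.
rewrite raddf_sum -sumEFin; apply: eq_bigr => n _.
by rewrite integralZr// phiZ EFinM -lw.
Qed.

Lemma gf_representationP nu : Nstar_measure nu ->
  gf_representation q al Lam nu <->
  gf_finite nu /\
  forall r, 0 <= r < 1 -> wint Lam al (1 - pgf q r) 1 = (ngf nu r)%:E.
Proof.
move=> hnu; have nu0 := Nstar_weight0 hnu; split=> [rep|[nuoo h] z].
  suff h r : 0 <= r < 1 -> exists2 l : R, wint Lam al (1 - pgf q r) 1 = l%:E &
      egf (EFin \o weight nu) r = l%:E.
    have nuoo : gf_finite nu by move=> r /h[l _ ->]; rewrite ltry.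
    by split=> // r r01; have [l -> e] := h r r01; rewrite -ngf_egf.
  move=> r01; have /andP[r0 r1] := r01.
  have [[int _] cv] : cintegrable Lam (posreals R) (gf_integrand q al r%:C%C) /\
    gf_partial nu r%:C%C @ \oo -->
      (cintegral Lam (posreals R) (gf_integrand q al r%:C%C) : C^o).
    by apply: rep; rewrite norm_normc ltcR normcC ger0_norm.
  (* At a real point the integrand is real and equals the kernel, so the complex statement contains
     the real one. *)
  have iE x : gf_integrand q al r%:C%C x = (wker al (1 - pgf q r) 1 x)%:C%C.
    rewrite /gf_integrand gf_real//.
    have -> : ((pgf q r)%:C%C - 1) * x%:C%C = (- ((1 - pgf q r) * x))%:C%C.
      by rewrite -mulNr opprB rmorphM rmorphB.
    by rewrite cexp_real -rmorphB -rmorphM /wker powRN mul1r.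
  have wE : wint Lam al (1 - pgf q r) 1 =
      (\int[Lam]_(x in posreals R) complex.Re (gf_integrand q al r%:C%C x))%:E.
    have fn := integrable_fin_num (measurable_posreals (R := R)) int.
    rewrite /wint /Rintegral (fineK fn).
    by apply: eq_integral => x _; rewrite iE.
  exists (\int[Lam]_(x in posreals R) complex.Re (gf_integrand q al r%:C%C x)) => //.
  apply/egf_cvg => //; first by move=> k; exact: weight_ge0.
  have /ccvgP/ccvg_Re := cv; rewrite /cintegral /=.
  rewrite (_ : (fun n => complex.Re _) = (fun n => \sum_(k < n) weight nu k * r ^+ k))//.
  apply/funext => n; rewrite gf_partialE// raddf_sum; apply: eq_bigr => k _.
  by rewrite -rmorphXn -rmorphM.
(* Conversely, the real identity fixes all coefficients, by [weight_levy_weight], and thereby the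
   sum at complex z. *)
rewrite norm_normc ltcR => z1.
have [i1 c1] := levy_integral (phi := @complex.Re R) (fun a u =>
  ltac:(by case: u => x y /=; rewrite mul0r subr0)) (@Re_le_normc R) nuoo h z1.
have [i2 c2] := levy_integral (phi := @complex.Im R) (fun a u =>
  ltac:(by case: u => x y /=; rewrite mul0r addr0)) (@Im_le_normc R) nuoo h z1.
split=> //; apply/ccvgP; apply: ccvg_ReIm.
  by rewrite (_ : (fun n => _) = fun n =>
    complex.Re (\sum_(k < n) (weight nu k)%:C%C * z ^+ k))//; apply/funext => n; rewrite gf_partialE.
by rewrite (_ : (fun n => _) = fun n =>
  complex.Im (\sum_(k < n) (weight nu k)%:C%C * z ^+ k))//; apply/funext => n; rewrite gf_partialE.
Qed.

End representation.

(** * Invariance, uniqueness of Lambda and radius of convergence *)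

Section characterization.
Context {R : realType} (p : probability nat R) (m : R).
Hypothesis m0 : 0 < m.
Hypothesis m1 : m < 1.
Hypothesis mean : (\int[p]_k (k%:R : R)%:E)%E = m%:E.
Context (d : measure_display) (Omega : measurableType d)
    (P1 : probability Omega R) (Z : nat -> {RV P1 >-> nat}).
Hypothesis hZ : bgw_process p 1 Z.
Context (nu_min : probability nat R).
Hypothesis hY : yaglom_limit Z nu_min.
Variable (al : R).
Hypothesis al1 : al < 1.
Local Notation TR := (measurableTypeR R).
Implicit Types (nu : {measure set nat -> \bar R}) (Lam : {measure set TR -> \bar R}).
Implicit Types (r s t : R).

Lemma wint_pgf_lty Lam r : posreals_measure Lam -> scale_invariant m Lam ->
  0 <= r < 1 -> (wint Lam al (1 - pgf nu_min r) 1 < +oo)%E.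
Proof.
move=> Lpos Lscale r01; apply: (wint_lty m0 m1 Lpos Lscale al1).
  by apply: pgf_compl_gt0; rewrite // /weight hY.1.1.
by rewrite gerBl pgf_ge0//; case/andP: r01.
Qed.

Lemma wint_scaleX Lam n s t : scale_invariant m Lam -> s <= t ->
  (wint Lam al (m ^+ n * s) (m ^+ n * t) = ((m `^ al) ^+ n)%:E * wint Lam al s t)%E.
Proof.
move=> Lscale st; elim: n => [|n IH]; first by rewrite !expr0 !mul1r mul1e.
have h : m ^+ n * s <= m ^+ n * t by rewrite ler_wpM2l// exprn_ge0// ltW.
by rewrite !exprS -!mulrA (wint_scale m0 Lscale al h) IH EFinM muleA.
Qed.

Lemma invariant_of_levy Lam nu : scale_invariant m Lam -> Nstar_measure nu -> gf_finite nu ->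
  (forall r, 0 <= r < 1 -> wint Lam al (1 - pgf nu_min r) 1 = (ngf nu r)%:E) ->
  invariant_measure p (m `^ al) nu.
Proof.
move=> Lscale hnu nuoo h; apply/(invariantP m0 m1 mean hnu (powR_ge0 _ _)); split => // r r01.
have z01 : 0 <= (0 : R) < 1 by rewrite lexx ltr01.
have F01 s : 0 <= s < 1 -> 0 <= pgf p s < 1.
  by move=> s01; rewrite (pgf_lt1 m0 mean s01) pgf_ge0//; case/andP: s01.
have yE s (s01 : 0 <= s < 1) := yaglom_pgfE m0 m1 mean hZ hY s01.
have e0 : wint Lam al m 1 = (ngf nu (pgf p 0))%:E.
  by rewrite -(h _ (F01 _ z01)) (yE _ z01) (yaglom_pgf0 hY) subr0 mulr1.
apply: EFin_inj; rewrite EFinD EFinM -e0 -(h _ (F01 _ r01)) -(h _ r01) (yE _ r01) addeC.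
have r0 : 0 <= r by case/andP: r01.
have H1 : 1 - pgf nu_min r <= 1 by rewrite gerBl pgf_ge0.
rewrite (@wintD _ _ _ _ m); last 2 first.
- by rewrite -[leRHS]mulr1 ler_wpM2l// ltW.
- exact: ltW.
by rewrite -[X in wint _ _ _ X]mulr1 wint_scale.
Qed.

(** The representation gives integrals between some s < 1 and 1, while [levy_unique] asks for those
    between s and s + 1 with s >= 1. Scaling by m^n brings the latter below 1, where they are
    differences of the former; the subtracted integral is finite. *)
Lemma levy_unique_scale Lam1 Lam2 :
  posreals_measure Lam1 -> scale_invariant m Lam1 ->
  posreals_measure Lam2 -> scale_invariant m Lam2 ->
  (forall r, 0 < r < 1 ->
    wint Lam1 al (1 - pgf nu_min r) 1 = wint Lam2 al (1 - pgf nu_min r) 1) ->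
  forall A, measurable A -> Lam1 A = Lam2 A.
Proof.
move=> Lp1 Ls1 Lp2 Ls2 E; apply: (@levy_unique _ al Lam1 Lam2 Lp1.1 Lp2.1).
  by move=> s s1; apply: (wint_lty m0 m1 Lp1 Ls1 al1); rewrite ?lerDl//; lra.
have mn0 n : 0 < m ^+ n by rewrite exprn_gt0.
have E1 s : 0 < s -> s < 1 -> wint Lam1 al s 1 = wint Lam2 al s 1.
  move=> s0 s1; have [|r r01 <-] := @survival_onto _ p m m0 m1 mean _ _ _ _ hZ _ hY s.
    by rewrite s0.
  exact: E.
move=> s s1; have s0 : 0 < s by lra.
have s10 : 0 < s + 1 by lra.
have [n hn] : exists n, m ^+ n * (s + 1) < 1.
  have [|n h] := @exists_expr_lt _ m (s + 1)^-1 m0 m1; first by rewrite invr_gt0.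
  by exists n; rewrite -ltr_pdivlMr// mul1r.
have ns : m ^+ n * s < 1 by apply: le_lt_trans hn; rewrite ler_wpM2l ?(ltW (mn0 n))// lerDl.
have ss : s <= s + 1 by rewrite lerDl.
have mss : m ^+ n * s <= m ^+ n * (s + 1) by rewrite ler_wpM2l// ltW.
have la0 : (m `^ al) ^+ n != 0 by rewrite expf_neq0// gt_eqF// powR_gt0.
have key : (((m `^ al) ^+ n)%:E * wint Lam1 al s (s + 1) =
            ((m `^ al) ^+ n)%:E * wint Lam2 al s (s + 1))%E.
  rewrite -!wint_scaleX//.
  have msn0 : 0 < m ^+ n * (s + 1) by rewrite mulr_gt0.
  have := E1 _ (mulr_gt0 (mn0 n) s0) ns; rewrite !(wintD _ _ mss (ltW hn)) (E1 _ msn0 hn).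
  have fin : wint Lam2 al (m ^+ n * (s + 1)) 1 \is a fin_num.
    rewrite ge0_fin_numE ?wint_ge0 ?(ltW hn)//.
    by apply: (wint_lty m0 m1 Lp2 Ls2 al1) => //; exact: ltW.
  by move=> h; rewrite -[LHS](addeK _ fin) h addeK.
have inv : (((m `^ al) ^+ n)^-1%:E * ((m `^ al) ^+ n)%:E = 1)%E.
  by rewrite -EFinM mulVf.
by rewrite -[LHS]mul1e -[RHS]mul1e -inv -!muleA key.
Qed.

Lemma conv_radius_ge1 nu : gf_finite nu -> (1 <= conv_radius (weight nu))%E.
Proof.
move=> nuoo; apply/lee_addgt0Pr => e e0.
(* Convergence is known strictly inside the disc only, so 1 is approached by admissible radii. *)
pose r := Num.max 0 (1 - e).
have r0 : 0 <= r by rewrite /r le_max lexx.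
have r1 : r < 1 by rewrite /r gt_max ltr01 gtrBl.
have r1e : 1 <= r + e by rewrite -lerBlDr /r le_max lexx orbT.
apply: (@le_trans _ _ (r%:E + e%:E)%E); first by rewrite -EFinD lee_fin.
rewrite leeD2r//; apply: ereal_sup_ubound; exists r => //; split => //.
have := ngf_egf nuoo (introT andP (conj r0 r1)).
move=> /egf_cvg => /(_ (weight_ge0 nu) r0) h.
rewrite (_ : series _ = (fun n => \sum_(k < n) weight nu k * r ^+ k)).
  by apply/cvg_ex; exists (ngf nu r).
apply/funext => n; rewrite /series/= big_mkord; apply: eq_bigr => k _.
by rewrite ger0_norm// weight_ge0.
Qed.

End characterization.

Theorem theorem1 (R : realType) (m : R) (hm0 : 0 < m) (hm1 : m < 1)
    (p : probability nat R)
    (hmean : (\int[p]_k (k%:R : R)%:E)%E = m%:E)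
    (d : measure_display) (Omega : measurableType d)
    (P1 : probability Omega R) (Z : nat -> {RV P1 >-> nat})
    (hZ : bgw_process p 1 Z)
    (nu_min : probability nat R) (hY : yaglom_limit Z nu_min) :
  [/\ (forall lambda : R, lambda < m ->
        ~ exists nu : {measure set nat -> \bar R},
            [/\ Nstar_measure nu, invariant_measure p lambda nu
              & nu [set: nat] <> 0%E]),
      (forall nu : {measure set nat -> \bar R}, Nstar_measure nu ->
        (invariant_measure p m nu <->
         exists c : R, 0 <= c /\
           forall A : set nat, nu A = (c%:E * nu_min A)%E))
    & (forall alpha : R, alpha < 1 ->
        [/\ (forall nu : {measure set nat -> \bar R}, Nstar_measure nu ->
              (invariant_measure p (m `^ alpha) nu <->
               exists Lambda : {measure set (measurableTypeR R) -> \bar R},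
                 [/\ posreals_measure Lambda, scale_invariant m Lambda
                   & gf_representation nu_min alpha Lambda nu])),
            (forall (nu : {measure set nat -> \bar R})
                (Lambda1 Lambda2 :
                   {measure set (measurableTypeR R) -> \bar R}),
              Nstar_measure nu -> invariant_measure p (m `^ alpha) nu ->
              posreals_measure Lambda1 -> scale_invariant m Lambda1 ->
              gf_representation nu_min alpha Lambda1 nu ->
              posreals_measure Lambda2 -> scale_invariant m Lambda2 ->
              gf_representation nu_min alpha Lambda2 nu ->
              forall A : set (measurableTypeR R), measurable A ->
                Lambda1 A = Lambda2 A)
          & (forall Lambda : {measure set (measurableTypeR R) -> \bar R},
              posreals_measure Lambda -> scale_invariant m Lambda ->
              exists nu : {measure set nat -> \bar R},
                [/\ Nstar_measure nu, invariant_measure p (m `^ alpha) nu,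
                    gf_representation nu_min alpha Lambda nu
                  & (1 <= conv_radius (weight nu))%E])])].
Proof.
have q0 : weight nu_min 0 = 0 by rewrite /weight hY.1.1.
split.
- move=> lambda lm [nu [hnu inv nz]]; apply: nz.
  exact: (no_invariant_lt hm0 hm1 hmean hZ hY lm hnu inv).
- by move=> nu hnu; exact: (invariant_mE hm0 hm1 hmean hZ hY hnu).
move=> alpha al1; split.
- move=> nu hnu; split=> [inv|[Lam [Lpos Lscale]]].
    have [Lam [Lpos Lscale h]] := levy_of_invariant hm0 hm1 hmean hZ hY hnu inv al1.
    exists Lam; split => //; apply/gf_representationP => //; split => //.
    exact: ((invariantP hm0 hm1 hmean hnu (powR_ge0 _ _)).1 inv).1.
  move=> /(gf_representationP q0 alpha Lam hnu)[nuoo h].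
  exact: (invariant_of_levy hm0 hm1 hmean hZ hY Lscale hnu nuoo h).
- move=> nu L1 L2 hnu _ p1 s1 /(gf_representationP q0 alpha L1 hnu)[_ h1].
  move=> p2 s2 /(gf_representationP q0 alpha L2 hnu)[_ h2].
  apply: (levy_unique_scale hm0 hm1 hmean hZ hY al1 p1 s1 p2 s2) => r /andP[/ltW r0 r1].
  by rewrite h1 ?h2 ?r0.
move=> Lam Lpos Lscale.
have [r r01|nu [hnu nuoo h]] := @exists_levy_gf _ nu_min q0 alpha Lam.
  exact: (wint_pgf_lty hm0 hm1 hY al1 Lpos Lscale).
exists nu; split => //.
- exact: (invariant_of_levy hm0 hm1 hmean hZ hY Lscale hnu nuoo h).
- exact/(gf_representationP q0 alpha Lam hnu).
- exact: conv_radius_ge1.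
Qed.
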